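(* As $N\to\infty$, the random probability measures $\hat\mu^N$ converge weakly to $\mu$, in probability; that is, for any metric $\rho$ metrizing weak convergence of probability measures on $\mathbb{R}^d\times\mathbb{R}^d$, $\rho(\hat\mu^N,\mu)\to 0$ in probability.
   Context: Let $P,Q$ be Borel probability measures on $\mathbb{R}^d$, and let $\Pi(P,Q)$ be the set of probability measures on $\mathbb{R}^d\times\mathbb{R}^d$ with marginals $P$ and $Q$. Let $\mu\in\Pi(P,Q)$ be absolutely continuous with respect to $P\otimes Q$, with density $\xi=\frac{d\mu}{d(P\otimes Q)}\in L^1(P\otimes Q)$. Define $\mathcal{A}:L^2(P)\to L^2(Q)$ and its adjoint $\mathcal{A}^*:L^2(Q)\to L^2(P)$ by $(\mathcal{A}f)(y)=\int f(x)\xi(x,y)\,dP(x)$ and $(\mathcal{A}^*g)(x)=\int g(y)\xi(x,y)\,dQ(y)$. Standing assumptions: (i) $\xi\in L^2(P\otimes Q)$; consequently $\mathcal{A}$ is compact and there are eigenvalue decompositions $\mathcal{A}^*\mathcal{A}\alpha_k=s_k^2\alpha_k$, $\mathcal{A}\mathcal{A}^*\beta_k=s_k^2\beta_k$, $k\ge 0$, with $s_0=1$, $\alpha_0=\beta_0=\mathbf{1}$, $0\le s_k\le 1$, $\mathcal{A}\alpha_k=s_k\beta_k$, $\mathcal{A}^*\beta_k=s_k\alpha_k$ (the $s_k$ are the singular values of $\mathcal{A}$). (ii) Spectral gap: $s_k\le s_1<1$ for all $k\ge 1$. Let $X_1,X_2,\dots$ be i.i.d. from $P$ and $Y_1,Y_2,\dots$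 i.i.d. from $Q$, the two sequences being independent. Let $\mathcal{S}_N$ be the set of permutations of $\{1,\dots,N\}$ and, for $\sigma\in\mathcal{S}_N$, $\xi^{\otimes}(X,Y_\sigma):=\prod_{i=1}^N\xi(X_i,Y_{\sigma_i})$. Define $$\hat\mu^N:=\frac{\frac1{N!}\sum_{\sigma\in\mathcal{S}_N}\Big(\frac1N\sum_{i=1}^N\delta_{(X_i,Y_{\sigma_i})}\Big)\xi^{\otimes}(X,Y_\sigma)}{\frac1{N!}\sum_{\sigma\in\mathcal{S}_N}\xi^{\otimes}(X,Y_\sigma)}$$ (on the event that the denominator vanishes, $\hat\mu^N$ is assigned an arbitrary fixed probability measure). *)

(* Defs.v *)
From HB Require Import structures.
From mathcomp Require Import all_boot all_order all_algebra all_fingroup.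
From mathcomp Require Import finmap.
From mathcomp Require Import all_classical all_reals all_analysis.

Set Implicit Arguments.
Unset Strict Implicit.
Unset Printing Implicit Defensive.
Import Order.TTheory GRing.Theory Num.Theory.
Import numFieldNormedType.Exports.
Local Open Scope classical_set_scope.
Local Open Scope ring_scope.

(* [open] generates the Borel sigma-algebra on matrices, in particular on
   R^d = 'rV[R]_d.  On 'rV[R]_d * 'rV[R]_d the library uses the product
   sigma-algebra, which is the Borel one because R^d is second countable. *)
HB.instance Definition _ (R : realType) (m n : nat) :=
  @isMeasurable.Build (sigma_display (@open 'M[R]_(m, n))) 'M[R]_(m, n)
    <<s @open 'M[R]_(m, n) >> (@sigma_algebra0 _ setT _)
    (@sigma_algebraC _ _) (@sigma_algebra_bigcup _ setT _).

Section couplings.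
Context d1 d2 (T1 : measurableType d1) (T2 : measurableType d2) (R : realType).
Implicit Types (P : probability T1 R) (Q : probability T2 R).

Definition is_coupling P Q (mu : probability (T1 * T2)%type R) :=
  (forall A, measurable A -> mu (fst @^-1` A) = P A) /\
  (forall B, measurable B -> mu (snd @^-1` B) = Q B).

End couplings.

(* f is a version of d mu / d nu with finite values; absolute continuity of mu
   follows. *)
Definition is_density d (T : measurableType d) (R : realType)
    (nu mu : {measure set T -> \bar R}) (f : T -> R) :=
  measurable_fun [set: T] f /\
  forall A, measurable A -> mu A = (\int[nu]_(z in A) (f z)%:E)%E.

Section singular_systems.
Context d1 d2 (T1 : measurableType d1) (T2 : measurableType d2) (R : realType).
Variables (P : probability T1 R) (Q : probability T2 R) (xi : T1 * T2 -> R).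

(* For f and xi in L^2 the integrand is integrable for almost every y; at the
   other points the real-valued integral takes a junk value, so identities
   about these operators are only stated almost everywhere. *)
Definition opA (f : T1 -> R) (y : T2) : R := \int[P]_x (f x * xi (x, y)).
Definition opA_adj (g : T2 -> R) (x : T1) : R := \int[Q]_y (g y * xi (x, y)).

End singular_systems.

(* An orthonormal basis of L^2(P) indexed by all of nat: when L^2(P) is finite
   dimensional, or when some indices are not needed, the sequence is padded
   with null functions. *)
Record is_padded_onb d (T : measurableType d) (R : realType)
    (P : probability T R) (e : nat -> T -> R) : Prop := {
  onb_L2 : forall k, e k \in Lfun P 2%:E ;
  onb_norm : forall k, \int[P]_x (e k x * e k x) = 1 \/ e k = cst 0 %[ae P] ;
  onb_orth : forall j k, j <> k -> \int[P]_x (e j x * e k x) = 0 ;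
  onb_complete : forall f, f \in Lfun P 2%:E ->
    (forall k, \int[P]_x (f x * e k x) = 0) -> f = cst 0 %[ae P] }.

(* Null vectors are only paired with s_k = 0; as the kernels of A and A^* may
   have different dimensions, padding cannot be avoided in general. *)
Record is_singular_system d1 d2 (T1 : measurableType d1)
    (T2 : measurableType d2) (R : realType) (P : probability T1 R)
    (Q : probability T2 R) (xi : T1 * T2 -> R) (s : nat -> R)
    (alpha : nat -> T1 -> R) (beta : nat -> T2 -> R) : Prop := {
  ss_alpha_onb : is_padded_onb P alpha ;
  ss_beta_onb : is_padded_onb Q beta ;
  ss_s_ge0_le1 : forall k, 0 <= s k <= 1 ;
  ss_nonnull : forall k, s k != 0 ->
    \int[P]_x (alpha k x * alpha k x) = 1 /\
    \int[Q]_y (beta k y * beta k y) = 1 ;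
  ss_s0 : s 0%N = 1 ;
  ss_alpha0 : alpha 0%N = cst 1 %[ae P] ;
  ss_beta0 : beta 0%N = cst 1 %[ae Q] ;
  ss_A : forall k,
    opA P xi (alpha k) = (fun y => s k * beta k y) %[ae Q] ;
  ss_Aadj : forall k,
    opA_adj Q xi (beta k) = (fun x => s k * alpha k x) %[ae P] ;
  ss_AadjA : forall k, opA_adj Q xi (opA P xi (alpha k)) =
    (fun x => s k ^+ 2 * alpha k x) %[ae P] ;
  ss_AAadj : forall k, opA P xi (opA_adj Q xi (beta k)) =
    (fun y => s k ^+ 2 * beta k y) %[ae Q] }.

Definition spectral_gap (R : realType) (s : nat -> R) :=
  (forall k, (1 <= k)%N -> s k <= s 1%N) /\ s 1%N < 1.

Section independence.
Context d d' (Om : measurableType d) (T : measurableType d') (R : realType).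
Variable Pr : probability Om R.
Implicit Types X Y : nat -> {RV Pr >-> T}.

Definition mutually_independent X :=
  forall (J : {fset nat}) (A : nat -> set T), (forall i, measurable (A i)) ->
    Pr (\bigcap_(i in [set` J]) (X i @^-1` A i)) =
    (\prod_(i <- J) Pr (X i @^-1` A i))%E.

Definition iid X (P : probability T R) :=
  mutually_independent X /\
  forall i A, measurable A -> distribution Pr (X i) A = P A.

Definition sigma_of X : set (set Om) :=
  <<s \bigcup_i g_sigma_algebra_preimage (X i) >>.

Definition independent_sequences X Y :=
  forall A B, sigma_of X A -> sigma_of Y B ->
    Pr (A `&` B) = (Pr A * Pr B)%E.

End independence.

Section finite_sum_of_measures.
Context d (T : measurableType d) (R : realType) (I : finType).
Variable m : I -> {measure set T -> \bar R}.
Local Open Scope ereal_scope.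

Definition fin_msum (A : set T) : \bar R := \sum_(i : I) m i A.

Let fin_msum0 : fin_msum set0 = 0. Proof. by rewrite /fin_msum big1. Qed.

Let fin_msum_ge0 A : 0 <= fin_msum A.
Proof. by rewrite /fin_msum; apply: sume_ge0. Qed.

Let fin_msum_sigma_additive : semi_sigma_additive fin_msum.
Proof.
move=> F mF tF mUF; rewrite [X in _ --> X](_ : _ =
    lim ((fun n => \sum_(0 <= i < n) fin_msum (F i)) @ \oo)).
  by apply: is_cvg_ereal_nneg_natsum => k _; exact: sume_ge0.
rewrite nneseries_sum//; apply: eq_bigr => /= i _.
exact: measure_semi_bigcup.
Qed.

HB.instance Definition _ := isMeasure.Build _ _ _ fin_msum
  fin_msum0 fin_msum_ge0 fin_msum_sigma_additive.

End finite_sum_of_measures.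

Section empirical.
Context d1 d2 (T1 : measurableType d1) (T2 : measurableType d2) (R : realType).
Variables (xi : {nnfun (T1 * T2)%type >-> R}).
Variable nu0 : probability (T1 * T2)%type R.
Variables (N : nat) (x : nat -> T1) (y : nat -> T2).

Definition xi_tensor (sigma : 'S_N) : R :=
  \prod_(i < N) xi (x i, y (sigma i)).

Definition muhat_num (A : set (T1 * T2)) : \bar R :=
  ((N`!%:R^-1)%:E * \sum_(sigma : 'S_N)
    (xi_tensor sigma)%:E *
    ((N%:R^-1)%:E * \sum_(i < N) \d_(x i, y (sigma i)) A))%E.

Definition muhat_den : R := N`!%:R^-1 * \sum_(sigma : 'S_N) xi_tensor sigma.

(* For N = 0 there is no empirical measure and the default is used as well. *)
Definition muhat (A : set (T1 * T2)) : \bar R :=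
  if (N == 0%N) || (muhat_den == 0) then nu0 A
  else ((muhat_den^-1)%:E * muhat_num A)%E.

Let xi_tensor_ge0 sigma : 0 <= xi_tensor sigma.
Proof. by apply: prodr_ge0 => i _; exact: fun_ge0. Qed.

Let invn_ge0 n : 0 <= n%:R^-1 :> R. Proof. by rewrite invr_ge0. Qed.

Let invden_ge0 : 0 <= muhat_den^-1.
Proof. by rewrite invr_ge0 mulr_ge0// sumr_ge0. Qed.

Let num_measure : {measure set (T1 * T2) -> \bar R} :=
  mscale (NngNum (invn_ge0 N`!)) (fin_msum (fun sigma : 'S_N =>
    mscale (NngNum (xi_tensor_ge0 sigma)) (mscale (NngNum (invn_ge0 N))
      (fin_msum (fun i : 'I_N => \d_(x i, y (sigma i))))))).

Let muhat_measure : {measure set (T1 * T2) -> \bar R} :=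
  if (N == 0%N) || (muhat_den == 0) then nu0 : {measure set _ -> \bar R}
  else mscale (NngNum invden_ge0) num_measure : {measure set _ -> \bar R}.

Let muhatE : muhat = muhat_measure.
Proof. by apply/funext => A; rewrite /muhat /muhat_measure; case: ifP. Qed.

Let muhat0 : muhat set0 = 0%E.
Proof. by rewrite muhatE measure0. Qed.

Let muhat_ge0 A : (0 <= muhat A)%E.
Proof. by rewrite muhatE measure_ge0. Qed.

Let muhat_sigma_additive : semi_sigma_additive muhat.
Proof. by rewrite muhatE; exact: measure_semi_sigma_additive. Qed.

HB.instance Definition _ := isMeasure.Build _ _ _ muhat
  muhat0 muhat_ge0 muhat_sigma_additive.

Let muhatT : muhat [set: T1 * T2] = 1%E.
Proof.
rewrite /muhat; case: ifPn => [_|]; first by rewrite probability_setT.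
rewrite negb_or => /andP[N0 den0].
suff -> : muhat_num [set: T1 * T2] = muhat_den%:E by rewrite -EFinM mulVf.
rewrite /muhat_num /muhat_den EFinM -sumEFin; congr (_ * _)%E.
apply: eq_bigr => sigma _.
under eq_bigr do rewrite diracT.
have NR0 : N%:R != 0 :> R by rewrite pnatr_eq0.
by rewrite sumEFin sumr_const card_ord -!EFinM mulVf// mulr1.
Qed.

HB.instance Definition _ := Measure_isProbability.Build _ _ _ muhat muhatT.

Definition muhat_prob : probability (T1 * T2)%type R := muhat.

End empirical.

Section weak_convergence.
Context (R : realType) (d : nat).
Let E : Type := ('rV[R]_d * 'rV[R]_d)%type.

Definition cvg_weakly (nu_ : nat -> probability E R) (nu : probability E R) :=
  forall f : E -> R, continuous f -> [bounded f z | z in [set: E]] ->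
    (fun n => \int[nu_ n]_z f z) @ \oo --> \int[nu]_z f z.

(* Elements of [probability E R] are functions on all subsets of E and may
   differ on non-measurable sets, hence equality on measurable sets instead of
   Leibniz equality in [mw_eq0]. *)
Record metrizes_weak_cvg (rho : probability E R -> probability E R -> R)
    : Prop := {
  mw_ge0 : forall m n, 0 <= rho m n ;
  mw_eq0 : forall m n, rho m n = 0 <-> (forall A, measurable A -> m A = n A) ;
  mw_sym : forall m n, rho m n = rho n m ;
  mw_triangle : forall m n p, rho m p <= rho m n + rho n p ;
  mw_cvg : forall nu_ nu, cvg_weakly nu_ nu <->
    (fun n => rho (nu_ n) nu) @ \oo --> 0 }.

End weak_convergence.

(* The outer measure [mu_ext Pr] agrees with [Pr] on events; it gives a meaning
   to the formula without a measurability requirement on [Z n]. *)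
Definition cvg_in_probability d (Om : measurableType d) (R : realType)
    (Pr : probability Om R) (Z : nat -> Om -> R) (z : R) :=
  forall eps : R, 0 < eps ->
    (fun n => mu_ext Pr [set w | eps <= `|Z n w - z|]) @ \oo --> 0%E.

(* Main.v *)
(** Let D_N be the denominator of the random measure. For a measurable set B, the
    difference between its random mass and mu(B) is a mean, over permutations
    weighted by the tensorised density, of centred averages S_sigma, so that its
    square is at most V_N / D_N, where V_N is the weighted mean of the S_sigma^2.
    Under the weight of a fixed permutation the matched pairs are i.i.d. with law
    mu, hence E V_N = O(1/N), and it remains to keep D_N away from 0.

    By Parseval on the sections of xi, the kernels
    1 + sum_(1 <= k < n) s_k alpha_k(x) beta_k(y) tend to xi in L^2. For such a
    kernel, expanding the products turns D_N into a sum over pairs of words with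
    the same letter counts, and these word products are orthonormal. So, uniformly
    in N, the letters of large index and the words repeating a letter many times
    have small variance. What is left is, up to an error vanishing with 1/N, the
    product over k of the Mehler sums of
      U_k = N^(-1/2) sum_i alpha_k(X_i) and V_k = N^(-1/2) sum_i beta_k(Y_i),
    and Mehler's formula bounds it below by the exponential of
      sum_k (s_k U_k V_k - s_k^2 (U_k^2 + V_k^2) / 2) / (1 - s_k^2),
    which is tight from below because sum_k s_k^2 < oo and s_1 < 1.

    Finally, finitely many finite unions of rational boxes decide whether a
    probability measure is close to mu. *)
Require Import Defs.
From mathcomp Require Import all_boot all_order all_algebra all_fingroup.
From mathcomp Require Import finmap.
From mathcomp Require Import all_classical all_reals all_analysis.
From mathcomp Require Import measurable_realfun ring lra.
Set Implicit Arguments.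
Unset Strict Implicit.
Unset Printing Implicit Defensive.
Import Order.TTheory GRing.Theory Num.Theory.
Import numFieldNormedType.Exports.
Local Open Scope classical_set_scope.
Local Open Scope ring_scope.

(** * Words and the average over permutations *)

(** The obstacle is D_N. Its mean is 1, but its second moment tends to prod_(k >= 1) 1 / (1 -
    s_k^2), so Chebyshev's inequality around the mean cannot make the lower tail small; positivity
    has to come from the limit law. No central limit theorem is needed for that: once the U_k and
    V_k are bounded, the samples small against sqrt N and the Gram matrices close to the identity,
    the comparison with the Mehler sums is deterministic, and these events are controlled by second
    moments and weak laws. Two different approximations lead to finitely many letters. An L^1 error
    x in the kernel costs (1 + x)^N - 1, so the passage from xi to n letters forces n to depend on
    N. The passage from there to a fixed number of letters must be uniform in N; it rests on
    orthogonality, where only the sum of s_k^2 over the dropped letters counts. In the same spirit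
    the exponent is controlled through sum_k s_k^2, since sum_k s_k may diverge. *)

Section words.
Context (R : realType) (I : finType) (N : nat).
Implicit Types (f g : {ffun 'I_N -> option I}) (a b : 'I_N -> I -> R)
  (kap : {ffun I -> nat}) (k l : I) (i : 'I_N).

(* Expanding prod_i (1 + sum_k a i k) amounts to choosing at every position i
   either a letter k or the term 1, that is, a word f with [f i = Some k] or
   [f i = None]; [cnt f] records the multiplicities of the letters. *)
Definition cnt f : {ffun I -> nat} := [ffun k => (\sum_(i < N) nat_of_bool (f i == Some k))%N].

Definition word_prod a f : R := \prod_(i < N) oapp (a i) 1 (f i).

(* The coefficient of prod_k t_k ^ kap_k in prod_i (1 + sum_k t_k a i k). *)
Definition elsym a kap : R := \sum_(f | cnt f == kap) word_prod a f.

(** The same coefficient with row [i] of [a] deleted: only words that leave position [i] free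
    count. *)
Definition elsym_off a i kap : R :=
  \sum_(f : {ffun 'I_N -> option I} | (f i == None) && (cnt f == kap)) word_prod a f.

(** The multinomial coefficient N! / ((N - |kap|)! prod_k kap_k!), zero when |kap| > N; see
    [card_class_fact]. *)
Definition card_class kap : R := \sum_(f | cnt f == kap) 1.

Definition addk kap l : {ffun I -> nat} := [ffun k => (kap k + (k == l))%N].
Definition subk kap l : {ffun I -> nat} := [ffun k => (kap k - (k == l))%N].

Lemma addkK l : cancel (addk^~ l) (subk^~ l).
Proof. by move=> kap; apply/ffunP => k; rewrite !ffunE addnK. Qed.

Lemma subkK kap l : (0 < kap l)%N -> addk (subk kap l) l = kap.
Proof.
move=> h; apply/ffunP => k; rewrite !ffunE; case: eqVneq => [->|_] /=.
  by rewrite subnK.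
by rewrite subn0 addn0.
Qed.

Lemma sum_addk kap l : (\sum_k addk kap l k = (\sum_k kap k).+1)%N.
Proof.
under eq_bigr do rewrite ffunE.
rewrite big_split/= -addn1; congr addn.
by rewrite (bigD1 l)//= eqxx big1// => k /negPf ->.
Qed.

Lemma big_option (V : nmodType) (F : option I -> V) :
  \sum_(o : option I) F o = F None + \sum_(k : I) F (Some k).
Proof.
rewrite (bigD1 None)//=; congr (_ + _).
rewrite (reindex_omap (Some : I -> option I) id)/=; last by case.
by apply: eq_bigl => k; rewrite !eqxx.
Qed.

Lemma word_prod_cnt (s : I -> R) f :
  word_prod (fun=> s) f = \prod_(k : I) s k ^+ cnt f k.
Proof.
rewrite /word_prod.
transitivity (\prod_(i < N) \prod_(k : I) s k ^+ (f i == Some k)).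
  apply: eq_bigr => i _; case: (f i) => [l|]/=; last by rewrite big1.
  rewrite (bigD1 l)//= eqxx expr1 big1 ?mulr1// => k kl.
  by rewrite (_ : (_ == _) = false) ?expr0//; apply: contraNF kl => /eqP[->].
rewrite exchange_big/=; apply: eq_bigr => k _.
by rewrite ffunE prodrXr.
Qed.

Lemma word_prodM a b f :
  word_prod (fun i k => a i k * b i k) f = word_prod a f * word_prod b f.
Proof.
rewrite /word_prod -big_split/=; apply: eq_bigr => i _.
by case: (f i) => //=; rewrite mulr1.
Qed.

Definition upd f i o : {ffun 'I_N -> option I} := [ffun j => if j == i then o else f j].

Lemma cnt_upd f i l : f i = None -> cnt (upd f i (Some l)) = addk (cnt f) l.
Proof.
move=> fi; apply/ffunP => k; rewrite !ffunE (bigD1 i)//= [in RHS](bigD1 i)//=.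
rewrite ffunE eqxx fi/= add0n addnC; congr (_ + _)%N.
  by apply: eq_bigr => j /negPf ji; rewrite ffunE ji.
by congr nat_of_bool; apply/eqP/eqP => [[]|->].
Qed.

Lemma word_prod_upd a f i l : f i = None ->
  word_prod a (upd f i (Some l)) = a i l * word_prod a f.
Proof.
move=> fi; rewrite /word_prod (bigD1 i)//= [in RHS](bigD1 i)//= ffunE eqxx fi/=.
by rewrite mul1r; congr (_ * _); apply: eq_bigr => j /negPf ji; rewrite ffunE ji.
Qed.

(** Erasing the letter at position [i] is a bijection onto the words of class [kap] with [i] free,
    and the word product loses the factor [a i l]. *)
Lemma sum_at a i l kap :
  \sum_(f : {ffun 'I_N -> option I} | (f i == Some l) && (cnt f == addk kap l)) word_prod a f =
  a i l * elsym_off a i kap.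
Proof.
rewrite (reindex_onto (fun f => upd f i (Some l)) (fun f => upd f i None))/=; last first.
  move=> f /andP[/eqP fi _]; apply/ffunP => j; rewrite !ffunE.
  by case: eqVneq => // ->.
rewrite mulr_sumr; apply: eq_big => [f|f /andP[_ /eqP fi]].
  have -> : (upd (upd f i (Some l)) i None == f) = (f i == None).
    apply/eqP/eqP => [<-|fi]; first by rewrite !ffunE eqxx.
    by apply/ffunP => j; rewrite !ffunE; case: eqVneq => // ->.
  rewrite ffunE eqxx eqxx andbC/=; case: eqVneq => //= fi.
  rewrite cnt_upd//; apply/eqP/eqP => [|->//].
  by move/(congr1 (subk^~ l)); rewrite !addkK.
by rewrite word_prod_upd// -fi !ffunE eqxx.
Qed.

Lemma cnt_gt0 f i l : f i = Some l -> (0 < cnt f l)%N.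
Proof. by move=> fi; rewrite ffunE (bigD1 i)//= fi eqxx. Qed.

Lemma elsym_row a i kap : elsym a kap = elsym_off a i kap +
  \sum_(l | (0 < kap l)%N) a i l * elsym_off a i (subk kap l).
Proof.
rewrite /elsym (partition_big (fun f => f i) predT)//= big_option; congr (_ + _).
  by apply: eq_bigl => f; rewrite andbC.
rewrite [RHS]big_mkcond/=; apply: eq_bigr => l _; case: ifPn => h.
  rewrite -sum_at subkK//; apply: eq_bigl => f; exact: andbC.
rewrite big1// => f /andP[/eqP fk /eqP fi]; exfalso.
by move: h; rewrite -fk (cnt_gt0 fi).
Qed.

(** Words with one marked occurrence of [k] are counted first by the word, then by the marked
    position. *)
Lemma elsym_rec a kap k : (0 < kap k)%N ->
  (kap k)%:R * elsym a kap = \sum_i a i k * elsym_off a i (subk kap k).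
Proof.
move=> h; rewrite mulr_sumr.
transitivity (\sum_(f | cnt f == kap) \sum_i (f i == Some k)%:R * word_prod a f).
  apply: eq_bigr => f /eqP <-; rewrite -mulr_suml ffunE natr_sum//.
rewrite exchange_big/=; apply: eq_bigr => i _.
rewrite -sum_at subkK// [RHS]big_mkcond/= [LHS]big_mkcond/=.
by apply: eq_bigr => f _; case: (cnt f == _); case: (f i == _) => //=; rewrite ?mul1r ?mul0r.
Qed.

Lemma elsym0 a : elsym a [ffun=> 0%N] = 1.
Proof.
rewrite /elsym (big_pred1 [ffun=> None]) => [|f].
  by rewrite /word_prod big1// => i _; rewrite ffunE.
apply/eqP/eqP => [|->].
  move=> f0; apply/ffunP => i; rewrite ffunE; case E: (f i) => [l|//].
  by have := cnt_gt0 E; rewrite f0 ffunE.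
by apply/ffunP => k; rewrite !ffunE big1// => i _; rewrite ffunE.
Qed.

Lemma card_classE kap : card_class kap = elsym (fun _ _ => 1) kap.
Proof.
apply: eq_bigr => f _; rewrite /word_prod big1// => i _.
by case: (f i).
Qed.

Lemma card_class_gt0 f : 0 < card_class (cnt f).
Proof.
rewrite /card_class (bigD1 f)//=.
by apply: (lt_le_trans ltr01); rewrite lerDl sumr_ge0.
Qed.

Lemma sum_cnt f : (\sum_k cnt f k + \sum_(i < N) (f i == None) = N)%N.
Proof.
under eq_bigr do rewrite ffunE.
rewrite exchange_big/= -big_split/= -[RHS]card_ord -sum1_card.
apply: eq_bigr => i _; case: (f i) => [l|]; last by rewrite big1.
by rewrite (bigD1 l)//= eqxx big1// => k kl; apply/eqP; rewrite eqb0;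
  apply: contraNN kl => /eqP[->].
Qed.

(** In [elsym_rec] with all entries 1, a word of class [subk kap k] appears once for each of its
    free positions. *)
Lemma card_class_rec kap k : (0 < kap k)%N ->
  (kap k)%:R * card_class kap =
  (N%:R - (\sum_l subk kap k l)%:R) * card_class (subk kap k).
Proof.
move=> h; rewrite !card_classE (elsym_rec _ h) mulr_sumr.
under [LHS]eq_bigr do rewrite mul1r.
transitivity (\sum_(f | cnt f == subk kap k)
    \sum_i (f i == None)%:R * word_prod (fun _ _ => 1 : R) f).
  rewrite exchange_big/=; apply: eq_bigr => i _.
  rewrite /elsym_off [RHS]big_mkcond/= [LHS]big_mkcond/=.
  by apply: eq_bigr => f _; case: (cnt f == _); case: (f i == _) => //=; rewrite ?mul1r ?mul0r.
apply: eq_bigr => f /eqP <-; rewrite -mulr_suml; congr (_ * _).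
have := congr1 (fun n => n%:R : R) (sum_cnt f); rewrite natrD => <-.
by rewrite addrC addKr natr_sum.
Qed.

Lemma card_class_fact kap : card_class kap * \prod_k (kap k)`!%:R =
  \prod_(j < \sum_k kap k) (N%:R - j%:R) :> R.
Proof.
move mE : (\sum_k kap k)%N => m.
elim: m kap mE => [|m IH] kap mE.
  have -> : kap = [ffun=> 0%N].
    apply/ffunP => k; rewrite ffunE; apply/eqP; move/eqP: mE.
    by rewrite sum_nat_eq0 => /forallP/(_ k).
  rewrite card_classE elsym0 mul1r big_ord0 big1// => k _.
  by rewrite ffunE.
have [k kk] : exists k, (0 < kap k)%N.
  apply/existsP; rewrite -[X in is_true X]negbK negb_exists; apply/negP => /forallP h.
  move: mE; rewrite big1// => k _; move: (h k); by rewrite -eqn0Ngt => /eqP.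
have mE' : (\sum_l subk kap k l = m)%N.
  by move: mE; rewrite -{1}(subkK kk) sum_addk => -[].
rewrite big_ord_recr/= -(IH _ mE').
have -> : \prod_l (kap l)`!%:R = (kap k)%:R * \prod_l (subk kap k l)`!%:R :> R.
  rewrite (bigD1 k)//= [in RHS](bigD1 k)//= mulrA ffunE eqxx subn1.
  rewrite -natrM -{2}(prednK kk) -factS (prednK kk); congr (_ * _).
  by apply: eq_bigr => l /negPf lk; rewrite ffunE lk subn0.
rewrite mulrA [_ * (kap k)%:R]mulrC (card_class_rec kk) mE'; ring.
Qed.

(* Averaging over permutations of the positions spreads a word uniformly over its class. *)
Lemma cnt_perm f (tau : 'S_N) : cnt [ffun i => f (tau i)] = cnt f.
Proof.
apply/ffunP => k; rewrite !ffunE [RHS](reindex_inj (@perm_inj _ tau))/=.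
by apply: eq_bigr => i _; rewrite ffunE.
Qed.

Lemma cnt_eq_perm f g : cnt f = cnt g -> exists tau : 'S_N, g = [ffun i => f (tau i)].
Proof.
move=> fg.
have /tuple_permP[tau tauE] : perm_eq [tuple of [seq g i | i <- ord_tuple N]]
                                [tuple of [seq f i | i <- ord_tuple N]].
  have cE (h : {ffun 'I_N -> option I}) o : count_mem o [seq h i | i <- ord_tuple N] = (\sum_(i < N) (h i == o))%N.
    rewrite count_map -sum1_count big_mkcond/= big_enum/=.
    by apply: eq_bigr => i _; case: (h i == o).
  have sE (h : {ffun 'I_N -> option I}) k : (\sum_(i < N) (h i == Some k) = cnt h k)%N by rewrite ffunE.
  apply/allP => o _ /=; rewrite !cE; case: o => [k|]; first by rewrite !sE fg.
  (* The letter counts determine the number of free positions, since together they add up to [N]. *)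
  by rewrite -(eqn_add2l (\sum_k cnt g k)) sum_cnt -fg sum_cnt.
exists tau; apply/ffunP => i; rewrite ffunE.
have := congr1 (fun s => nth None s i) tauE.
rewrite /= (nth_map i) ?size_enum_ord// nth_ord_enum => ->.
rewrite (nth_map i) ?size_enum_ord// nth_ord_enum.
by rewrite tnth_map tnth_ord_tuple.
Qed.

Lemma sum_perm_word (G : {ffun 'I_N -> option I} -> R) f :
  \sum_(tau : 'S_N) G [ffun i => f (tau i)] =
  N`!%:R / card_class (cnt f) * \sum_(g | cnt g == cnt f) G g.
Proof.
pose S f := \sum_(tau : 'S_N) G [ffun i => f (tau i)].
have SE g : cnt g = cnt f -> S g = S f.
  move=> /esym/cnt_eq_perm[tau ->]; rewrite /S.
  rewrite [RHS](reindex_inj (mulIg tau))/=; apply: eq_bigr => u _.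
  by congr G; apply/ffunP => i; rewrite !ffunE permM.
(* The orbit sum [S] is constant on the class, and each permutation maps the class onto itself;
   summing [S] over the class in both orders determines it without computing stabilisers. *)
have : \sum_(g | cnt g == cnt f) S g = card_class (cnt f) * S f.
  rewrite /card_class mulr_suml; apply: eq_bigr => g /eqP gf.
  by rewrite SE// mul1r.
rewrite exchange_big/=.
under eq_bigr => tau _.
  rewrite (_ : \sum_(_ | _) _ = \sum_(g | cnt g == cnt f) G g); first over.
  rewrite [RHS](reindex_onto (fun h : {ffun 'I_N -> option I} => [ffun i => h (tau i)])
    (fun h : {ffun 'I_N -> option I} => [ffun i => h ((tau^-1)%g i)]))/=.
    apply: eq_bigl => g; rewrite cnt_perm; set b := (X in _ && X).
    suff -> : b by rewrite andbT.
    by apply/eqP/ffunP => i; rewrite !ffunE permKV.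
  by move=> g _; apply/ffunP => i; rewrite !ffunE permK.
rewrite sumr_const card_Sn => h.
rewrite -/(S f) mulrAC mulr_natl h mulrAC mulfV ?mul1r//.
by rewrite gt_eqF// card_class_gt0.
Qed.

(** Relabelling positions moves the permutation onto the word of [b] alone, where [sum_perm_word]
    replaces it by the mean over the class. *)
Lemma kernel_expand (s : I -> R) a b :
  N`!%:R^-1 * \sum_(sig : 'S_N) \prod_(i < N) (1 + \sum_k s k * a i k * b (sig i) k) =
  \sum_f \sum_(g | cnt g == cnt f)
    (\prod_k s k ^+ cnt f k) / card_class (cnt f) * (word_prod a f * word_prod b g).
Proof.
under eq_bigr => sig _.
  under eq_bigr => i _.
    rewrite (_ : 1 + _ = \sum_(o : option I) oapp s 1 o * oapp (a i) 1 o * oapp (b (sig i)) 1 o);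
      last by rewrite big_option/= !mulr1.
    over.
  rewrite (bigA_distr_bigA (fun i o => oapp s 1 o * oapp (a i) 1 o * oapp (b (sig i)) 1 o)).
  over.
rewrite exchange_big/= mulr_sumr; apply: eq_bigr => f _.
under eq_bigr => sig _.
  rewrite 2!big_split/= (_ : \prod_(i < N) oapp s 1 (f i) = word_prod (fun=> s) f)//.
  rewrite word_prod_cnt -/(word_prod a f).
  rewrite (_ : \prod_(i < N) _ = word_prod b [ffun i => f ((sig^-1)%g i)]); last first.
    rewrite /word_prod [RHS](reindex_inj (@perm_inj _ sig))/=.
    by apply: eq_bigr => i _; rewrite ffunE permK.
  over.
rewrite -mulr_sumr (reindex_inj invg_inj)/=.
under [\sum_j _]eq_bigr do rewrite invgK.
rewrite (sum_perm_word (word_prod b)) -mulr_sumr -[in RHS]mulr_sumr.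
have N0 : N`!%:R != 0 :> R by rewrite pnatr_eq0 -lt0n fact_gt0.
rewrite -!mulrA mulrCA; congr (_ * _).
rewrite [_ * \sum_(_ | _) _]mulrC; field.
by rewrite N0 gt_eqF// card_class_gt0.
Qed.

End words.

(** * Hermite polynomials and Mehler's formula *)

Section hermite.
Context (R : realType).
Implicit Types (u v s : R) (m : nat).

(** Probabilists' Hermite polynomials, orthogonal for the standard Gaussian law. *)
Fixpoint hermite m u : R :=
  if m is m1.+1 then
    if m1 is m2.+1 then u * hermite m1 u - m1%:R * hermite m2 u else u
  else 1.

Lemma hermiteSS m u :
  hermite m.+2 u = u * hermite m.+1 u - m.+1%:R * hermite m u.
Proof. by []. Qed.

Definition mehler_coef m u v : R := hermite m u * hermite m v / m`!%:R.

Definition mehler_sum M s u v : R := \sum_(m < M.+1) s ^+ m * mehler_coef m u v.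

Context (I : finType).
Implicit Types (kap : {ffun I -> nat}) (k l : I) (U : I -> R).

(** The coefficient of prod_k t_k ^ kap_k in exp (sum_k (t_k U_k - t_k ^ 2 / 2)). This is what
    [elsym] becomes when sum_i a i k = U_k, the Gram matrix is the identity and moments of order
    three are negligible. *)
Definition hermite_prod kap U : R := \prod_k (hermite (kap k) (U k) / (kap k)`!%:R).

(** Three-term recurrence in the letter [k]; the conditional drops the last term when [kap k] is 1,
    where [subk] would truncate. *)
Lemma hermite_prod_rec kap U k : (0 < kap k)%N ->
  (kap k)%:R * hermite_prod kap U = U k * hermite_prod (subk kap k) U -
    (if (0 < subk kap k k)%N then hermite_prod (subk (subk kap k) k) U else 0).
Proof.
have E (q : {ffun I -> nat}) : hermite_prod q U = hermite (q k) (U k) / (q k)`!%:R *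
    \prod_(i | i != k) (hermite (q i) (U i) / (q i)`!%:R).
  by rewrite /hermite_prod (bigD1 k).
move=> h; rewrite !{}E.
pose W := \prod_(i | i != k) (hermite (kap i) (U i) / (kap i)`!%:R).
rewrite (_ : \prod_(i | i != k) (hermite (subk kap k i) _ / _) = W); last first.
  by apply: eq_bigr => l /negPf lk; rewrite ffunE lk subn0.
rewrite (_ : \prod_(i | i != k) (hermite (subk (subk kap k) k i) _ / _) = W); last first.
  by apply: eq_bigr => l /negPf lk; rewrite !ffunE lk !subn0.
rewrite -/W !ffunE eqxx.
case: (kap k) h => // -[|n] _ /=.
  by rewrite subnn /= fact0 (_ : 1`! = 1%N)// !divr1 !mul1r subr0.
rewrite !subn1/= -/(hermite n.+1 (U k)) !factS !natrM.
have n0 : n`!%:R != 0 :> R by rewrite pnatr_eq0 -lt0n fact_gt0.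
rewrite -!natr1; field.
by rewrite n0 !natr1 !pnatr_eq0.
Qed.

Lemma sum_subk kap k : (0 < kap k)%N -> ((\sum_l subk kap k l).+1 = \sum_l kap l)%N.
Proof. by move=> h; rewrite -(sum_addk _ k) subkK. Qed.

(* Inclusion-exclusion on the position [i], pushed to third order. *)
Lemma elsym_expand N (a : 'I_N -> I -> R) kap k : (0 < kap k)%N ->
  (kap k)%:R * elsym a kap =
  (\sum_i a i k) * elsym a (subk kap k)
  - \sum_(l | (0 < subk kap k l)%N)
      (\sum_i a i k * a i l) * elsym a (subk (subk kap k) l)
  + \sum_(l | (0 < subk kap k l)%N)
      \sum_(l' | (0 < subk (subk kap k) l l')%N)
      \sum_i a i k * a i l * a i l' * elsym_off a i (subk (subk (subk kap k) l) l').
Proof.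
move=> h; rewrite (elsym_rec _ h); set kap' := subk kap k.
have step i : a i k * elsym_off a i kap' = a i k * elsym a kap'
    - \sum_(l | (0 < kap' l)%N) a i k * a i l * elsym a (subk kap' l)
    + \sum_(l | (0 < kap' l)%N) \sum_(l' | (0 < subk kap' l l')%N)
      a i k * a i l * a i l' * elsym_off a i (subk (subk kap' l) l').
  rewrite (elsym_row a i kap') mulrDr.
  rewrite (_ : a i k * \sum_(l | (0 < kap' l)%N) _ = \sum_(l | (0 < kap' l)%N) a i k * a i l * elsym a (subk kap' l)
    - \sum_(l | (0 < kap' l)%N) \sum_(l' | (0 < subk kap' l l')%N)
      a i k * a i l * a i l' * elsym_off a i (subk (subk kap' l) l')).
    by ring.
  rewrite mulr_sumr -sumrB; apply: eq_bigr => l _.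
  rewrite (elsym_row a i (subk kap' l)) mulrDr mulr_sumr.
  under [X in _ + X - _]eq_bigr do rewrite mulrA.
  by rewrite addrK mulrA.
rewrite (eq_bigr _ (fun i _ => step i)).
rewrite 2!big_split/= -mulr_suml sumrN; congr (_ - _ + _).
  by rewrite exchange_big/=; apply: eq_bigr => l _; rewrite mulr_suml.
rewrite exchange_big/=; apply: eq_bigr => l _.
by rewrite exchange_big.
Qed.

Lemma ler_sum_card (P : pred I) (F : I -> R) c : 0 <= c ->
  (forall l, P l -> `|F l| <= c) -> `|\sum_(l | P l) F l| <= #|I|%:R * c.
Proof.
move=> c0 h; apply: (le_trans (ler_norm_sum _ _ _)).
rewrite big_mkcond/= mulr_natl -sumr_const; apply: ler_sum => l _.
by case: ifPn => // /h.
Qed.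

(* Up to the cubic remainder of [elsym_expand] and the error on the Gram matrix,
   [elsym a] satisfies the three-term recursion of [hermite_prod]. *)
Lemma elsym_approx (m : nat) (B : R) : 0 <= B -> exists2 C : R, 0 <= C &
  forall N (a : 'I_N -> I -> R) (eta : R), 0 <= eta <= 1 ->
    (forall i k, `|a i k| <= eta) ->
    (forall k l, `|\sum_i a i k * a i l - (k == l)%:R| <= eta) ->
    (forall k, `|\sum_i a i k| <= B) ->
  forall kap, (\sum_k kap k <= m)%N ->
  [/\ `|elsym a kap - hermite_prod kap (fun k => \sum_i a i k)| <= C * eta,
      `|elsym a kap| <= C & forall i, `|elsym_off a i kap| <= C].
Proof.
move=> B0; elim: m => [|m [C C0 IH]].
  exists 1 => // N a eta /andP[eta0 eta1] ha hG hU kap.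
  rewrite leqn0 => mE.
  have -> : kap = [ffun=> 0%N].
    apply/ffunP => k; rewrite ffunE; apply/eqP; move: mE.
    by rewrite sum_nat_eq0 => /forallP/(_ k).
  rewrite elsym0 normr1; split=> //.
    rewrite /hermite_prod big1 ?subrr ?normr0 ?mulr_ge0// => k _.
    by rewrite ffunE/= fact0 divr1.
  move=> i; have := elsym_row a i [ffun=> 0%N].
  by rewrite elsym0 big_pred0 ?addr0 => [<-|l]; rewrite ?normr1// ffunE.
pose n : R := #|I|%:R.
have n0 : 0 <= n by rewrite ler0n.
(* Room for B + 2 n + 2 n^2 from [elsym], a further n from [elsym_off], and B + n + 1 + 2 n^2 from
   the distance to [hermite_prod]. *)
exists (C * (B + 2 * n ^+ 2 + 4 * n + 2)).
  by rewrite mulr_ge0// !addr_ge0// mulr_ge0// exprn_ge0.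
move=> N a eta eta01 ha hG hU kap.
have /andP[eta0 eta1] := eta01.
have {}IH := IH N a eta eta01 ha hG hU.
have CC : C <= C * (B + 2 * n ^+ 2 + 4 * n + 2).
  by rewrite ler_peMr//; nra.
rewrite leq_eqVlt => /orP[/eqP mE|]; last first.
  rewrite ltnS => /IH[h1 h2 h3]; split => [||i].
  - by apply: (le_trans h1); exact: ler_wpM2r.
  - exact: le_trans h2 CC.
  - exact: le_trans (h3 i) CC.
have [k kk] : exists k, (0 < kap k)%N.
  apply/existsP; rewrite -[X in is_true X]negbK negb_exists; apply/negP => /forallP h.
  move: mE; rewrite big1// => k _; move: (h k); by rewrite -eqn0Ngt => /eqP.
have s1 : (\sum_l subk kap k l <= m)%N.
  by rewrite -ltnS sum_subk// mE.
have s2 l : (0 < subk kap k l)%N -> (\sum_j subk (subk kap k) l j <= m)%N.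
  by move=> h; apply: leq_trans s1; rewrite -(sum_subk h).
have s3 l l' : (0 < subk kap k l)%N -> (0 < subk (subk kap k) l l')%N ->
   (\sum_j subk (subk (subk kap k) l) l' j <= m)%N.
  by move=> h h'; apply: leq_trans (s2 _ h); rewrite -(sum_subk h').
pose U l := \sum_i a i l.
pose G l := \sum_i a i k * a i l.
pose E := \sum_(l | (0 < subk kap k l)%N)
      \sum_(l' | (0 < subk (subk kap k) l l')%N)
      \sum_i a i k * a i l * a i l' * elsym_off a i (subk (subk (subk kap k) l) l').
have G2 l : `|G l| <= 2.
  have := hG k l; rewrite -/(G l) => h.
  have -> : G l = (G l - (k == l)%:R) + (k == l)%:R by ring.
  apply: (le_trans (ler_normD _ _)); apply: (@le_trans _ _ (eta + 1)); last lra.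
  by apply: lerD => //; case: (k == l); rewrite ?normr1 ?normr0.
have Sq l : \sum_i (a i l) ^+ 2 <= 2.
  under eq_bigr do rewrite expr2.
  by have := hG l l; rewrite eqxx mulr1n ler_norml => /andP[_]; lra.
(* Of the three entries one is at most [eta]; the product of the other two is summed by 2 x y <= x^2
   + y^2, the sums of squares being diagonal Gram entries, at most 2. *)
have EE : `|E| <= n * (n * (2 * C * eta)).
  have c0 : 0 <= 2 * C * eta by rewrite !mulr_ge0.
  apply: ler_sum_card => [|l hl]; first by rewrite mulr_ge0.
  apply: ler_sum_card => // l' hl'.
  apply: (le_trans (ler_norm_sum _ _ _)).
  apply: (@le_trans _ _ (\sum_i (a i k ^+ 2 + a i l ^+ 2) / 2 * (eta * C))).
    apply: ler_sum => i _; rewrite normrM normrM -mulrA ler_pM//.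
    - rewrite normrM -(real_normK (num_real (a i k))) -(real_normK (num_real (a i l))).
      have := sqr_ge0 (`|a i k| - `|a i l|); nra.
    - by rewrite ler_pM//; case: (IH _ (s3 _ _ hl hl')) => _ _; apply.
  rewrite -mulr_suml -mulr_suml big_split/=.
  rewrite (_ : 2 * C * eta = 2 * (eta * C)); last by ring.
  rewrite ler_wpM2r ?mulr_ge0//.
  have := Sq k; have := Sq l; lra.
have k1 : 1 <= (kap k)%:R :> R by rewrite ler1n.
have normk (x : R) : `|x| <= `|(kap k)%:R * x|.
  by rewrite normrM ler_peMl// normr_nat.
have hexp := elsym_expand a kk.
have [A1 A2 _] := IH _ s1.
have hA : `|elsym a kap| <= B * C + n * (2 * C) + n * (n * (2 * C)).
  apply: (le_trans (normk _)); rewrite hexp -/E.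
  apply: (le_trans (ler_normD _ _)); apply: lerD; last first.
    by apply: (le_trans EE); apply: ler_wpM2l => //; apply: ler_wpM2l => //; rewrite ler_piMr// mulr_ge0.
  apply: (le_trans (ler_normB _ _)); apply: lerD.
    by rewrite normrM ler_pM.
  apply: ler_sum_card => [|l hl]; first by rewrite mulr_ge0.
  by rewrite normrM; apply: ler_pM => //; [exact: G2|case: (IH _ (s2 _ hl))].
have hAC : B * C + n * (2 * C) + n * (n * (2 * C)) + n * C <=
    C * (B + 2 * n ^+ 2 + 4 * n + 2).
  rewrite -subr_ge0; rewrite (_ : _ - _ = C * (n + 2)); last by ring.
  by rewrite mulr_ge0// addr_ge0.
split.
- apply: (le_trans (normk _)).
  rewrite mulrBr hexp hermite_prod_rec// -/E.
  (* Up to [eta], only the letter l = k survives in the Gram sum; it produces the last term of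
     [hermite_prod_rec]. *)
  rewrite (_ : _ - _ = U k * (elsym a (subk kap k) - hermite_prod (subk kap k) U)
    - (\sum_(l | (0 < subk kap k l)%N) (G l - (k == l)%:R) * elsym a (subk (subk kap k) l))
    - (if (0 < subk kap k k)%N then elsym a (subk (subk kap k) k) -
       hermite_prod (subk (subk kap k) k) U else 0) + E); last first.
    under [X in _ = _ - X - _ + _]eq_bigr do rewrite mulrBl.
    rewrite sumrB.
    rewrite (_ : \sum_(l | _) (k == l)%:R * _ = if (0 < subk kap k k)%N
        then elsym a (subk (subk kap k) k) else 0).
      by case: ifP => _; rewrite /U /G; ring.
    rewrite big_mkcond (bigD1 k)//= eqxx mul1r big1 ?addr0// => l /negPf lk.
    by rewrite eq_sym lk mul0r if_same.
  apply: (@le_trans _ _ (B * (C * eta) + n * (eta * C) + C * eta + n * (n * (2 * C * eta)))).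
    apply: (le_trans (ler_normD _ _)); apply: lerD => //.
    apply: (le_trans (ler_normB _ _)); apply: lerD; last first.
      case: ifPn => hk; last by rewrite normr0 mulr_ge0.
      by case: (IH _ (s2 _ hk)).
    apply: (le_trans (ler_normB _ _)); apply: lerD.
      by rewrite normrM; apply: ler_pM => //; exact: hU.
    apply: ler_sum_card => [|l hl]; first by rewrite mulr_ge0.
    by rewrite normrM; apply: ler_pM => //; [exact: hG|case: (IH _ (s2 _ hl))].
  rewrite -subr_ge0 (_ : _ - _ = (C * eta) * (3 * n + 1)); last by ring.
  by rewrite !mulr_ge0// addr_ge0// mulr_ge0.
- by apply: le_trans hAC; apply: (le_trans hA); rewrite lerDl mulr_ge0.
- move=> i.
  rewrite (_ : elsym_off a i kap = elsym a kap -
    \sum_(l | (0 < kap l)%N) a i l * elsym_off a i (subk kap l)); last first.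
    by rewrite (elsym_row a i kap) addrK.
  apply: (le_trans (ler_normB _ _)); apply: le_trans hAC; apply: lerD => //.
  apply: ler_sum_card => // l hl; rewrite normrM -[leRHS]mul1r ler_pM//.
    exact: le_trans (ha i l) eta1.
  have sl : (\sum_j subk kap l j <= m)%N by rewrite -ltnS sum_subk// mE.
  by case: (IH _ sl).
Qed.

End hermite.

(** * Limit of the expansion with bounded multiplicities *)

Section truncated_limit.
Context (R : realType).

(** The lower bound is Weierstrass's product inequality. *)
Lemma prod_1B_ge (m : nat) (x : nat -> R) : (forall j, (j < m)%N -> 0 <= x j <= 1) ->
  1 - \sum_(j < m) x j <= \prod_(j < m) (1 - x j) <= 1.
Proof.
elim: m => [|m IH] hx; first by rewrite !big_ord0 subr0 !lexx.
have hx' j : (j < m)%N -> 0 <= x j <= 1 by move=> jm; apply: hx; exact: ltnW.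
have /andP[IH1 IH2] := IH hx'.
rewrite !big_ord_recr/=; have /andP[x0 x1] := hx m (ltnSn m).
have S0 : 0 <= \sum_(j < m) x j.
  by apply: sumr_ge0 => j _; case/andP: (hx' j (ltn_ord j)).
have P0 : 0 <= \prod_(j < m) (1 - x j).
  by apply: prodr_ge0 => j _; rewrite subr_ge0; case/andP: (hx' j (ltn_ord j)).
apply/andP; split; nra.
Qed.

Lemma falling_ratio (m : nat) (e : R) : 0 < e -> exists N0 : nat,
  forall N, (N0 <= N)%N -> (0 < N)%N ->
    `|N%:R ^+ m / \prod_(j < m) (N%:R - j%:R) - 1| <= e.
Proof.
move=> e0; pose q : R := (m * m)%:R.
have q0 : 0 <= q by rewrite ler0n.
(* With r = q / N the product [p] below is at least 1 - r and the error is (1 - p) / p. The two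
   terms with [q] give r <= 1/2 and 2 r <= e, and [m] keeps the factors nonnegative. *)
exists (Num.bound (2 * q + 2 * q / e) + m)%N => N hN N0.
have NR : 2 * q + 2 * q / e <= N%:R.
  apply: ltW; apply: (lt_le_trans (archi_boundP _)).
    by rewrite addr_ge0// ?divr_ge0 ?mulr_ge0// ltW.
  by rewrite ler_nat; apply: leq_trans hN; exact: leq_addr.
have mN : (m <= N)%N by apply: leq_trans hN; exact: leq_addl.
have N1 : 0 < N%:R :> R by rewrite ltr0n.
have -> : \prod_(j < m) (N%:R - j%:R) = N%:R ^+ m * \prod_(j < m) (1 - j%:R / N%:R) :> R.
  rewrite -[X in _ ^+ X]card_ord -prodr_const -big_split/=; apply: eq_bigr => j _.
  by rewrite mulrBr mulr1 mulrC mulfVK// gt_eqF.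
set p := \prod_(j < m) _.
have /andP[p1 p2] : 1 - q / N%:R <= p <= 1.
  have := @prod_1B_ge m (fun j => j%:R / N%:R).
  have hx j : (j < m)%N -> 0 <= (j%:R / N%:R : R) <= 1.
    move=> jm; rewrite divr_ge0//= ler_pdivrMr// mul1r ler_nat.
    exact: leq_trans (ltnW jm) mN.
  move=> /(_ hx)/andP[h1 ->]; rewrite andbT; apply: le_trans h1.
  rewrite lerD2l lerN2 -mulr_suml ler_pM2r ?invr_gt0//.
  apply: (@le_trans _ _ (\sum_(j < m) m%:R)).
    by apply: ler_sum => j _; rewrite ler_nat ltnW.
  by rewrite sumr_const card_ord -mulrnA.
set r := q / N%:R in p1.
have qe : 0 <= q / e by rewrite divr_ge0// ltW.
have r0 : 0 <= r by rewrite divr_ge0.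
have r1 : r <= 1 / 2.
  by rewrite ler_pdivrMr//; lra.
have r2 : 2 * r <= e.
  by rewrite mulrA ler_pdivrMr// [e * _]mulrC -ler_pdivrMr//; lra.
have pp : 0 < p by lra.
rewrite invfM mulrA divff ?mul1r ?expf_neq0 ?gt_eqF//.
have -> : p^-1 - 1 = (1 - p) / p by field; rewrite gt_eqF.
rewrite ger0_norm; last by rewrite divr_ge0 ?subr_ge0// ltW.
have p12 : 0 <= p - 1 / 2 by lra.
have : 0 <= e * (p - 1 / 2) by apply: mulr_ge0 => //; exact: ltW.
by rewrite ler_pdivrMr//; lra.
Qed.

Context (I : finType).
Implicit Types (k l : I) (s : I -> R).

Lemma word_prod_scale N (c : R) (a : 'I_N -> I -> R) f :
  word_prod (fun i k => c * a i k) f = c ^+ (\sum_k cnt f k) * word_prod a f.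
Proof.
by rewrite (word_prodM (fun=> fun=> c)) word_prod_cnt prodrXr.
Qed.

Lemma elsym_scale N (c : R) (a : 'I_N -> I -> R) (kap : {ffun I -> nat}) :
  elsym (fun i k => c * a i k) kap = c ^+ (\sum_k kap k) * elsym a kap.
Proof.
rewrite mulr_sumr; apply: eq_bigr => f /eqP <-; exact: word_prod_scale.
Qed.

(** The expansion of [kernel_expand] restricted to words that use each letter at most [M] times.
    They fall into at most (M + 1) ^ #|I| classes whatever [N] is, so a limit can be taken class by
    class. *)
Definition trunc_kernel N M s (a b : 'I_N -> I -> R) : R :=
  \sum_(f : {ffun 'I_N -> option I} | [forall k, cnt f k <= M]%N)
    \sum_(g | cnt g == cnt f)
    (\prod_k s k ^+ cnt f k) / card_class R N (cnt f) * (word_prod a f * word_prod b g).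

Definition ffval M (kap : {ffun I -> 'I_M.+1}) : {ffun I -> nat} :=
  [ffun k => val (kap k)].

Lemma sum_bounded_cnt N M (F : {ffun 'I_N -> option I} -> R) :
  \sum_(f | [forall k, cnt f k <= M]%N) F f =
  \sum_(kap : {ffun I -> 'I_M.+1}) \sum_(f | cnt f == ffval kap) F f.
Proof.
rewrite (partition_big (fun f => [ffun k => inord (cnt f k)] : {ffun I -> 'I_M.+1}) predT)//=.
apply: eq_bigr => kap _; apply: eq_bigl => f.
apply/andP/eqP => [[/forallP fM /eqP fk]|fk].
  by apply/ffunP => k; rewrite -fk !ffunE/= inordK// ltnS; have := fM k; rewrite ffunE.
split; first by apply/forallP => k; rewrite fk ffunE -ltnS ltn_ord.
by apply/eqP/ffunP => k; rewrite ffunE fk ffunE inord_val.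
Qed.

Lemma trunc_kernelE N M s (a b : 'I_N -> I -> R) : trunc_kernel M s a b =
  \sum_(kap : {ffun I -> 'I_M.+1})
     (\prod_k s k ^+ kap k) / card_class R N (ffval kap) *
       (elsym a (ffval kap) * elsym b (ffval kap)).
Proof.
rewrite /trunc_kernel sum_bounded_cnt; apply: eq_bigr => kap _.
rewrite [elsym a _]/elsym mulr_suml mulr_sumr; apply: eq_bigr => f /eqP fk.
rewrite fk -!mulr_sumr; congr (_ / _ * _).
by apply: eq_bigr => k _; rewrite ffunE.
Qed.

Lemma prod_mehler_sumE M s (U V : I -> R) :
  \prod_k mehler_sum M (s k) (U k) (V k) =
  \sum_(kap : {ffun I -> 'I_M.+1})
    (\prod_k s k ^+ kap k) * (\prod_k (kap k)`!%:R) *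
    (hermite_prod (ffval kap) U * hermite_prod (ffval kap) V).
Proof.
rewrite /mehler_sum.
rewrite (bigA_distr_bigA (fun k (m : 'I_M.+1) => s k ^+ m * mehler_coef m (U k) (V k))).
apply: eq_bigr => kap _; rewrite /hermite_prod -!big_split/=.
apply: eq_bigr => k _; rewrite /mehler_coef !ffunE/=; field.
by rewrite pnatr_eq0 -lt0n fact_gt0.
Qed.

(** The entries divided by sqrt N satisfy the hypotheses of [elsym_approx]. The powers of sqrt N
    taken out of the two [elsym] factors make N ^ |kap|, which the falling factorial in [card_class]
    cancels asymptotically. *)
Lemma trunc_kernel_limit M (B e : R) s : 0 <= B -> 0 < e -> (forall k, 0 <= s k <= 1) ->
  exists eta : R, exists N0 : nat, [/\ 0 < eta, (0 < N0)%N &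
  forall N (a b : 'I_N -> I -> R), (N0 <= N)%N ->
    let r : R := Num.sqrt N%:R in
    (forall i k, `|a i k| <= eta * r) -> (forall i k, `|b i k| <= eta * r) ->
    (forall k l, `|(\sum_i a i k * a i l) / N%:R - (k == l)%:R| <= eta) ->
    (forall k l, `|(\sum_i b i k * b i l) / N%:R - (k == l)%:R| <= eta) ->
    (forall k, `|(\sum_i a i k) / r| <= B) -> (forall k, `|(\sum_i b i k) / r| <= B) ->
    `|trunc_kernel M s a b - \prod_k mehler_sum M (s k) ((\sum_i a i k) / r)
        ((\sum_i b i k) / r)| <= e].
Proof.
move=> B0 e0 hs.
have [C C0 hC] := elsym_approx I (#|I| * M) B0.
pose K : R := #|{ffun I -> 'I_M.+1}|%:R.
have K0 : 0 <= K by rewrite ler0n.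
pose W (kap : {ffun I -> 'I_M.+1}) : R := \prod_k (kap k)`!%:R.
have W0 kap : 0 <= W kap by apply: prodr_ge0.
pose WW : R := \sum_kap W kap.
have WW0 : 0 <= WW by apply: sumr_ge0.
have WWW kap : W kap <= WW.
  by rewrite /WW (bigD1 kap)//= lerDl sumr_ge0.
pose D := K * (C ^+ 2 * (1 * WW + 3 * WW)).
have D0 : 0 <= D by rewrite mulr_ge0// mulr_ge0// ?exprn_ge0// addr_ge0// mulr_ge0.
pose eta := Num.min 1 (e / (D + 1)).
have eta0 : 0 < eta by rewrite lt_min ltr01 divr_gt0//; lra.
have eta1 : eta <= 1 by rewrite ge_min lexx.
have etaD : D * eta <= e.
  apply: (@le_trans _ _ ((D + 1) * (e / (D + 1)))).
    apply: ler_pM => //; [exact: ltW|lra|by rewrite ge_min lexx orbT].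
  by rewrite mulrC mulfVK// gt_eqF//; lra.
have /choice[Nf hNf] : forall kap : {ffun I -> 'I_M.+1}, exists N0 : nat,
    forall N, (N0 <= N)%N -> (0 < N)%N -> `|N%:R ^+ (\sum_k kap k) /
      \prod_(j < \sum_k kap k) (N%:R - j%:R) - 1| <= eta.
  by move=> kap; exact: falling_ratio.
(* The first maximum makes all falling-factorial ratios close to 1; the second keeps |kap| below
   [N], so that these factorials are positive. *)
exists eta, (\max_(kap : {ffun I -> 'I_M.+1}) Nf kap + \max_(kap : {ffun I -> 'I_M.+1}) (\sum_k kap k)).+1%N; split => //.
move=> N a b hN r ha hb hGa hGb hUa hUb.
have N0 : (0 < N)%N by apply: leq_trans hN.
have NR : 0 < N%:R :> R by rewrite ltr0n.
have r0 : 0 < r by rewrite sqrtr_gt0.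
have rN : r ^+ 2 = N%:R by rewrite sqr_sqrtr// ltW.
pose a' i k : R := r^-1 * a i k; pose b' i k : R := r^-1 * b i k.
have red (x : 'I_N -> I -> R) : (forall i k, `|x i k| <= eta * r) ->
    (forall k l, `|(\sum_i x i k * x i l) / N%:R - (k == l)%:R| <= eta) ->
    (forall k, `|(\sum_i x i k) / r| <= B) ->
    forall kap : {ffun I -> nat}, (\sum_k kap k <= #|I| * M)%N ->
    let x' i k : R := r^-1 * x i k in
  `|elsym x' kap - hermite_prod kap (fun k => (\sum_i x i k) / r)| <= C * eta /\
      `|elsym x' kap| <= C.
  move=> hx hG hU kap hk x'.
  have Ux k : \sum_i x' i k = (\sum_i x i k) / r by rewrite -mulr_sumr mulrC.
  have [||||h1 h2 _] := hC N x' eta _ _ _ _ kap hk.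
  - by rewrite ltW.
  - by move=> i k; rewrite normrM (gtr0_norm (_ : 0 < r^-1)) ?invr_gt0// mulrC ler_pdivrMr.
  - move=> k l; rewrite (_ : \sum_i _ = (\sum_i x i k * x i l) / N%:R)//.
    rewrite mulr_suml; apply: eq_bigr => i _; rewrite -rN /x'; field.
    by rewrite gt_eqF.
  - by move=> k; rewrite Ux.
  split=> //; move: h1; congr (`| _ - hermite_prod _ _ | <= _).
  by apply/funext => k.
rewrite trunc_kernelE prod_mehler_sumE -sumrB.
have term (kap : {ffun I -> 'I_M.+1}) :
   `|(\prod_k s k ^+ kap k) / card_class R N (ffval kap) *
       (elsym a (ffval kap) * elsym b (ffval kap)) -
     (\prod_k s k ^+ kap k) * (\prod_k (kap k)`!%:R) *
       (hermite_prod (ffval kap) (fun k => (\sum_i a i k) / r) *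
        hermite_prod (ffval kap) (fun k => (\sum_i b i k) / r))| <=
   C ^+ 2 * (1 * WW + 3 * WW) * eta.
  set m := (\sum_k ffval kap k)%N.
  have mE : m = (\sum_k kap k)%N by apply: eq_bigr => k _; rewrite ffunE.
  have mM : (m <= #|I| * M)%N.
    rewrite mE -sum_nat_const; apply: leq_sum => k _; by rewrite -ltnS.
  have [a1 a2] := red a ha hGa hUa _ mM.
  have [b1 b2] := red b hb hGb hUb _ mM.
  set A' := elsym _ _ in a1 a2; set B' := elsym _ _ in b1 b2.
  set HA := hermite_prod _ _ in a1 *; set HB := hermite_prod _ _ in b1 *.
  have aE : elsym a (ffval kap) = r ^+ m * A'.
    rewrite -elsym_scale; congr elsym; apply/funext => i; apply/funext => k.
    by rewrite mulrA mulfV ?mul1r// gt_eqF.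
  have bE : elsym b (ffval kap) = r ^+ m * B'.
    rewrite -elsym_scale; congr elsym; apply/funext => i; apply/funext => k.
    by rewrite mulrA mulfV ?mul1r// gt_eqF.
  have cE : card_class R N (ffval kap) * W kap = \prod_(j < m) (N%:R - j%:R).
    rewrite -card_class_fact; congr (_ * _); apply: eq_bigr => k _.
    by rewrite ffunE.
  have Wp : 0 < W kap by apply: prodr_gt0 => k _; rewrite ltr0n fact_gt0.
  have pp : 0 < \prod_(j < m) (N%:R - j%:R) :> R.
    apply: prodr_gt0 => j _; rewrite subr_gt0 ltr_nat.
    apply: leq_trans (ltn_ord j) _; apply: leq_trans (ltnW hN).
    rewrite mE; apply: leq_trans (leq_addl _ _).
    exact: (@leq_bigmax _ (fun kap : {ffun I -> 'I_M.+1} => \sum_k kap k)%N kap).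
  have cE' : card_class R N (ffval kap) = \prod_(j < m) (N%:R - j%:R) / W kap.
    by rewrite -cE mulfK// gt_eqF.
  have q1 := hNf kap N _ N0.
  have {}q1 : `|N%:R ^+ m / \prod_(j < m) (N%:R - j%:R) - 1| <= eta :> R.
    rewrite mE; apply: q1; apply: leq_trans (ltnW hN).
    apply: leq_trans (leq_addr _ _).
    exact: (@leq_bigmax _ Nf kap).
  set q := N%:R ^+ m / _ in q1.
  set S := \prod_k s k ^+ kap k.
  have /andP[S0 S1] : 0 <= S <= 1.
    apply/andP; split.
      by apply: prodr_ge0 => k _; rewrite exprn_ge0//; case/andP: (hs k).
    apply: prodr_ile1 => k _; have /andP[s0 s1] := hs k.
    by rewrite exprn_ge0//= exprn_ile1.
  (* The difference A' B' - HA HB is written through [A'], [B'] and the errors only, because [C]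
     bounds [A'] and [B'] directly but not the Hermite products. *)
  rewrite -/(W kap) (_ : _ - _ = S * W kap * ((q - 1) * (A' * B') +
     ((A' - HA) * B' - (A' - HA) * (B' - HB) + A' * (B' - HB)))); last first.
    rewrite aE bE cE' /q -rN -exprM mulnC exprM; field.
    by rewrite rN !gt_eqF.
  rewrite normrM ger0_norm; last exact: mulr_ge0.
  have SW : S * W kap <= WW.
    by rewrite -[leRHS]mul1r ler_pM.
  have hq : `|(q - 1) * (A' * B')| <= eta * (C * C).
    by rewrite !normrM ler_pM// ler_pM.
  have h1 : `|(A' - HA) * B'| <= (C * eta) * C by rewrite normrM ler_pM.
  have h3 : `|A' * (B' - HB)| <= C * (C * eta) by rewrite normrM ler_pM.
  have h2 : `|(A' - HA) * (B' - HB)| <= (C * eta) * C.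
    rewrite normrM ler_pM//; apply: (le_trans b1); rewrite ler_piMr//.
  rewrite (_ : C ^+ 2 * (1 * WW + 3 * WW) * eta =
    WW * (eta * (C * C) + (C * eta * C + C * eta * C + C * (C * eta)))); last by ring.
  apply: ler_pM => //; first exact: mulr_ge0.
  apply: (le_trans (ler_normD _ _)); apply: lerD => //.
  apply: (le_trans (ler_normD _ _)); apply: lerD => //.
  by apply: (le_trans (ler_normB _ _)); apply: lerD.
apply: le_trans etaD; apply: (le_trans (ler_norm_sum _ _ _)).
rewrite /D -mulrA /K mulr_natl -sumr_const; apply: ler_sum => kap _; exact: term.
Qed.

End truncated_limit.

(** * Power series of radius of convergence at least one *)

Section subexponential.
Context (R : realType).
Implicit Types (c : nat -> R) (x rho : R).

Definition subexp c := forall rho, 1 < rho -> exists2 C : R, 0 <= C &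
  forall m, `|c m| <= C * rho ^+ m.

Lemma subexp_cvg c x : subexp c -> `|x| < 1 -> cvgn (pseries c x).
Proof.
move=> hc x1; have x0 := normr_ge0 x.
pose rho := 2 / (1 + `|x|).
have rho1 : 1 < rho by rewrite /rho ltr_pdivlMr; lra.
have rhox : rho * `|x| < 1 by rewrite /rho mulrAC ltr_pdivrMr; lra.
have [C C0 hC] := hc _ rho1.
apply: normed_cvg; apply: (@series_le_cvg _ _ (geometric C (rho * `|x|))).
- by move=> n; rewrite normr_ge0.
- by move=> n; rewrite /= mulr_ge0// exprn_ge0// mulr_ge0// ltW// (lt_trans _ rho1).
- by move=> n; rewrite /= normrM normrX exprMn mulrA ler_wpM2r ?exprn_ge0.
apply: is_cvg_geometric_series; rewrite ger0_norm// mulr_ge0// ltW//.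
by rewrite (lt_trans _ rho1).
Qed.

(** With rho = t ^ 2, one factor t ^ m bounds the coefficient and the other, by an inequality of
    Bernoulli type, the factor m + 1. *)
Lemma subexp_diffs c : subexp c -> subexp (pseries_diffs c).
Proof.
move=> hc rho rho1; pose t := Num.sqrt rho.
have t2 : t ^+ 2 = rho by rewrite sqr_sqrtr// ltW// (lt_trans _ rho1).
have t0 : 0 <= t by rewrite sqrtr_ge0.
have t1 : 1 < t by rewrite -(@ltr_pXn2r _ 2)// ?nnegrE// t2 expr1n.
have [C C0 hC] := hc _ t1.
pose b := Num.min 1 (t - 1).
have b0 : 0 < b by rewrite lt_min ltr01 subr_gt0.
have bern m : m.+1%:R * b <= t ^+ m.
  elim: m => [|m IH]; first by rewrite mul1r expr0 ge_min lexx.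
  rewrite exprS -natr1 mulrDl mul1r.
  have bt : b <= t - 1 by rewrite ge_min lexx orbT.
  have tm1 : 1 <= t ^+ m by rewrite exprn_ege1// ltW.
  have : b * 1 <= (t - 1) * t ^+ m by apply: ler_pM => //; exact: ltW.
  rewrite mulrBl mulr1 mul1r; lra.
exists (C * t / b); first by rewrite divr_ge0 ?mulr_ge0// ltW.
move=> m; rewrite /pseries_diffs normrM ger0_norm//.
rewrite -t2 -exprM mulnC exprM expr2.
apply: (@le_trans _ _ (m.+1%:R * (C * t ^+ m.+1))); first by rewrite ler_wpM2l.
rewrite exprS (_ : _ * (t ^+ m * t ^+ m) = (C * t * t ^+ m) * (t ^+ m / b)); last by ring.
rewrite (_ : _ * (C * _) = (C * t * t ^+ m) * m.+1%:R); last by ring.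
rewrite ler_wpM2l//.
  by rewrite !mulr_ge0// exprn_ge0.
by rewrite ler_pdivlMr.
Qed.

Lemma pseries_shift c x l : pseries c x @ \oo --> l ->
  pseries (fun m => if m is k.+1 then c k else 0) x @ \oo --> x * l.
Proof.
move=> cl; rewrite -cvg_shiftS/=.
rewrite [X in X @ _ --> _](_ : _ = (fun n => x * pseries c x n)).
  by apply: cvgM => //; exact: cvg_cst.
apply/funext => n; rewrite /pseries /series/= big_nat_recl//= mul0r add0r mulr_sumr.
by apply: eq_bigr => i _; rewrite exprS mulrCA.
Qed.

Lemma pseries_tail c x C r M : (forall m, `|c m| * `|x| ^+ m <= C * r ^+ m) ->
  0 <= r -> r < 1 -> cvgn (pseries c x) ->
  `|limn (pseries c x) - \sum_(m < M) c m * x ^+ m| <= C * r ^+ M / (1 - r).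
Proof.
move=> hC r0 r1 cc.
have C0 : 0 <= C by have := hC 0%N; rewrite !expr0 !mulr1; exact: le_trans.
have main n : `|pseries c x (n + M)%N - \sum_(m < M) c m * x ^+ m| <= C * r ^+ M / (1 - r).
  rewrite /pseries /series/= -(big_mkord xpredT (fun m => c m * x ^+ m)).
  rewrite (@big_cat_nat _ _ _ M)//= ?leq_addl// addrAC subrr add0r.
  rewrite -{1}[M]add0n big_addn addnK.
  apply: (le_trans (ler_norm_sum _ _ _)).
  apply: (@le_trans _ _ (\sum_(0 <= i < n) (C * r ^+ M) * r ^+ i)).
    apply: ler_sum => i _; rewrite normrM normrX.
    by apply: (le_trans (hC _)); rewrite exprD -mulrA [r ^+ i * _]mulrC.
  have := @geometric_seriesE R (C * r ^+ M) r.
  rewrite lt_eqF// => /(_ isT) /(congr1 (fun f => f n)).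
  rewrite /series/= => ->; rewrite ler_wpM2r//; first by rewrite invr_ge0 subr_ge0 ltW.
  by rewrite ler_piMr ?mulr_ge0 ?exprn_ge0// gerBl exprn_ge0.
have h : (fun n => `|pseries c x (n + M)%N - \sum_(m < M) c m * x ^+ m|) @ \oo -->
   `|limn (pseries c x) - \sum_(m < M) c m * x ^+ m|.
  apply: cvg_norm; apply: cvgB; last exact: cvg_cst.
  by rewrite (cvg_shiftn M (pseries c x)).
rewrite -(cvg_lim _ h)//; apply: limr_le; first exact: cvgP h.
by near=> n; exact: main.
Unshelve. all: by end_near. Qed.

End subexponential.

Section mehler.
Context (R : realType).
Implicit Types (u v s x rho B : R) (m : nat).

Lemma hermite_bound_step B m : 0 <= B -> exists2 C : R, 0 <= C &
  forall u, `|u| <= B -> forall j, (j <= m)%N -> hermite j u ^+ 2 / j`!%:R <= C.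
Proof.
move=> B0.
suff [C C0 hC] : exists2 C : R, 0 <= C &
    forall u, `|u| <= B -> forall j, (j <= m)%N -> `|hermite j u| <= C.
  exists (C ^+ 2); first exact: exprn_ge0.
  move=> u uB j jm; rewrite ler_pdivrMr ?ltr0n ?fact_gt0//.
  apply: (@le_trans _ _ (C ^+ 2)).
    by rewrite -(real_normK (num_real (hermite j u))) ler_pXn2r ?nnegrE// hC.
  by rewrite ler_peMr ?exprn_ge0// ler1n fact_gt0.
elim: m => [|m [C C0 IH]].
  exists 1 => // u _ j; rewrite leqn0 => /eqP ->.
  by rewrite normr1.
exists ((B + m%:R + 1) * (C + 1)).
  by rewrite mulr_ge0// !addr_ge0.
move=> u uB j; rewrite leq_eqVlt => /orP[/eqP ->|jm]; last first.
  apply: (le_trans (IH u uB j jm)); rewrite mulrDl mul1r addrC.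
  rewrite -[leLHS]addr0; apply: lerD; first by rewrite lerDl.
  by rewrite mulr_ge0// addr_ge0.
case: m IH => [|m] IH.
  rewrite /= addr0; apply: (le_trans uB).
  by apply: (@le_trans _ _ ((B + 1) * 1)); [lra|rewrite ler_wpM2l//; lra].
rewrite hermiteSS; apply: (le_trans (ler_normB _ _)).
have h1 := IH u uB m.+1 (leqnn _).
have h0 := IH u uB m (leqnSn _).
apply: (@le_trans _ _ (B * C + m.+1%:R * C)).
  by rewrite !normrM; apply: lerD; apply: ler_pM => //; rewrite ger0_norm.
rewrite -mulrDl; apply: ler_pM => //; first by rewrite addr_ge0.
  by rewrite lerDl.
by rewrite lerDl.
Qed.

(** Induction on the recurrence, split by Young's inequality with t = rho - 1. The two parts use t
    (m + 2) and m + 1 out of the available rho (m + 2), provided m + 2 >= K; smaller degrees are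
    covered by [hermite_bound_step]. *)
Lemma hermite_bound B rho : 0 <= B -> 1 < rho -> exists2 C : R, 0 <= C &
  forall u, `|u| <= B -> forall m, hermite m u ^+ 2 / m`!%:R <= C * rho ^+ m.
Proof.
move=> B0 rho1.
(* Solves rho / t * B ^ 2 = t * K for t = rho - 1, so that the term containing u is absorbed once
   the degree reaches [K]. *)
pose K := rho * B ^+ 2 / (rho - 1) ^+ 2.
have rho1' : 0 < rho - 1 by rewrite subr_gt0.
have rho0 : 0 < rho by apply: lt_trans rho1.
have K0 : 0 <= K by rewrite divr_ge0 ?mulr_ge0 ?exprn_ge0// ltW.
pose m1 := Num.bound K.
have hm1 : K < m1%:R by exact: archi_boundP.
have [C C0 hC] := hermite_bound_step m1.+1 B0.
exists C => // u uB.
have rm m : 1 <= rho ^+ m by rewrite exprn_ege1// ltW.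
have base m : (m <= m1.+1)%N -> hermite m u ^+ 2 / m`!%:R <= C * rho ^+ m.
  by move=> /(hC u uB) /le_trans; apply; rewrite ler_peMr.
suff H m : hermite m u ^+ 2 / m`!%:R <= C * rho ^+ m /\
    hermite m.+1 u ^+ 2 / m.+1`!%:R <= C * rho ^+ m.+1 by move=> m; case: (H m).
elim: m => [|m [IH1 IH2]]; first by split; apply: base.
split=> //; have [|mm1] := leqP m.+2 m1.+1; first exact: base.
have {}mm1 : K <= m.+2%:R.
  by apply: (le_trans (ltW hm1)); rewrite ler_nat; apply: leq_trans mm1; apply: leq_trans (leqnSn _) (leqnSn _).
rewrite hermiteSS.
set h1 := hermite m.+1 u in IH2 *; set h0 := hermite m u in IH1 *.
have f0 : 0 < m`!%:R :> R by rewrite ltr0n fact_gt0.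
have n2 : 0 < m.+2%:R :> R by rewrite ltr0n.
have n1 : 0 < m.+1%:R :> R by rewrite ltr0n.
pose t := rho - 1.
(* Young: (x - y)^2 <= (1 + 1/t) x^2 + (1 + t) y^2 *)
have young a b : (a - b) ^+ 2 <= (1 + t^-1) * a ^+ 2 + (1 + t) * b ^+ 2.
  rewrite -subr_ge0 (_ : _ - _ = t * (t^-1 * a + b) ^+ 2).
    by rewrite mulr_ge0 ?sqr_ge0// ltW.
  by field; rewrite gt_eqF.
have fE1 : m.+1`!%:R = m.+1%:R * m`!%:R :> R by rewrite factS natrM.
have fE2 : m.+2`!%:R = m.+2%:R * (m.+1%:R * m`!%:R) :> R by rewrite factS natrM fE1.
rewrite fE2; rewrite fE1 in IH2.
rewrite ler_pdivrMr; last by rewrite !mulr_gt0.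
move: IH1 IH2; rewrite ler_pdivrMr// => IH1; rewrite ler_pdivrMr ?mulr_gt0// => IH2.
apply: (le_trans (young _ _)).
have u2 : u ^+ 2 <= B ^+ 2.
  by rewrite -(real_normK (num_real u)) ler_pXn2r// nnegrE.
pose X := C * rho ^+ m * (m.+1%:R * m`!%:R).
have X0 : 0 <= X by rewrite !mulr_ge0// exprn_ge0// ltW.
have -> : C * rho ^+ m.+2 * (m.+2%:R * (m.+1%:R * m`!%:R)) = rho * X * ((t + 1) * m.+2%:R).
  by rewrite /X /t !exprS; ring.
have A1 : (1 + t^-1) * (u * h1) ^+ 2 <= rho * X * (t * m.+2%:R).
  have -> : 1 + t^-1 = rho / t by rewrite /t; field; rewrite gt_eqF.
  rewrite exprMn (mulrA (rho / t)).
  apply: (@le_trans _ _ ((rho / t * B ^+ 2) * (rho * X))).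
    apply: ler_pM; [|exact: sqr_ge0| |].
    - by rewrite mulr_ge0 ?sqr_ge0// divr_ge0// ltW.
    - by rewrite ler_wpM2l// divr_ge0// ltW.
    - by apply: (le_trans IH2); rewrite /X exprS le_eqVlt; apply/orP; left; apply/eqP; ring.
  rewrite mulrC; apply: ler_wpM2l; first by rewrite mulr_ge0// ltW.
  rewrite (_ : rho / t * B ^+ 2 = t * K); last by rewrite /K /t; field; rewrite gt_eqF.
  by rewrite ler_wpM2l// ltW.
have A2 : (1 + t) * (m.+1%:R * h0) ^+ 2 <= rho * X * m.+1%:R.
  have -> : 1 + t = rho by rewrite /t; ring.
  rewrite exprMn -mulrA; apply: ler_wpM2l; first exact: ltW.
  have -> : X * m.+1%:R = m.+1%:R ^+ 2 * (C * rho ^+ m * m`!%:R) by rewrite /X; ring.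
  by apply: ler_wpM2l => //; exact: sqr_ge0.
apply: (@le_trans _ _ (rho * X * (t * m.+2%:R + m.+1%:R))).
  by rewrite mulrDr; exact: lerD.
apply: ler_wpM2l; first by rewrite mulr_ge0// ltW.
by rewrite [(t + 1) * _]mulrDl mul1r lerD2l ler_nat.
Qed.

Lemma mehler_coef_bound B rho : 0 <= B -> 1 < rho -> exists2 C : R, 0 <= C &
  forall u v, `|u| <= B -> `|v| <= B -> forall m, `|mehler_coef m u v| <= C * rho ^+ m.
Proof.
move=> B0 rho1; have [C C0 hC] := hermite_bound B0 rho1.
exists C => // u v uB vB m.
have f0 : 0 < m`!%:R :> R by rewrite ltr0n fact_gt0.
have := hC u uB m; have := hC v vB m.
rewrite !ler_pdivrMr// => h1 h2.
rewrite /mehler_coef normrM [X in _ * X]gtr0_norm ?invr_gt0// ler_pdivrMr//.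
rewrite ler_norml; apply/andP; split; [have := sqr_ge0 (hermite m u + hermite m v)|
   have := sqr_ge0 (hermite m u - hermite m v)]; rewrite ?sqrrD ?sqrrB; lra.
Qed.

Lemma subexp_mehler u v : subexp (fun m => mehler_coef m u v).
Proof.
move=> rho rho1; pose B := `|u| + `|v|.
have B0 : 0 <= B by rewrite addr_ge0.
have [C C0 hC] := mehler_coef_bound B0 rho1.
by exists C => // m; apply: hC; rewrite /B ?lerDl ?lerDr.
Qed.

Definition mehler_exponent s u v : R :=
  (s * (u * v) - s ^+ 2 * (u ^+ 2 + v ^+ 2) / 2) / (1 - s ^+ 2).

Definition mehler s u v : R := limn (pseries (fun m => mehler_coef m u v) s).

(** With the series of these mixed products, the Hermite recurrence becomes a set of linear
    relations between power series in s. *)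
Let q u v m : R := hermite m u * hermite m.+1 v / m`!%:R.
Let shift (c : nat -> R) m : R := if m is k.+1 then c k else 0.

(** The inequality |x y| <= x^2 + y^2 reduces the mixed products to diagonal coefficients of degrees
    m and m + 1; dividing the latter by m! instead of (m + 1)! is exactly the effect of
    [pseries_diffs]. *)
Let subexp_q u v : subexp (q u v).
Proof.
move=> rho rho1; have [C C0 hC] := subexp_mehler u u rho1.
have [C' C0' hC'] := subexp_diffs (subexp_mehler v v) rho1.
exists (C + C') => [|m]; first by rewrite addr_ge0.
apply: (@le_trans _ _ (`|mehler_coef m u u| +
    `|pseries_diffs (fun m => mehler_coef m v v) m|)); last by rewrite mulrDl lerD.
have f0 : 0 < m`!%:R :> R by rewrite ltr0n fact_gt0.
have -> : pseries_diffs (fun m => mehler_coef m v v) m = hermite m.+1 v ^+ 2 / m`!%:R.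
  rewrite /pseries_diffs /mehler_coef factS natrM; field.
  by rewrite gt_eqF//= nat1r pnatr_eq0.
have fi : 0 <= m`!%:R^-1 :> R by rewrite invr_ge0 ltW.
have sq x : 0 <= x ^+ 2 / m`!%:R by rewrite mulr_ge0// sqr_ge0.
rewrite /mehler_coef -expr2 (ger0_norm (sq _)) (ger0_norm (sq _)) /q normrM.
rewrite (ger0_norm fi) -mulrDl ler_wpM2r//.
set a := hermite m u; set b := hermite m.+1 v.
by rewrite ler_norml; apply/andP; split; [have := sqr_ge0 (a + b)|have := sqr_ge0 (a - b)];
  rewrite ?sqrrD ?sqrrB; have := sqr_ge0 a; have := sqr_ge0 b; lra.
Qed.

Let pseries_lin (a b : R) c e x (l l' : R) : pseries c x @ \oo --> l -> pseries e x @ \oo --> l' ->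
  pseries (fun m => a * c m + b * e m) x @ \oo --> a * l + b * l'.
Proof.
move=> cl el; rewrite (_ : pseries _ _ = (fun n => a * pseries c x n + b * pseries e x n)).
  by apply: cvgD; apply: cvgM => //; exact: cvg_cst.
apply/funext => n; rewrite /pseries /series/= !mulr_sumr -big_split/=.
by apply: eq_bigr => i _; rewrite mulrDl !mulrA.
Qed.

Let q_rec u v m : q u v m = v * mehler_coef m u v + - 1 * shift (q v u) m.
Proof.
case: m => [|m]; first by rewrite /q /mehler_coef /shift/=; ring.
rewrite /q /shift hermiteSS /mehler_coef factS natrM; field.
by rewrite nat1r !pnatr_eq0 -lt0n fact_gt0.
Qed.

(** The recurrence is applied to the factor of degree m + 1 in u, then in the remaining term to the
    one in v; the factor m left over is split as (m - 1) + 1. *)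
Let diffs_rec u v m : pseries_diffs (fun m => mehler_coef m u v) m =
  1 * (u * q u v m + - v * shift (q u v) m) +
  1 * (1 * shift (shift (pseries_diffs (fun m => mehler_coef m u v))) m +
       1 * shift (fun m => mehler_coef m u v) m).
Proof.
rewrite /pseries_diffs /q /mehler_coef /shift.
have f1 : 1`! = 1%N by [].
have f2 : 2`! = 2%N by [].
case: m => [|[|m]].
- by rewrite /= f1 fact0; field.
- by rewrite /= f1 f2 fact0; field.
rewrite (hermiteSS m.+1 u) (hermiteSS m.+1 v) !factS !natrM; field.
by rewrite !nat1r -!natrD !pnatr_eq0 -lt0n fact_gt0.
Qed.

(* A linear differential equation in [s], solved by
   expR (mehler_exponent s u v) / sqrt (1 - s ^+ 2). *)
Lemma mehler_derive s u v : `|s| < 1 ->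
  is_derive s (1 : R) (fun x => mehler x u v)
    (((u - s * v) * (v - s * u) / (1 - s ^+ 2) + s) / (1 - s ^+ 2) * mehler s u v).
Proof.
move=> s1.
have sc := subexp_mehler u v.
have s2 : 1 - s ^+ 2 != 0.
  rewrite subr_eq0 eq_sym lt_eqF// -(real_normK (num_real s)).
  by rewrite expr_lt1.
set c := (fun m => mehler_coef m u v) in sc.
have sd := subexp_diffs sc; have sdd := subexp_diffs sd.
pose F := mehler s u v.
pose D : R := limn (pseries (pseries_diffs c) s).
pose Q u v : R := limn (pseries (q u v) s).
have cF : pseries c s @ \oo --> F := subexp_cvg sc s1.
have cD : pseries (pseries_diffs c) s @ \oo --> D := subexp_cvg sd s1.
have cQ u' v' : pseries (q u' v') s @ \oo --> Q u' v' := subexp_cvg (@subexp_q u' v') s1.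
(* Taken for (u, v) and for (v, u), [q_rec] is a linear system in Q u v and Q v u with determinant 1
   - s ^ 2. *)
have QE : Q u v = v * F + - 1 * (s * Q v u).
  have h := pseries_lin (a:=v) (b:=-1) cF (pseries_shift (cQ v u)).
  rewrite -(cvg_lim _ h)//; congr (limn (pseries _ s)).
  by apply/funext => m; rewrite q_rec.
have QE' : Q v u = u * F + - 1 * (s * Q u v).
  have h := pseries_lin (a:=u) (b:=-1) cF (pseries_shift (cQ u v)).
  rewrite -(cvg_lim _ h)//; congr (limn (pseries _ s)).
  by apply/funext => m; rewrite q_rec /c /mehler_coef; congr (u * (_ / _) + _); rewrite mulrC.
have DE : D = 1 * (u * Q u v + - v * (s * Q u v)) + 1 * (1 * (s * (s * D)) + 1 * (s * F)).
  have h1 := pseries_lin (a:=u) (b:=- v) (cQ u v) (pseries_shift (cQ u v)).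
  have h2 := pseries_lin (a:=1) (b:=1) (pseries_shift (pseries_shift cD)) (pseries_shift cF).
  have h := pseries_lin (a:=1) (b:=1) h1 h2.
  rewrite -[RHS](cvg_lim _ h)//; congr (limn (pseries _ s)).
  by apply/funext => m; rewrite diffs_rec.
have QF : Q u v = (v - s * u) / (1 - s ^+ 2) * F.
  apply: (mulfI s2); rewrite (_ : _ * (_ / _ * F) = (v - s * u) * F); last by field.
  by rewrite {1}QE' in QE; move: QE; lra.
have -> : ((u - s * v) * (v - s * u) / (1 - s ^+ 2) + s) / (1 - s ^+ 2) * mehler s u v = D.
  rewrite -/F; apply: (mulfI s2).
  transitivity ((u - s * v) * Q u v + s * F); first by rewrite QF; field.
  by move: DE; lra.
(* A point strictly between |s| and 1, where the differentiated series still converge. *)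
pose K := (1 + `|s|) / 2.
have K1 : `|K| < 1.
  rewrite ger0_norm; first by rewrite /K; lra.
  by rewrite divr_ge0// addr_ge0.
apply: (@pseries_snd_diffs _ c K); [exact: subexp_cvg..|].
rewrite (@ger0_norm _ K); first by rewrite /K; lra.
by rewrite divr_ge0// addr_ge0.
Qed.

Lemma mehler0 u v : mehler 0 u v = 1.
Proof.
apply: cvg_lim => //; rewrite -cvg_shiftS/=.
rewrite [X in X @ _](_ : _ = (fun=> 1)); first exact: cvg_cst.
apply/funext => n; rewrite /pseries /series/= big_nat_recl//= expr0 mulr1.
rewrite big1 ?addr0; first by rewrite /mehler_coef/= fact0 !mul1r invr1.
by move=> i _; rewrite exprS mul0r mulr0.
Qed.

(** The series divided by its closed form has derivative zero and equals 1 at s = 0. The prefactor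
    (1 - s ^ 2) ^ (-1/2) is at least 1 and is dropped. *)
Lemma mehler_ge s u v : 0 <= s -> s < 1 -> expR (mehler_exponent s u v) <= mehler s u v.
Proof.
move=> s0 s1.
have pos x : `|x| < 1 -> 0 < 1 - x ^+ 2.
  by move=> x1; rewrite subr_gt0 -(real_normK (num_real x)) expr_lt1.
pose E x := (- mehler_exponent x u v) + ln (1 - x ^+ 2) / 2.
pose L x := mehler x u v * expR (E x).
have dL x : `|x| < 1 -> is_derive x (1 : R) L 0.
  move=> x1; have p1 := pos _ x1.
  have p2 : 1 - x ^+ 2 != 0 by rewrite gt_eqF.
  have d1 := mehler_derive u v x1.
  have ext (f g : R -> R) df df' : (forall y, f y = g y) -> df = df' ->
      is_derive x (1 : R) f df -> is_derive x (1 : R) g df'.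
    by move=> /funext -> ->.
  have dX : is_derive x (1 : R) (fun y => y ^+ 2) (2 * x).
    apply: (ext _ _ _ _ _ _ (is_deriveM (is_derive_id x 1) (is_derive_id x 1))) => [y|]//.
    by rewrite /GRing.scale/=; ring.
  have dp : is_derive x (1 : R) (fun y => 1 - y ^+ 2) (- (2 * x)).
    apply: (ext _ _ _ _ _ _ (is_deriveB (is_derive_cst (1 : R^o) x (1 : R^o)) dX)) => [y|]//.
    by rewrite sub0r.
  have dpi : is_derive x (1 : R) (fun y => (1 - y ^+ 2)^-1) (2 * x / (1 - x ^+ 2) ^+ 2).
    apply: (ext _ _ _ _ _ _ (is_deriveV (f := fun y => 1 - y ^+ 2) p2 dp)) => [y|]//.
    by rewrite /GRing.scale/=; field.
  have dln : is_derive x (1 : R) (fun y => ln (1 - y ^+ 2)) (- (2 * x) / (1 - x ^+ 2)).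
    apply: (ext _ _ _ _ _ _ (is_derive1_comp (g := fun y => 1 - y ^+ 2) (is_derive1_ln p1) dp)) => [y|]//.
    by rewrite mulrC.
  have dn : is_derive x (1 : R) (fun y => y * (u * v) - y ^+ 2 * ((u ^+ 2 + v ^+ 2) / 2))
     (u * v - x * (u ^+ 2 + v ^+ 2)).
    apply: (ext _ _ _ _ _ _ (is_deriveB (is_deriveM (is_derive_id x 1) (is_derive_cst (u * v : R^o) x (1 : R^o)))
      (is_deriveM dX (is_derive_cst ((u ^+ 2 + v ^+ 2) / 2 : R^o) x (1 : R^o))))) => [y|]//.
    by rewrite /GRing.scale/=; field.
  have dE : is_derive x (1 : R) E
      (- ((u - x * v) * (v - x * u) / (1 - x ^+ 2) + x) / (1 - x ^+ 2)).
    apply: (ext _ _ _ _ _ _ (is_deriveB (is_deriveM dln (is_derive_cst (2^-1 : R^o) x (1 : R^o)))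
      (is_deriveM dn dpi))) => [y|].
      by rewrite /E /mehler_exponent [RHS]addrC -[_ * _ / 2]mulrA.
    by rewrite /GRing.scale/=; field.
  apply: (ext _ _ _ _ _ _ (is_deriveM d1 (is_derive1_comp (is_derive_expR (E x)) dE))) => [y|]//.
  by rewrite /GRing.scale/=; field.
have L0 : L 0 = 1.
  rewrite /L /E /mehler_exponent mehler0 expr0n/= subr0 ln1 !mul0r subr0.
  by rewrite mul0r oppr0 addr0 expR0 mulr1.
have Ls : L s = 1.
  have [->|s0'] := eqVneq s 0; first exact: L0.
  have sp : 0 < s by rewrite lt_def s0' s0.
  have in1 x : x \in `[0, s] -> `|x| < 1.
    by rewrite in_itv/= => /andP[x0 xs]; rewrite ger0_norm//; exact: le_lt_trans s1.
  have [||c _] := @MVT _ L (fun=> 0) 0 s sp.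
  - by move=> x /subset_itv_oo_cc; move=> /in1; exact: dL.
  - apply: derivable_within_continuous => x /in1 /dL h; exact: ex_derive.
  - by rewrite mul0r => /eqP; rewrite subr_eq0 L0 => /eqP.
have s1' : `|s| < 1 by rewrite ger0_norm.
have -> : mehler s u v = expR (- E s).
  by rewrite expRN; apply: (mulIf (lt0r_neq0 (expR_gt0 (E s)))); rewrite mulVf ?gt_eqF ?expR_gt0.
rewrite ler_expR /E opprD opprK lerDl oppr_ge0 pmulr_lle0//.
by apply: ln_le0; rewrite lerBlDr lerDl sqr_ge0.
Qed.

Lemma mehler_sum_cvg s B e : 0 <= s -> s < 1 -> 0 <= B -> 0 < e ->
  exists M0 : nat, forall M, (M0 <= M)%N -> forall u v, `|u| <= B -> `|v| <= B ->
    `|mehler_sum M s u v - mehler s u v| <= e.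
Proof.
move=> s0 s1 B0 e0.
(* Larger than 1 with rho * s < 1, so that the coefficient bound leaves a geometric tail, uniform in
   u and v. *)
pose rho := 2 / (1 + s).
have rho1 : 1 < rho by rewrite /rho ltr_pdivlMr; lra.
have rhos : rho * s < 1 by rewrite /rho mulrAC ltr_pdivrMr; lra.
have r0 : 0 <= rho * s by rewrite mulr_ge0// ltW// (lt_trans _ rho1).
have [C C0 hC] := mehler_coef_bound B0 rho1.
have : (fun M => C / (1 - rho * s) * (rho * s) ^+ M.+1) @ \oo --> C / (1 - rho * s) * 0.
  apply: cvgM; first exact: cvg_cst.
  rewrite (cvg_shiftS (fun M => (rho * s) ^+ M)); apply: cvg_expr; by rewrite ger0_norm.
rewrite mulr0 => /cvgrPdist_le/(_ e e0)[M0 _ hM0].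
exists M0 => M MM u v uB vB.
have := hM0 M MM; rewrite sub0r normrN => h; apply: le_trans h.
apply: le_trans (ler_norm _).
rewrite distrC (_ : mehler_sum _ _ _ _ = \sum_(m < M.+1) mehler_coef m u v * s ^+ m); last first.
  by apply: eq_bigr => m _; rewrite mulrC.
have := @pseries_tail R (fun m => mehler_coef m u v) s C (rho * s) M.+1.
rewrite (mulrAC C); apply=> //.
  move=> m; rewrite (ger0_norm s0) exprMn mulrA ler_wpM2r ?exprn_ge0//.
  exact: hC.
by apply: subexp_cvg; [exact: subexp_mehler|rewrite ger0_norm].
Qed.

Lemma mehler_bounded s B : 0 <= s -> s < 1 -> 0 <= B -> exists2 C : R, 0 <= C &
  forall u v, `|u| <= B -> `|v| <= B -> `|mehler s u v| <= C.
Proof.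
move=> s0 s1 B0; have [M0 hM0] := mehler_sum_cvg s0 s1 B0 ltr01.
have [C C0 hC] := mehler_coef_bound B0 (ltr1n _ 2).
exists (1 + \sum_(m < M0.+1) C * 2 ^+ m).
  by rewrite addr_ge0// sumr_ge0// => m _; rewrite mulr_ge0// exprn_ge0.
move=> u v uB vB; have h := hM0 M0 (leqnn _) u v uB vB.
have -> : mehler s u v = - (mehler_sum M0 s u v - mehler s u v) + mehler_sum M0 s u v by ring.
apply: (le_trans (ler_normD _ _)); rewrite normrN; apply: lerD => //.
apply: (le_trans (ler_norm_sum _ _ _)); apply: ler_sum => m _.
rewrite normrM -[leRHS]mul1r ler_pM//; last exact: hC.
by rewrite ger0_norm ?exprn_ge0// exprn_ile1// ltW.
Qed.

End mehler.

Section trunc_kernel_lower.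
Context (R : realType) (I : finType).
Implicit Types (s U V : I -> R).

Lemma prod_approx (C d : R) (r : seq I) (x y : I -> R) : 0 <= C -> 0 <= d <= 1 ->
  (forall k, `|y k| <= C) -> (forall k, `|x k - y k| <= d) ->
  `|\prod_(k <- r) x k - \prod_(k <- r) y k| <= d * ((size r)%:R * (C + 1) ^+ size r)
  /\ `|\prod_(k <- r) y k| <= (C + 1) ^+ size r.
Proof.
move=> C0 /andP[d0 d1] yC xy; elim: r => [|k r [IH1 IH2]].
  by rewrite !big_nil subrr normr0 normr1 mul0r mulr0 expr0.
rewrite !big_cons; set X := \prod_(_ <- r) x _ in IH1 *; set Y := \prod_(_ <- r) y _ in IH1 IH2 *.
have CC : 0 <= C + 1 by rewrite addr_ge0.
have yC1 : `|y k| <= C + 1 by apply: (le_trans (yC k)); rewrite lerDl.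
split; last by rewrite normrM exprS ler_pM.
have xk : `|x k| <= C + 1.
  have -> : x k = y k + (x k - y k) by ring.
  apply: (le_trans (ler_normD _ _)); apply: lerD => //; exact: le_trans (xy k) d1.
have -> : x k * X - y k * Y = x k * (X - Y) + (x k - y k) * Y by ring.
apply: (le_trans (ler_normD _ _)); rewrite !normrM /=.
apply: (@le_trans _ _ ((C + 1) * (d * ((size r)%:R * (C + 1) ^+ size r)) + d * (C + 1) ^+ size r)).
  by apply: lerD; apply: ler_pM.
rewrite -natr1 exprS -subr_ge0.
rewrite (_ : _ - _ = d * C * (C + 1) ^+ size r); last by ring.
by rewrite !mulr_ge0// exprn_ge0.
Qed.

(** [M] is fixed first, since [eta] and [N0] depend on it. Half of [e] pays for the tails of the
    Mehler series, uniformly for arguments bounded by [B], and half for the passage in N. *)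
Lemma trunc_kernel_lower s (B e : R) : (forall k, 0 <= s k < 1) -> 0 <= B -> 0 < e ->
  exists M0 : nat, forall M, (M0 <= M)%N ->
  exists eta : R, exists N0 : nat, [/\ 0 < eta, (0 < N0)%N &
  forall N (a b : 'I_N -> I -> R), (N0 <= N)%N ->
    let r : R := Num.sqrt N%:R in
    let U k := (\sum_i a i k) / r in let V k := (\sum_i b i k) / r in
    (forall i k, `|a i k| <= eta * r) -> (forall i k, `|b i k| <= eta * r) ->
    (forall k l, `|(\sum_i a i k * a i l) / N%:R - (k == l)%:R| <= eta) ->
    (forall k l, `|(\sum_i b i k * b i l) / N%:R - (k == l)%:R| <= eta) ->
    (forall k, `|U k| <= B) -> (forall k, `|V k| <= B) ->
    expR (\sum_k mehler_exponent (s k) (U k) (V k)) - e <= trunc_kernel M s a b].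
Proof.
move=> hs B0 e0.
have hs1 k : 0 <= s k <= 1 by case/andP: (hs k) => -> /ltW ->.
have /choice[Cf hCf] : forall k, exists C : R, 0 <= C /\
    forall u v, `|u| <= B -> `|v| <= B -> `|mehler (s k) u v| <= C.
  by move=> k; case/andP: (hs k) => s0 s1; have [C C0 hC] := mehler_bounded s0 s1 B0; exists C.
pose C := \sum_k Cf k.
have C0 : 0 <= C by apply: sumr_ge0 => k _; case: (hCf k).
have CfC k : Cf k <= C.
  by rewrite /C (bigD1 k)//= lerDl sumr_ge0// => l _; case: (hCf l).
pose n := size (index_enum I).
pose K := n%:R * (C + 1) ^+ n.
have K0 : 0 <= K by rewrite mulr_ge0// exprn_ge0// addr_ge0.
pose d := Num.min 1 (e / 2 / (K + 1)).
have d0 : 0 < d by rewrite lt_min ltr01 !divr_gt0//; lra.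
have d1 : d <= 1 by rewrite ge_min lexx.
have dK : d * K <= e / 2.
  apply: (@le_trans _ _ (e / 2 / (K + 1) * (K + 1))).
    by apply: ler_pM => //; [exact: ltW|rewrite ge_min lexx orbT|rewrite lerDl].
  by rewrite mulfVK// gt_eqF//; lra.
have /choice[Mf hMf] : forall k, exists M0 : nat, forall M, (M0 <= M)%N ->
    forall u v, `|u| <= B -> `|v| <= B -> `|mehler_sum M (s k) u v - mehler (s k) u v| <= d.
  by move=> k; case/andP: (hs k) => s0 s1; exact: mehler_sum_cvg.
exists (\max_k Mf k)%N => M MM.
have e2 : 0 < e / 2 by rewrite divr_gt0.
have [eta [N0 [eta0 N00 H]]] := trunc_kernel_limit M B0 e2 hs1.
exists eta, N0; split => // N a b NN r U V ha hb hGa hGb hU hV.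
have := H N a b NN ha hb hGa hGb hU hV.
have [|||h1 _ h2] := @prod_approx C d (index_enum I)
    (fun k => mehler_sum M (s k) (U k) (V k)) (fun k => mehler (s k) (U k) (V k)) C0.
- by rewrite ltW.
- by move=> k; apply: le_trans (CfC k); case: (hCf k) => _; apply.
- by move=> k; apply: hMf => //; apply: leq_trans MM; exact: leq_bigmax.
have h3 : expR (\sum_k mehler_exponent (s k) (U k) (V k)) <= \prod_k mehler (s k) (U k) (V k).
  rewrite expR_sum; apply: ler_prod => k _.
  by rewrite expR_ge0/=; case/andP: (hs k) => s0 s1; exact: mehler_ge.
have {}h1 := le_trans h1 dK.
by move: h1 h2; rewrite !ler_norml => /andP[h1 _] /andP[h2 _]; lra.
Qed.

End trunc_kernel_lower.

(** * Independence and word orthogonality *)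

Section independent_products.
Context d d' (Om : measurableType d) (S : measurableType d') (R : realType).
Variable Pr : probability Om R.
Local Open Scope ereal_scope.
Import HBNNSimple.

Let integral_mul_comp_nnsfun (mu : probability S R) (V : Om -> S) (H : Om -> R) (c : R)
    (g : {nnsfun S >-> R}) :
  measurable_fun setT V -> measurable_fun setT H -> (forall w, 0 <= H w)%R ->
  (forall A, measurable A -> \int[Pr]_w (H w * \1_A (V w))%:E = c%:E * mu A) ->
  \int[Pr]_w (H w * g (V w))%:E = c%:E * \int[mu]_x (g x)%:E.
Proof.
move=> mV mH H0 hA.
have mi r : measurable_fun setT (fun w => (H w * \1_(g @^-1` [set r]) (V w))%:E).
  apply/measurable_EFinP; apply: measurable_funM => //.
  by apply: (measurableT_comp (f := \1_(g @^-1` [set r]) : S -> R)).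
have nn r w : 0 <= (H w * (r * \1_(g @^-1` [set r]) (V w)))%:E.
  by rewrite EFinM mule_ge0//; [rewrite lee_fin | rewrite EFinM nnfun_muleindic_ge0].
under eq_integral.
  move=> w _; rewrite fimfunE EFinM -fsumEFin// ge0_mule_fsumr; last first.
    by move=> r; rewrite EFinM nnfun_muleindic_ge0.
  under eq_fsbigr do rewrite -EFinM.
  over.
rewrite ge0_integral_fsum//; last first.
  move=> r; apply/measurable_EFinP; apply: measurable_funM => //.
  apply: measurable_funM => //; exact: measurableT_comp.
under [in RHS]eq_integral do rewrite fimfunE -fsumEFin//.
rewrite ge0_integral_fsum//; last 2 first.
- by move=> r; apply/measurable_EFinP; apply: measurable_funM.
- by move=> r x _; rewrite EFinM nnfun_muleindic_ge0.
rewrite ge0_mule_fsumr; last first.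
  by move=> r; apply: integral_ge0 => x _; rewrite EFinM nnfun_muleindic_ge0.
apply: eq_fsbigr => r; rewrite inE => -[z _ <-].
under eq_integral do rewrite mulrCA EFinM.
rewrite ge0_integralZl//; last 2 first.
- by move=> w _; rewrite lee_fin mulr_ge0.
- by rewrite lee_fin.
rewrite hA//; under eq_integral do rewrite EFinM.
rewrite ge0_integralZl//; last 2 first.
- exact/measurable_EFinP.
- by rewrite lee_fin.
by rewrite integral_indic// setIT muleCA.
Qed.

(** The hypothesis says that the measure of density [H] has image c * mu under [V]. It passes from
    indicators to simple functions and, by monotone convergence, to nonnegative ones. *)
Lemma integral_mul_comp (mu : probability S R) (V : Om -> S) (H : Om -> R) (c : R)
    (f : S -> R) :
  measurable_fun setT V -> measurable_fun setT H -> (forall w, 0 <= H w)%R ->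
  (forall A, measurable A -> \int[Pr]_w (H w * \1_A (V w))%:E = c%:E * mu A) ->
  measurable_fun setT f -> (forall x, 0 <= f x)%R ->
  \int[Pr]_w (H w * f (V w))%:E = c%:E * \int[mu]_x (f x)%:E.
Proof.
move=> mV mH H0 hA mf f0.
have mf' : measurable_fun setT (EFin \o f) by exact/measurable_EFinP.
pose g := nnsfun_approx measurableT mf'.
have gf x : (g n x)%:E @[n --> \oo] --> (f x)%:E.
  by apply: cvg_nnsfun_approx => // y _; rewrite lee_fin.
have nd x : {homo (fun n => (g n x)%:E) : m n / (m <= n)%N >-> m <= n}.
  by move=> m n mn; rewrite lee_fin; exact/lefP/nd_nnsfun_approx.
have h1 : \int[mu]_x (g n x)%:E @[n --> \oo] --> \int[mu]_x (f x)%:E.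
  under [X in _ --> X]eq_integral => x _ do rewrite -(cvg_lim _ (gf x))//.
  apply: cvg_monotone_convergence => //.
  - by move=> n; apply/measurable_EFinP.
  - by move=> n x _; rewrite lee_fin.
have h2 : \int[Pr]_w (H w * g n (V w))%:E @[n --> \oo] --> \int[Pr]_w (H w * f (V w))%:E.
  have hl w : (H w * g n (V w))%:E @[n --> \oo] --> (H w * f (V w))%:E.
    by rewrite EFinM; under eq_fun do rewrite EFinM; apply: cvgeZl.
  under [X in _ --> X]eq_integral => w _ do rewrite -(cvg_lim _ (hl w))//.
  apply: cvg_monotone_convergence => //.
  - move=> n; apply/measurable_EFinP; apply: measurable_funM => //.
    exact: measurableT_comp.
  - by move=> n w _; rewrite lee_fin mulr_ge0.
  - by move=> w _ m n mn; rewrite !EFinM lee_wpmul2l// ?lee_fin//; exact: nd.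
have h3 : \int[Pr]_w (H w * g n (V w))%:E @[n --> \oo] --> c%:E * \int[mu]_x (f x)%:E.
  under eq_fun do rewrite (integral_mul_comp_nnsfun _ mV mH H0 hA).
  exact: cvgeZl.
have /(@cvg_unique _ (@ereal_hausdorff R)) := h2; apply; exact: h3.
Qed.

(** Independence and marginal laws in a single formula over the full index set; the choice A i =
    setT recovers subfamilies. *)
Definition indep_with n (V : 'I_n -> Om -> S) (mu : 'I_n -> probability S R) :=
  (forall i, measurable_fun setT (V i)) /\
  forall A : 'I_n -> set S, (forall i, measurable (A i)) ->
    Pr (\bigcap_(i in setT) (V i @^-1` A i)) = \prod_i mu i (A i).

Variables (n : nat) (V : 'I_n -> Om -> S) (mu : 'I_n -> probability S R).
Hypothesis hV : indep_with V mu.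

(** Interpolates between indicators, where the product formula is the hypothesis, and the functions
    [phi], replacing one factor at a time. *)
Let mixed m (phi : 'I_n -> S -> R) (A : 'I_n -> set S) (i : 'I_n) : S -> R :=
  if (i < m)%N then phi i else \1_(A i).

Let prod_EFin (I : finType) (F : I -> R) : (\prod_i F i)%:E = \prod_i (F i)%:E.
Proof. by apply: (big_morph EFin) => // x y; rewrite EFinM. Qed.

Let measurable_mixed m phi A i : measurable_fun setT (phi i) -> measurable (A i) ->
  measurable_fun setT (mixed m phi A i).
Proof. by move=> mp mA; rewrite /mixed; case: ifP => // _; exact: measurable_indic. Qed.

Let mixed_ge0 m (phi : 'I_n -> S -> R) A i x : (forall i x, 0 <= phi i x)%R ->
  (0 <= mixed m phi A i x)%R.
Proof. by move=> phi0; rewrite /mixed; case: ifP. Qed.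

Let measurable_prod_comp (P : pred 'I_n) (f : 'I_n -> S -> R) :
  (forall i, measurable_fun setT (f i)) ->
  measurable_fun setT (fun w => \prod_(i | P i) f i (V i w))%R.
Proof.
move=> mf; under eq_fun do rewrite big_mkcond/=.
apply: measurable_prod => i _; case: (P i) => //; apply: measurableT_comp => //.
by case: hV.
Qed.

Let integral_mixed m (phi : 'I_n -> S -> R) :
  (forall i, (mu i).-integrable setT (EFin \o phi i)) -> (forall i x, 0 <= phi i x)%R ->
  forall A, (forall i, measurable (A i)) ->
  \int[Pr]_w (\prod_i mixed m phi A i (V i w))%:E =
  (\prod_i \int[mu i]_x mixed m phi A i x)%R%:E.
Proof.
move=> iphi phi0; have mphi i : measurable_fun setT (phi i).
  by apply/measurable_EFinP; exact: measurable_int (iphi i).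
elim: m => [|m IH] A mA.
  rewrite prod_EFin (eq_bigr (fun i => mu i (A i))); last first.
    move=> i _; rewrite /mixed ltn0 /Rintegral integral_indic// setIT fineK//.
    exact: fin_num_measure.
  rewrite -(hV.2 A mA) -[in RHS](setIT (\bigcap_(i in setT) _)) -integral_indic//; last first.
    apply: fin_bigcap_measurable => [|i _]; first exact: finite_finset.
    by rewrite -[X in measurable X]setTI; apply: hV.1.
  apply: eq_integral => w _; congr EFin.
  have E i : mixed 0 phi A i = \1_(A i) by [].
  under eq_bigr do rewrite E.
  have [h|h] := pselect (forall i, A i (V i w)).
    rewrite big1 => [|i _]; first by rewrite indicE mem_set// => i _; exact: h.
    by rewrite indicE mem_set.
  rewrite [RHS]indicE memNset; last by move=> h'; apply: h => i; exact: h'.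
  move/existsNP: h => [i hi]; rewrite (bigD1 i)//= indicE memNset// mul0r//.
have [mn|nm] := ltnP m n; last first.
  have E i : mixed m.+1 phi A i = mixed m phi A i.
    by rewrite /mixed (leq_trans (ltn_ord i) (leqW nm)) (leq_trans (ltn_ord i) nm).
  under eq_integral => w _ do under eq_bigr do rewrite E.
  rewrite IH//; congr EFin; apply: eq_bigr => i _; by rewrite E.
pose i0 := Ordinal mn.
have mixE i : i != i0 -> mixed m.+1 phi A i = mixed m phi A i.
  move=> ii; rewrite /mixed ltnS leq_eqVlt (_ : (nat_of_ord i == m) = false)//.
  by apply: contraNF ii => /eqP im; apply/eqP/val_inj.
pose H w : R := (\prod_(i | i != i0) mixed m phi A i (V i w))%R.
pose c : R := (\prod_(i | i != i0) \int[mu i]_x mixed m phi A i x)%R.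
transitivity (\int[Pr]_w (H w * phi i0 (V i0 w))%:E).
  apply: eq_integral => w _; rewrite (bigD1 i0)//= mulrC {2}/mixed /= ltnS leqnn.
  congr (_ * _)%:E; apply: eq_bigr => i ii; by rewrite mixE.
rewrite (@integral_mul_comp (mu i0) (V i0) H c (phi i0))//.
- rewrite [in RHS](bigD1 i0)//= EFinM [RHS]muleC.
  rewrite (eq_bigr (fun i => \int[mu i]_x mixed m phi A i x)%R); last first.
    by move=> i ii; rewrite mixE.
  congr (_ * _); rewrite /mixed /= ltnS leqnn /Rintegral fineK//.
  exact: integrable_fin_num (iphi i0).
- exact: hV.1.
- by apply: measurable_prod_comp => i; exact: measurable_mixed.
- by move=> w; apply: prodr_ge0 => i _; exact: mixed_ge0.
(* The image condition required by [integral_mul_comp] is the induction hypothesis with [B] in place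
   of the set at [i0]. *)
move=> B mB; pose A' i := if i == i0 then B else A i.
have mA' i : measurable (A' i) by rewrite /A'; case: ifP.
have AE i : i != i0 -> mixed m phi A' i = mixed m phi A i.
  by move=> /negPf ii; rewrite /mixed /A' ii.
have A0 : mixed m phi A' i0 = \1_B by rewrite /mixed /= ltnn /A' eqxx.
transitivity (\int[Pr]_w (\prod_i mixed m phi A' i (V i w))%:E).
  apply: eq_integral => w _; rewrite [in RHS](bigD1 i0)//= A0 mulrC; congr (_ * _)%:E.
  by apply: eq_bigr => i ii; rewrite AE.
rewrite IH// (bigD1 i0)//= A0 EFinM muleC; congr (_ * _).
  by rewrite /c; congr EFin; apply: eq_bigr => i ii; rewrite AE.
by rewrite /Rintegral integral_indic// setIT fineK// fin_num_measure.
Qed.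

Let prod_ge0_integral (phi : 'I_n -> S -> R) :
  (forall i, (mu i).-integrable setT (EFin \o phi i)) -> (forall i x, 0 <= phi i x)%R ->
  \int[Pr]_w (\prod_i phi i (V i w))%:E = (\prod_i \int[mu i]_x phi i x)%R%:E.
Proof.
move=> iphi phi0; have := integral_mixed n iphi phi0 (A := fun=> setT) (fun=> measurableT).
have E i : mixed n phi (fun=> setT) i = phi i by rewrite /mixed ltn_ord.
under eq_integral => w _ do under eq_bigr do rewrite E.
by move=> ->; congr EFin; apply: eq_bigr => i _; rewrite E.
Qed.

Lemma integrable_prod_indep (phi : 'I_n -> S -> R) :
  (forall i, (mu i).-integrable setT (EFin \o phi i)) ->
  Pr.-integrable setT (EFin \o (fun w => \prod_i phi i (V i w))%R).
Proof.
move=> iphi; apply/integrableP; split.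
  apply/measurable_EFinP; apply: measurable_prod_comp => i.
  by apply/measurable_EFinP; exact: measurable_int (iphi i).
rewrite (_ : (fun _ => _) = (fun w => (\prod_i `|phi i (V i w)|)%:E)); last first.
  by apply/funext => w /=; rewrite normr_prod.
rewrite (prod_ge0_integral (phi := fun i x => `|phi i x|%R))//; first by rewrite ltry.
by move=> i; exact: integrable_norm (iphi i).
Qed.

(** Signs are removed one factor at a time: both sides are linear in the factor [i0], which is split
    into its positive and negative parts. *)
Lemma Rintegral_prod_indep (phi : 'I_n -> S -> R) :
  (forall i, (mu i).-integrable setT (EFin \o phi i)) ->
  (\int[Pr]_w \prod_i phi i (V i w) = \prod_i \int[mu i]_x phi i x)%R.
Proof.
suff H m : forall phi : 'I_n -> S -> R,
    (forall i, (mu i).-integrable setT (EFin \o phi i)) ->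
    (forall i : 'I_n, (m <= i)%N -> forall x, 0 <= phi i x)%R ->
    (\int[Pr]_w \prod_i phi i (V i w) = \prod_i \int[mu i]_x phi i x)%R.
  by move=> iphi; apply: (H n) => // i; rewrite leqNgt ltn_ord.
elim: m => [|m IH] {}phi iphi phi0.
  rewrite {1}/Rintegral prod_ge0_integral// => i x; exact: phi0.
have [mn|nm] := ltnP m n; last first.
  by apply: IH => // i; rewrite leqNgt (leq_trans (ltn_ord i)).
pose i0 := Ordinal mn.
pose psi f i := if i == i0 then f else phi i.
have psi0 f : psi f i0 = f by rewrite /psi eqxx.
have psiN f i : i != i0 -> psi f i = phi i by rewrite /psi => /negPf ->.
have ipsi f : (mu i0).-integrable setT (EFin \o f) -> forall i, (mu i).-integrable setT (EFin \o psi f i).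
  by move=> intf i; have [->|ii] := eqVneq i i0; [rewrite psi0|rewrite psiN].
have psi_ge0 f : (forall x, 0 <= f x)%R -> forall i : 'I_n, (m <= i)%N -> forall x, (0 <= psi f i x)%R.
  move=> f0 i; rewrite leq_eqVlt => /orP[/eqP im|mi] x.
    have -> : i = i0 by apply/val_inj.
    by rewrite psi0.
  rewrite psiN; first exact: phi0.
  by apply: contraTneq mi => ->; rewrite ltnn.
pose fp := ((phi i0)^\+)%R; pose fn := ((phi i0)^\-)%R.
have ip : (mu i0).-integrable setT (EFin \o fp) by apply: integrable_funrpos => //; exact: iphi.
have im : (mu i0).-integrable setT (EFin \o fn) by apply: integrable_funrneg => //; exact: iphi.
have fE x : (phi i0 x = fp x - fn x)%R by rewrite -[in LHS](funrposBneg (phi i0)).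
have splitE f (G : 'I_n -> (S -> R) -> R) : (\prod_i G i (psi f i) =
   G i0 f * \prod_(i | i != i0) G i (phi i))%R.
  rewrite (bigD1 i0)//= psi0; congr (_ * _)%R.
  by apply: eq_bigr => i ii; rewrite psiN.
transitivity (\int[Pr]_w (\prod_i psi fp i (V i w)) - \int[Pr]_w (\prod_i psi fn i (V i w)))%R.
  rewrite -RintegralB//; last 2 first.
  - exact: (integrable_prod_indep (ipsi _ ip)).
  - exact: (integrable_prod_indep (ipsi _ im)).
  apply: eq_Rintegral => w _.
  rewrite (splitE fp (fun i f => f (V i w))) (splitE fn (fun i f => f (V i w))).
  by rewrite -mulrBl -fE [in LHS](bigD1 i0).
rewrite (IH _ (ipsi _ ip)); last by apply: psi_ge0 => x; exact: funrpos_ge0.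
rewrite (IH _ (ipsi _ im)); last by apply: psi_ge0 => x; exact: funrneg_ge0.
rewrite (splitE fp (fun i f => \int[mu i]_x f x)%R) (splitE fn (fun i f => \int[mu i]_x f x)%R).
rewrite -mulrBl -RintegralB// [in RHS](bigD1 i0)//=; congr (_ * _)%R.
by apply: eq_Rintegral => x _; rewrite fE.
Qed.

End independent_products.

Section joint_independence.
Context d d' (Om : measurableType d) (T : measurableType d') (R : realType).
Variable Pr : probability Om R.
Variables (P Q : probability T R) (X Y : nat -> {RV Pr >-> T}).
Hypotheses (hX : iid X P) (hY : iid Y Q) (hXY : independent_sequences X Y).
Local Open Scope ereal_scope.

Let iid_cap (X' : nat -> {RV Pr >-> T}) (P' : probability T R) N (A : 'I_N -> set T) :
  iid X' P' -> (forall i, measurable (A i)) ->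
  Pr (\bigcap_(i in [set: 'I_N]) (X' i @^-1` A i)) = \prod_i P' (A i).
Proof.
move=> [indep law] mA.
pose B k := if insub k is Some i then A i else setT.
have mB k : measurable (B k) by rewrite /B; case: insubP.
have BE (i : 'I_N) : B i = A i by rewrite /B valK.
have := indep [fset k in iota 0 N]%fset B mB.
rewrite (_ : \bigcap_(i in _) _ = \bigcap_(i in [set: 'I_N]) (X' i @^-1` A i)); last first.
  apply/seteqP; split => [w h i _|w h k].
    by have := h i; rewrite BE; apply; rewrite /= inE mem_iota/=.
  rewrite /= inE mem_iota/= add0n => kN.
  by have := h (Ordinal kN) I; rewrite -BE.
move=> ->; rewrite (perm_big (iota 0 N)); last first.
  apply: uniq_perm; [exact: fset_uniq|exact: iota_uniq|].
  by move=> k; rewrite inE.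
rewrite -[N in iota 0 N]subn0 -/(index_iota 0 N) big_mkord; apply: eq_bigr => i _.
by rewrite BE; exact: law.
Qed.

Lemma iid_indep_with (X' : nat -> {RV Pr >-> T}) (P' : probability T R) N :
  iid X' P' -> indep_with Pr (fun i : 'I_N => X' i : Om -> T) (fun=> P').
Proof. by move=> h; split=> // A mA; exact: iid_cap. Qed.

Let sigma_cap (X' : nat -> {RV Pr >-> T}) N (A : 'I_N -> set T) :
  (forall i, measurable (A i)) ->
  sigma_of X' (\bigcap_(i in [set: 'I_N]) (X' i @^-1` A i)).
Proof.
move=> mA; pose G := \bigcup_i g_sigma_algebra_preimage (X' i).
pose GT : measurableType _ := g_sigma_algebraType G.
apply: (@fin_bigcap_measurable _ GT); first exact: finite_finset.
move=> i _; apply: sub_sigma_algebra; exists (nat_of_ord i) => //.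
by exists (A i) => //; rewrite setTI.
Qed.

Lemma indep_rows_columns N (A B : 'I_N -> set T) :
  (forall i, measurable (A i)) -> (forall i, measurable (B i)) ->
  Pr (\bigcap_(i in [set: 'I_N]) (X i @^-1` A i) `&`
      \bigcap_(i in [set: 'I_N]) (Y i @^-1` B i)) =
  (\prod_i P (A i)) * (\prod_i Q (B i)).
Proof.
move=> mA mB; rewrite hXY; [|exact: sigma_cap|exact: sigma_cap].
by rewrite (iid_cap hX)// (iid_cap hY).
Qed.

(** The first N terms of both sequences as one independent family of length N + N, so that
    everything proved for [indep_with] applies to functions of X and Y together. *)
Definition rows_columns N (i : 'I_(N + N)) : Om -> T :=
  match fintype.split i with inl k => X k | inr k => Y k end.
Definition rows_columns_law N (i : 'I_(N + N)) : probability T R :=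
  match fintype.split i with inl k => P | inr k => Q end.

Lemma indep_with_rows_columns N :
  indep_with Pr (@rows_columns N) (@rows_columns_law N).
Proof.
split=> [i|A mA]; first by rewrite /rows_columns; case: fintype.split.
rewrite big_split_ord/=.
have El (k : 'I_N) : fintype.split (lshift N k) = inl k by exact: (unsplitK (inl k)).
have Er (k : 'I_N) : fintype.split (rshift N k) = inr k by exact: (unsplitK (inr k)).
rewrite (eq_bigr (fun k => P (A (lshift N k)))); last first.
  by move=> k _; rewrite /rows_columns_law El.
rewrite [X in _ * X](eq_bigr (fun k => Q (A (rshift N k)))); last first.
  by move=> k _; rewrite /rows_columns_law Er.
rewrite -indep_rows_columns//; congr (Pr _); apply/seteqP; split => w.
  move=> h; split=> k _.
    by have := h (lshift N k) Logic.I; rewrite /preimage/= /rows_columns El.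
  by have := h (rshift N k) Logic.I; rewrite /preimage/= /rows_columns Er.
move=> [h1 h2] i _; rewrite /preimage/= /rows_columns.
by case: (split_ordP i) => k ->; [exact: h1|exact: h2].
Qed.

Lemma Rintegral_rows_columns N (phi psi : 'I_N -> T -> R) :
  (forall i, P.-integrable setT (EFin \o phi i)) ->
  (forall i, Q.-integrable setT (EFin \o psi i)) ->
  Pr.-integrable setT (EFin \o (fun w => (\prod_i phi i (X i w)) * (\prod_j psi j (Y j w)))%R) /\
  (\int[Pr]_w ((\prod_i phi i (X i w)) * (\prod_j psi j (Y j w))) =
   (\prod_i \int[P]_x phi i x) * (\prod_j \int[Q]_y psi j y))%R.
Proof.
move=> iphi ipsi.
pose F (i : 'I_(N + N)) : T -> R := match fintype.split i with inl k => phi k | inr k => psi k end.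
have iF i : (rows_columns_law i).-integrable setT (EFin \o F i).
  by rewrite /rows_columns_law /F; case: fintype.split.
have El (k : 'I_N) : fintype.split (lshift N k) = inl k by exact: (unsplitK (inl k)).
have Er (k : 'I_N) : fintype.split (rshift N k) = inr k by exact: (unsplitK (inr k)).
have E w : (\prod_i F i (rows_columns i w) =
   (\prod_i phi i (X i w)) * (\prod_j psi j (Y j w)))%R.
  rewrite big_split_ord/=; congr (_ * _)%R; apply: eq_bigr => k _.
    by rewrite /F /rows_columns El.
  by rewrite /F /rows_columns Er.
split.
  rewrite (_ : (fun w => _) = (fun w => \prod_i F i (rows_columns i w))%R); last first.
    by apply/funext => w; rewrite E.
  exact: (integrable_prod_indep (@indep_with_rows_columns N)).
under eq_Rintegral do rewrite -E.
rewrite (Rintegral_prod_indep (@indep_with_rows_columns N))// big_split_ord/=.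
congr (_ * _)%R; apply: eq_bigr => k _.
  by rewrite /F /rows_columns_law El.
by rewrite /F /rows_columns_law Er.
Qed.

Definition matched_pair N (sig : 'S_N) (i : 'I_N) (w : Om) : T * T := (X i w, Y (sig i) w).

(** On rectangles the event separates into rows and columns, the latter reindexed by [sig]. General
    sets are reached one position at a time by uniqueness of measures on the pi-system of
    rectangles; in the induction, positions from [m] on still carry rectangles. *)
Lemma indep_with_matched_pair N (sig : 'S_N) :
  indep_with Pr (matched_pair sig) (fun=> (P \x Q)%E).
Proof.
have mZ i : measurable_fun setT (matched_pair sig i) by exact: measurable_fun_pair.
split=> //.
suff H m (C : 'I_N -> set (T * T)) : (forall i, measurable (C i)) ->
   (forall i : 'I_N, (m <= i)%N -> exists A B, [/\ measurable A, measurable B & C i = A `*` B]) ->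
   Pr (\bigcap_(i in setT) (matched_pair sig i @^-1` C i)) = \prod_i (P \x Q)%E (C i).
  by move=> C mC; apply: (H N) => // i; rewrite leqNgt ltn_ord.
elim: m C => [|m IH] C mC hC.
  have /choice[A hA] : forall i, exists A, exists B, [/\ measurable A, measurable B & C i = A `*` B].
    by move=> i; exact: hC.
  have /choice[B hB] := hA.
  have mA i : measurable (A i) by case: (hB i).
  have mB i : measurable (B i) by case: (hB i).
  have CE i : C i = A i `*` B i by case: (hB i).
  rewrite (eq_bigr (fun i => P (A i) * Q (B i))); last first.
    by move=> i _; rewrite CE product_measure1E.
  rewrite big_split/= [X in _ * X](reindex_inj (@perm_inj _ (sig^-1)%g))/=.
  rewrite -indep_rows_columns//; congr (Pr _); apply/seteqP; split => w.
    move=> h; split => i _.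
      by have := h i Logic.I; rewrite /preimage/= CE => -[].
    by have := h ((sig^-1)%g i) Logic.I; rewrite /preimage/= CE => -[_]; rewrite /= permKV.
  move=> [h1 h2] i _; rewrite /preimage/= CE; split; first exact: h1.
  by have := h2 (sig i) Logic.I; rewrite permK.
have [mN|Nm] := ltnP m N; last first.
  by apply: IH => // i; rewrite leqNgt (leq_trans (ltn_ord i)).
pose i0 := Ordinal mN.
pose E := \bigcap_(i in [set i | i != i0]) (matched_pair sig i @^-1` C i).
have mE : measurable E.
  apply: fin_bigcap_measurable => [|i _]; first exact: finite_finset.
  by rewrite -[X in measurable X]setTI; exact: mZ.
pose c := (\prod_(i | i != i0) fine ((P \x Q)%E (C i)))%R.
have c0 : (0 <= c)%R by apply: prodr_ge0 => i _; rewrite fine_ge0.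
pose Z0 := matched_pair sig i0.
(* The law of the pair at [i0] under Pr restricted to the event [E] of the other positions; it has
   to be a multiple of P x Q. *)
pose push : {measure set (T * T)%type -> \bar R} := pushforward (mrestr Pr mE) Z0.
pose m1 := push (mZ i0).
pose m2 : {measure set (T * T)%type -> \bar R} := mscale (NngNum c0) (P \x Q)%E.
have swap D : measurable D -> \bigcap_(i in setT) (matched_pair sig i @^-1` (if i == i0 then D else C i)) =
    Z0 @^-1` D `&` E.
  move=> mD; apply/seteqP; split => w.
    move=> h; split; first by have := h i0 Logic.I; rewrite eqxx.
    by move=> i /= ii; have := h i Logic.I; rewrite (negPf ii).
  move=> [h1 h2] i _; case: eqVneq => [->|ii]; first exact: h1.
  exact: h2.
have cE : c%:E = \prod_(i | i != i0) (P \x Q)%E (C i).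
  rewrite /c -prodEFin; apply: eq_bigr => i _; rewrite fineK//.
  exact: (@fin_num_measure _ _ _ ((P \x Q)%E : probability _ _) _ (mC i)).
have m12 D : measurable D -> m1 D = m2 D.
  apply: (measure_unique [set A `*` B | A in measurable & B in measurable] (fun=> setT)).
  - by rewrite measurable_prod_measurableType.
  - move=> _ _ [A1 mA1 [B1 mB1 <-]] [A2 mA2 [B2 mB2 <-]].
    exists (A1 `&` A2); first exact: measurableI.
    by exists (B1 `&` B2); [exact: measurableI|rewrite setXI].
  - by move=> _; exists setT => //; exists setT => //; rewrite setXTT.
  - by rewrite bigcup_const.
  - move=> _ [A mA [B mB <-]]; have mAB : measurable (A `*` B) by exact: measurableX.
    transitivity (Pr (Z0 @^-1` (A `*` B) `&` E)); first by [].
    rewrite -swap// IH; last 2 first.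
    + by move=> i; case: ifP.
    + move=> i mi; case: eqVneq => [_|ii]; first by exists A, B.
      apply: hC; rewrite ltn_neqAle mi andbT; apply: contraNN ii => /eqP h.
      by apply/eqP/val_inj.
    rewrite (bigD1 i0)//= eqxx (_ : m2 _ = c%:E * (P \x Q)%E (A `*` B))// cE muleC; congr (_ * _).
    by apply: eq_bigr => i /negPf ->.
  - move=> _; apply: (le_lt_trans (y := 1)); last exact: ltry.
    by rewrite /m1/= /pushforward/= /mrestr preimage_setT setTI; exact: probability_le1.
transitivity (Pr (Z0 @^-1` C i0 `&` E)).
  rewrite -swap//; congr (Pr _); apply: eq_bigcapr => i _.
  by case: eqVneq => [->|].
transitivity (m1 (C i0)); first by [].
by rewrite m12// (_ : m2 _ = c%:E * (P \x Q)%E (C i0))// cE muleC [RHS](bigD1 i0).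
Qed.

End joint_independence.

(** * Integrability, Markov's inequality and orthonormal sums *)

Section moments.
Context d (Om : measurableType d) (R : realType) (Pr : probability Om R).

Definition fin_int d' (S : measurableType d') (mu : {measure set S -> \bar R}) (f : S -> R) :=
  mu.-integrable setT (EFin \o f).

Lemma fin_int_measurable d' (S : measurableType d') (mu : {measure set S -> \bar R}) f :
  fin_int mu f -> measurable_fun setT f.
Proof. by move=> h; apply/measurable_EFinP; exact: measurable_int h. Qed.

Lemma fin_int_sum d' (S : measurableType d') (mu : {measure set S -> \bar R})
    (J : Type) (r : seq J) (P : pred J) (F : J -> S -> R) : (forall j, fin_int mu (F j)) ->
  fin_int mu (fun x => \sum_(j <- r | P j) F j x).
Proof.
move=> iF; rewrite /fin_int (_ : _ \o _ = (fun x => \sum_(j <- r | P j) (F j x)%:E)%E).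
  by apply: integrable_sum => // j _; exact: iF.
by apply/funext => x /=; rewrite sumEFin.
Qed.

Lemma fin_intZ d' (S : measurableType d') (mu : {measure set S -> \bar R}) f (k : R) :
  fin_int mu f -> fin_int mu (fun x => k * f x).
Proof.
move=> h; rewrite /fin_int (_ : _ \o _ = (fun x => k%:E * (EFin \o f) x)%E)//.
exact: integrableZl.
Qed.

Lemma fin_intD d' (S : measurableType d') (mu : {measure set S -> \bar R}) f g :
  fin_int mu f -> fin_int mu g -> fin_int mu (fun x => f x + g x).
Proof.
move=> hf hg; rewrite /fin_int (_ : _ \o _ = ((EFin \o f) \+ (EFin \o g))%E)//.
exact: integrableD.
Qed.

Lemma fin_int_cst d' (S : measurableType d') (mu : probability S R) (c : R) :
  fin_int mu (fun=> c).
Proof. exact: finite_measure_integrable_cst. Qed.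

Lemma Rintegral_sum d' (S : measurableType d') (mu : {measure set S -> \bar R})
    (J : Type) (r : seq J) (P : pred J) (F : J -> S -> R) : (forall j, fin_int mu (F j)) ->
  \int[mu]_x (\sum_(j <- r | P j) F j x) = \sum_(j <- r | P j) \int[mu]_x F j x.
Proof.
move=> iF; elim: r => [|j r IH].
  under eq_Rintegral do rewrite big_nil.
  by rewrite big_nil Rintegral_cst// mul0r.
under eq_Rintegral do rewrite big_cons.
rewrite big_cons; case: ifP => // _; rewrite -IH -RintegralD//; first exact: iF.
exact: fin_int_sum.
Qed.

(** Bounds by a measurable cover, so that intermediate events need not be shown measurable. *)
Definition prob_le (E : set Om) (e : R) :=
  exists2 A, measurable A & E `<=` A /\ (Pr A <= e%:E)%E.

Lemma prob_leW E F e f : prob_le E e -> F `<=` E -> e <= f -> prob_le F f.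
Proof.
move=> [A mA [EA Ae]] FE ef; exists A => //; split; first exact: subset_trans FE EA.
by apply: le_trans Ae _; rewrite lee_fin.
Qed.

Lemma prob_leU E F e f : prob_le E e -> prob_le F f -> prob_le (E `|` F) (e + f).
Proof.
move=> [A mA [EA Ae]] [B mB [FB Bf]]; exists (A `|` B); first exact: measurableU.
split; first exact: setUSS.
by apply: le_trans (measureU2 _ mA mB) _; rewrite EFinD leeD.
Qed.

Lemma prob_le_bigcup (J : finType) (E : J -> set Om) (e : J -> R) :
  (forall j, prob_le (E j) (e j)) -> prob_le [set w | exists j, E j w] (\sum_j e j).
Proof.
move=> hE; suff H (r : seq J) : prob_le [set w | exists2 j, j \in r & E j w] (\sum_(j <- r) e j).
  apply: prob_leW (H (index_enum J)) _ _ => // w [j Ejw]; exists j => //.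
elim: r => [|j r IH].
  by rewrite big_nil; exists set0 => //; split; [move=> w []|rewrite measure0].
rewrite big_cons; apply: prob_leW (prob_leU (hE j) IH) _ _ => // w [k].
by rewrite inE => /predU1P[-> ?|kr ?]; [left|right; exists k].
Qed.

Lemma markov_ineq (g : Om -> R) (e : R) : 0 < e -> fin_int Pr g -> (forall w, 0 <= g w) ->
  prob_le [set w | e <= g w] (\int[Pr]_w g w / e).
Proof.
move=> e0 ig g0.
have mE : measurable [set w | e <= g w].
  rewrite (_ : [set w | _] = [set w | (e%:E <= (EFin \o g) w)%E])//.
  rewrite -[X in measurable X]setTI; apply: emeasurable_fun_c_infty => //.
  exact: measurable_int ig.
exists [set w | e <= g w] => //; split => //.
have := @le_integral_comp_abse _ _ _ Pr setT measurableT (EFin \o g) e id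
  (@measurable_id _ _ _) (fun _ h => h) (fun _ _ _ _ h => h).
move=> /(_ (measurable_int Pr ig) e0); rewrite setTI.
rewrite (_ : [set x | _] = [set w | e <= g w]); last first.
  by apply/seteqP; split => w /=; rewrite lee_fin ger0_norm.
rewrite (_ : (\int[_]_(_ in _) _)%E = (\int[Pr]_w g w)%:E); last first.
  rewrite /Rintegral fineK; last exact: integrable_fin_num.
  by apply: eq_integral => w _ /=; rewrite ger0_norm.
have pf : Pr [set w | (e <= g w)%R] \is a fin_num by exact: fin_num_measure.
by move=> h; rewrite -(fineK pf) lee_fin ler_pdivlMr// mulrC -lee_fin EFinM fineK.
Qed.

Section orthonormal.
Variables (J : finType) (Psi : J -> Om -> R).
Hypothesis hPsi : forall p q, fin_int Pr (fun w => Psi p w * Psi q w) /\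
  \int[Pr]_w (Psi p w * Psi q w) = (p == q)%:R.

Lemma orthonormal_sum_sqr (c : J -> R) :
  fin_int Pr (fun w => (\sum_p c p * Psi p w) ^+ 2) /\
  \int[Pr]_w ((\sum_p c p * Psi p w) ^+ 2) = \sum_p c p ^+ 2.
Proof.
have E w : (\sum_p c p * Psi p w) ^+ 2 = \sum_p \sum_q c p * c q * (Psi p w * Psi q w).
  rewrite expr2 mulr_suml; apply: eq_bigr => p _; rewrite mulr_sumr.
  by apply: eq_bigr => q _; ring.
have i1 p q : fin_int Pr (fun w => c p * c q * (Psi p w * Psi q w)).
  by have [h _] := hPsi p q; exact: fin_intZ.
have i2 p : fin_int Pr (fun w => \sum_q c p * c q * (Psi p w * Psi q w)).
  exact: fin_int_sum.
rewrite (_ : (fun w => _ ^+ 2) =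
    (fun w => \sum_p \sum_q c p * c q * (Psi p w * Psi q w))); last exact/funext.
split; first exact: fin_int_sum.
rewrite Rintegral_sum//; apply: eq_bigr => p _; rewrite Rintegral_sum//.
rewrite (bigD1 p)//= big1 ?addr0 => [|q qp].
  by have [h1 h2] := hPsi p p; rewrite RintegralZl// h2 eqxx mulr1 expr2.
have [h1 h2] := hPsi p q; rewrite RintegralZl// h2.
by rewrite eq_sym (negPf qp) mulr0.
Qed.

Lemma orthonormal_chebyshev (c : J -> R) (e : R) : 0 < e ->
  prob_le [set w | e <= `|\sum_p c p * Psi p w|] ((\sum_p c p ^+ 2) / e ^+ 2).
Proof.
move=> e0; have [h1 h2] := orthonormal_sum_sqr c.
have := markov_ineq (exprn_gt0 2 e0) h1 (fun w => sqr_ge0 _).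
rewrite h2 => h; apply: prob_leW h _ _ => // w /=.
by rewrite -[X in _ -> _ <= X](real_normK (num_real _)) ler_pXn2r// nnegrE ltW.
Qed.

End orthonormal.

End moments.

Section word_sums.
Context (R : realType) (I : finType).
Implicit Types (s : I -> R).

(** Each class with at least one word contributes its value of [h] once; the right side also has the
    counts of total above N, which no word realises. *)
Lemma sum_word_class N (h : {ffun I -> nat} -> R) : (forall kap, 0 <= h kap) ->
  \sum_(f : {ffun 'I_N -> option I}) h (cnt f) / card_class R N (cnt f) <=
  \sum_(kap : {ffun I -> 'I_N.+1}) h (ffval kap).
Proof.
move=> h0.
have cN (f : {ffun 'I_N -> option I}) k : (cnt f k <= N)%N.
  rewrite -{2}(sum_cnt f) (bigD1 k)//= -addnA leq_addr//.
have := sum_bounded_cnt N (fun f : {ffun 'I_N -> option I} => h (cnt f) / card_class R N (cnt f)).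
rewrite (eq_bigl xpredT) => [->|f]; last by apply/forallP.
apply: ler_sum => kap _.
rewrite (eq_bigr (fun=> h (ffval kap) / card_class R N (ffval kap) * 1)); last first.
  by move=> f /eqP ->; rewrite mulr1.
rewrite -mulr_sumr -/(card_class R N (ffval kap)).
have [->|c0] := eqVneq (card_class R N (ffval kap)) 0; first by rewrite mulr0.
by rewrite mulfVK.
Qed.

Lemma sum_powers N s : \sum_(kap : {ffun I -> 'I_N.+1}) \prod_k s k ^+ ffval kap k =
  \prod_k \sum_(j < N.+1) s k ^+ j.
Proof.
rewrite (bigA_distr_bigA (fun k (j : 'I_N.+1) => s k ^+ j)).
by apply: eq_bigr => kap _; apply: eq_bigr => k _; rewrite ffunE.
Qed.

Lemma geometric_sum_le N (x : R) : 0 <= x -> x < 1 -> \sum_(j < N) x ^+ j <= (1 - x)^-1.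
Proof.
move=> x0 x1; have p : 0 < 1 - x by rewrite subr_gt0.
rewrite -[leRHS]mul1r ler_pdivlMr//.
have := subrX1 x N; have : 0 <= x ^+ N by rewrite exprn_ge0.
set S := \sum_(j < N) _; lra.
Qed.

(* Words with some letter used more than M times: compare the weights s ^ 2 with the
   weights s ^ 2 / q, which are still summable. *)
Lemma sum_words_above N M s (q : R) : 0 < q -> q < 1 -> (forall k, 0 <= s k <= q) ->
  \sum_(kap : {ffun I -> 'I_N.+1})
    (if [forall k, ffval kap k <= M]%N then 0 else \prod_k s k ^+ ffval kap k) ^+ 2 <=
  q ^+ M.+1 * (1 - q)^-1 ^+ #|I|.
Proof.
move=> q0 q1 hs; pose r k := s k ^+ 2 / q.
have r0 k : 0 <= r k by rewrite divr_ge0 ?sqr_ge0// ltW.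
have rq k : r k <= q.
  have /andP[s0 sq] := hs k.
  by rewrite ler_pdivrMr// -expr2 ler_pXn2r// nnegrE// ltW.
apply: (@le_trans _ _ (\sum_(kap : {ffun I -> 'I_N.+1}) q ^+ M.+1 * \prod_k r k ^+ ffval kap k)).
  apply: ler_sum => kap _; case: ifPn => [_|].
    rewrite expr0n/=; apply: mulr_ge0; first by rewrite exprn_ge0// ltW.
    by apply: prodr_ge0 => k _; rewrite exprn_ge0.
  move=> /forallPn[k]; rewrite -ltnNge => Mk.
  have -> : (\prod_k s k ^+ ffval kap k) ^+ 2 =
      q ^+ (\sum_k ffval kap k) * \prod_k r k ^+ ffval kap k.
    rewrite -prodrXr -big_split/= -prodrXl; apply: eq_bigr => l _.
    rewrite -exprMn /r -exprM mulnC exprM; congr (_ ^+ _).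
    by rewrite mulrC mulfVK// gt_eqF.
  apply: ler_wpM2r; first by apply: prodr_ge0 => l _; rewrite exprn_ge0.
  apply: ler_wiXn2l => //; [exact: ltW|exact: ltW|].
  by apply: (leq_trans Mk); rewrite (bigD1 k)//= leq_addr.
rewrite -mulr_sumr; apply: ler_wpM2l; first by rewrite exprn_ge0// ltW.
rewrite sum_powers -prodr_const; apply: ler_prod => k _.
rewrite sumr_ge0 => [|j _]; last by rewrite exprn_ge0.
apply: (le_trans (geometric_sum_le _ (r0 k) (le_lt_trans (rq k) q1))).
by rewrite lef_pV2 ?posrE ?subr_gt0//; [rewrite lerD2l lerN2|exact: le_lt_trans q1].
Qed.

(** Since 0 <= b <= a gives (a - b)^2 <= a^2 - b^2, both sums factor into geometric series and the
    letters in [A] factor out. Then 1 / (1 - x) <= exp (x / (1 - q^2)) for 0 <= x <= q^2 turns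
    products into sums of s^2, with no dependence on the number of letters. *)
Lemma sum_words_zeroed N s s' (A : pred I) (q : R) : 0 <= q -> q < 1 ->
  (forall k, 0 <= s k <= q) -> (forall k, s' k = if A k then s k else 0) ->
  \sum_(kap : {ffun I -> 'I_N.+1})
    (\prod_k s k ^+ ffval kap k - \prod_k s' k ^+ ffval kap k) ^+ 2 <=
  expR ((\sum_(k | A k) s k ^+ 2) / (1 - q ^+ 2)) *
  (expR ((\sum_(k | ~~ A k) s k ^+ 2) / (1 - q ^+ 2)) - 1).
Proof.
move=> q0 q1 hs hs'.
have s0 k : 0 <= s k by case/andP: (hs k).
have s2q k : s k ^+ 2 <= q ^+ 2 by case/andP: (hs k) => *; rewrite ler_pXn2r// nnegrE.
have q2 : q ^+ 2 < 1 by rewrite expr_lt1.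
have p : 0 < 1 - q ^+ 2 by rewrite subr_gt0.
pose g k : R := \sum_(j < N.+1) (s k ^+ 2) ^+ j.
have g1 k : 1 <= g k.
  rewrite /g big_ord_recl expr0 lerDl sumr_ge0// => j _.
  by rewrite exprn_ge0// exprn_ge0.
have gexp k : g k <= expR (s k ^+ 2 / (1 - q ^+ 2)).
  apply: (le_trans (geometric_sum_le _ (sqr_ge0 _) (le_lt_trans (s2q k) q2))).
  have p' : 0 < 1 - s k ^+ 2 by rewrite subr_gt0; exact: le_lt_trans q2.
  apply: (@le_trans _ _ (1 + s k ^+ 2 / (1 - q ^+ 2))); last exact: expR_ge1Dx.
  have -> : (1 - s k ^+ 2)^-1 = 1 + s k ^+ 2 / (1 - s k ^+ 2) by field; rewrite gt_eqF.
  rewrite lerD2l ler_wpM2l ?sqr_ge0// lef_pV2 ?posrE//.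
  by rewrite lerD2l lerN2.
have prod_gexp (B : pred I) : \prod_(k | B k) g k <= expR ((\sum_(k | B k) s k ^+ 2) / (1 - q ^+ 2)).
  rewrite mulr_suml expR_sum; apply: ler_prod => k _.
  by rewrite gexp (le_trans ler01).
apply: (@le_trans _ _ (\sum_(kap : {ffun I -> 'I_N.+1})
    (\prod_k (s k ^+ 2) ^+ ffval kap k - \prod_k (s' k ^+ 2) ^+ ffval kap k))).
  apply: ler_sum => kap _.
  have sqE (u : I -> R) : \prod_k (u k ^+ 2) ^+ ffval kap k = (\prod_k u k ^+ ffval kap k) ^+ 2.
    by rewrite -prodrXl; apply: eq_bigr => k _; rewrite -!exprM mulnC.
  rewrite !sqE; set a := \prod_k s k ^+ _; set b := \prod_k s' k ^+ _.
  have b0 : 0 <= b.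
    by apply: prodr_ge0 => k _; rewrite exprn_ge0// hs'; case: ifP.
  have ba : b <= a.
    apply: ler_prod => k _; rewrite exprn_ge0 hs'; last by case: ifP.
    by case: ifP => // _; apply: lerXn2r; rewrite ?nnegrE.
  nra.
rewrite sumrB !sum_powers.
rewrite (bigID A)/= -/g [X in _ - X](bigID A)/=.
rewrite [X in _ - _ * X]big1 ?mulr1 => [|k /negPf Ak]; last first.
  rewrite hs' Ak expr0n/= big_ord_recl expr0 big1 ?addr0// => j _.
  by rewrite exprS mul0r.
rewrite (eq_bigr g) => [|k _]; last by [].
rewrite [X in _ - X](eq_bigr g) => [|k Ak]; last first.
  by apply: eq_bigr => j _; rewrite hs' Ak.
rewrite -[X in _ - X]mulr1 -mulrBr.
have P1 : 1 <= \prod_(k | ~~ A k) g k.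
  apply: (@le_trans _ _ (\prod_(k | ~~ A k) 1)); first by rewrite big1.
  by apply: ler_prod => k _; rewrite ler01/=.
apply: ler_pM.
- by apply: prodr_ge0 => k _; exact: le_trans (g1 k).
- by rewrite subr_ge0.
- exact: prod_gexp.
- by rewrite lerD2r; exact: (prod_gexp (fun k => ~~ A k)).
Qed.

End word_sums.

(** * Second moments of the averaged kernel *)

Section kernel_moments.
Context d d' (Om : measurableType d) (T : measurableType d') (R : realType).
Variable Pr : probability Om R.
Variables (P Q : probability T R) (X Y : nat -> {RV Pr >-> T}).

Definition kernel_avg (z : T * T -> R) N (w : Om) : R :=
  N`!%:R^-1 * \sum_(sig : 'S_N) \prod_(i < N) z (matched_pair X Y sig i w).

Context (I : finType).
Implicit Types (s : I -> R) (e : I -> T -> R).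

Definition with_one e (o : option I) : T -> R := oapp e (cst 1) o.

(** Taking [None] on one side also encodes that every [e k] has mean zero. *)
Definition orthonormal_with_one (mu : probability T R) e := forall o o',
  fin_int mu (fun x => with_one e o x * with_one e o' x) /\
  \int[mu]_x (with_one e o x * with_one e o' x) = (o == o')%:R.

Definition samples e (Z : nat -> {RV Pr >-> T}) N (w : Om) (i : 'I_N) (k : I) : R :=
  e k (Z i w).

Definition finite_kernel s (alpha beta : I -> T -> R) (z : T * T) : R :=
  1 + \sum_k s k * alpha k z.1 * beta k z.2.

Hypotheses (hX : iid X P) (hY : iid Y Q) (hXY : independent_sequences X Y).
Variables (alpha beta : I -> T -> R).
Hypotheses (ha : orthonormal_with_one P alpha) (hb : orthonormal_with_one Q beta).

Let A N w : 'I_N -> I -> R := @samples alpha X N w.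
Let B N w : 'I_N -> I -> R := @samples beta Y N w.

Lemma word_prod_samples e (Z : nat -> {RV Pr >-> T}) N w f :
  word_prod (@samples e Z N w) f = \prod_i with_one e (f i) (Z i w).
Proof. by apply: eq_bigr => i _; rewrite /with_one; case: (f i). Qed.

(** The integral factors over the 2 N independent samples, and at each of them
    [orthonormal_with_one] gives a Kronecker delta. *)
Lemma words_orthonormal N (p q : {ffun 'I_N -> option I} * {ffun 'I_N -> option I}) :
  let Psi p w := word_prod (A w) p.1 * word_prod (B w) p.2 in
  fin_int Pr (fun w => Psi p w * Psi q w) /\
  \int[Pr]_w (Psi p w * Psi q w) = (p == q)%:R.
Proof.
move=> Psi.
pose phi i x := with_one alpha (p.1 i) x * with_one alpha (q.1 i) x.
pose psi i x := with_one beta (p.2 i) x * with_one beta (q.2 i) x.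
have iphi i : fin_int P (phi i) by case: (ha (p.1 i) (q.1 i)).
have ipsi i : fin_int Q (psi i) by case: (hb (p.2 i) (q.2 i)).
have [h1 h2] := Rintegral_rows_columns hX hY hXY iphi ipsi.
rewrite (_ : (fun w => Psi p w * Psi q w) =
    (fun w => (\prod_i phi i (X i w)) * (\prod_j psi j (Y j w)))); last first.
  apply/funext => w; rewrite /Psi !word_prod_samples !big_split/=; ring.
split=> //; rewrite h2.
rewrite (eq_bigr (fun i => (p.1 i == q.1 i)%:R)) => [|i _]; last by case: (ha (p.1 i) (q.1 i)).
rewrite [X in _ * X](eq_bigr (fun i => (p.2 i == q.2 i)%:R)) => [|i _]; last by case: (hb (p.2 i) (q.2 i)).
have E (f g : {ffun 'I_N -> option I}) : \prod_i (f i == g i)%:R = (f == g)%:R :> R.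
  have [->|fg] := eqVneq f g; first by rewrite big1// => i _; rewrite eqxx.
  have /existsP[i /negPf fgi] : [exists i, f i != g i].
    apply: contraNT fg; rewrite negb_exists => /forallP h; apply/eqP/ffunP => i.
    by apply/eqP; move: (h i); rewrite negbK.
  by rewrite (bigD1 i)//= fgi mul0r.
by rewrite !E -natrM mulnb -xpair_eqE -!surjective_pairing.
Qed.

Definition word_kernel N (t : {ffun I -> nat} -> R) (w : Om) : R :=
  \sum_(f : {ffun 'I_N -> option I}) \sum_(g : {ffun 'I_N -> option I} | cnt g == cnt f)
    t (cnt f) / card_class R N (cnt f) * (word_prod (A w) f * word_prod (B w) g).

(** For a fixed word f there are [card_class] partners g, each with coefficient t / card_class, so
    the squares add up to t ^ 2 per class. *)
Lemma word_kernel_chebyshev N (t : {ffun I -> nat} -> R) (e : R) : 0 < e ->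
  prob_le Pr [set w | e <= `|word_kernel N t w|]
   ((\sum_(kap : {ffun I -> 'I_N.+1}) t (ffval kap) ^+ 2) / e ^+ 2).
Proof.
move=> e0.
pose c (p : {ffun 'I_N -> option I} * {ffun 'I_N -> option I}) : R :=
  if cnt p.2 == cnt p.1 then t (cnt p.1) / card_class R N (cnt p.1) else 0.
have := orthonormal_chebyshev (@words_orthonormal N) c e0.
rewrite (_ : [set w | _] = [set w | e <= `|word_kernel N t w|]); last first.
  apply/seteqP; split => w /=.
    rewrite (_ : \sum_p _ = word_kernel N t w)// /word_kernel pair_big_dep/=.
    rewrite [RHS]big_mkcond/=; apply: eq_bigr => p _; rewrite /c; case: ifP => //.
    by rewrite mul0r.
  rewrite (_ : word_kernel N t w = \sum_p c p * (word_prod (A w) p.1 * word_prod (B w) p.2))//.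
  rewrite /word_kernel pair_big_dep/= [LHS]big_mkcond/=; apply: eq_bigr => p _.
  by rewrite /c; case: ifP => //; rewrite mul0r.
move=> h; apply: prob_leW h _ _ => //; rewrite ler_wpM2r ?invr_ge0 ?exprn_ge0 ?(ltW e0)//.
apply: le_trans (sum_word_class N (h := fun kap => t kap ^+ 2) _) => [|kap]; last exact: sqr_ge0.
rewrite le_eqVlt; apply/orP; left; apply/eqP.
rewrite -(pair_bigA _ (fun f g => c (f, g) ^+ 2))/=; apply: eq_bigr => f _.
rewrite (bigID (fun g => cnt g == cnt f))/= [X in _ + X]big1 ?addr0 => [|g /negPf h]; last first.
  by rewrite /c/= h expr0n.
rewrite (eq_bigr (fun=> (t (cnt f) / card_class R N (cnt f)) ^+ 2 * 1)) => [|g h]; last first.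
  by rewrite /c/= h mulr1.
rewrite -mulr_sumr -/(card_class R N (cnt f)) expr_div_n.
by field; rewrite gt_eqF// card_class_gt0.
Qed.

Lemma kernel_avg_finite s N w :
  kernel_avg (finite_kernel s alpha beta) N w =
  word_kernel N (fun kap => \prod_k s k ^+ kap k) w.
Proof. by rewrite /kernel_avg /word_kernel -(@kernel_expand _ _ _ s (A w) (B w)). Qed.

Lemma word_kernelB N t t' w :
  word_kernel N t w - word_kernel N t' w = word_kernel N (fun kap => t kap - t' kap) w.
Proof.
rewrite -sumrB; apply: eq_bigr => f _; rewrite -sumrB; apply: eq_bigr => g _.
by rewrite -mulrBl -mulrBl.
Qed.

Lemma kernel_avg_trunc_chebyshev N M s (q e : R) : 0 < e -> 0 < q -> q < 1 ->
  (forall k, 0 <= s k <= q) ->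
  prob_le Pr [set w | e <= `|kernel_avg (finite_kernel s alpha beta) N w -
       trunc_kernel M s (A w) (B w : 'I_N -> I -> R)|]
   (q ^+ M.+1 * (1 - q)^-1 ^+ #|I| / e ^+ 2).
Proof.
move=> e0 q0 q1 hs.
pose t (kap : {ffun I -> nat}) : R := if [forall k, kap k <= M]%N then 0 else \prod_k s k ^+ kap k.
have := @word_kernel_chebyshev N t e e0.
rewrite (_ : [set w | _] = [set w | e <= `|kernel_avg (finite_kernel s alpha beta) N w -
       trunc_kernel M s (A w) (B w : 'I_N -> I -> R)|]); last first.
  apply/funext => w /=; congr (is_true (_ <= `|_|)).
  rewrite kernel_avg_finite /word_kernel (bigID (fun f => [forall k, cnt f k <= M]%N))/=.
  rewrite big1 ?add0r => [|f fM]; last first.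
    by rewrite big1// => g _; rewrite /t fM !mul0r.
  rewrite [X in _ = X - _](bigID (fun f => [forall k, cnt f k <= M]%N))/=.
  rewrite -/(trunc_kernel M s (A w) (B w)) addrAC subrr add0r.
  by apply: eq_bigr => f /negPf fM; apply: eq_bigr => g _; rewrite /t fM.
move=> h; apply: prob_leW h _ _ => //; rewrite ler_wpM2r ?invr_ge0 ?exprn_ge0 ?(ltW e0)//.
exact: sum_words_above.
Qed.

Lemma kernel_avg_zeroed_chebyshev N s s' (K : pred I) (q e : R) : 0 < e -> 0 <= q -> q < 1 ->
  (forall k, 0 <= s k <= q) -> (forall k, s' k = if K k then s k else 0) ->
  prob_le Pr [set w | e <= `|kernel_avg (finite_kernel s alpha beta) N w -
       kernel_avg (finite_kernel s' alpha beta) N w|]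
   (expR ((\sum_(k | K k) s k ^+ 2) / (1 - q ^+ 2)) *
    (expR ((\sum_(k | ~~ K k) s k ^+ 2) / (1 - q ^+ 2)) - 1) / e ^+ 2).
Proof.
move=> e0 q0 q1 hs hs'.
have := @word_kernel_chebyshev N (fun kap => \prod_k s k ^+ kap k - \prod_k s' k ^+ kap k) e e0.
rewrite (_ : [set w | _] = [set w | e <= `|kernel_avg (finite_kernel s alpha beta) N w -
       kernel_avg (finite_kernel s' alpha beta) N w|]); last first.
  by apply/funext => w /=; rewrite !kernel_avg_finite word_kernelB.
move=> h; apply: prob_leW h _ _ => //; rewrite ler_wpM2r ?invr_ge0 ?exprn_ge0 ?(ltW e0)//.
exact: sum_words_zeroed.
Qed.

Let single N (i : 'I_N) (k : I) := upd [ffun=> None] i (Some k).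

Let single_inj N (i j : 'I_N) k l : single i k = single j l -> i = j /\ k = l.
Proof.
move=> /ffunP/(_ i); rewrite !ffunE eqxx; case: eqVneq => // -> [->]; by split.
Qed.

Let word_prod_single (a : forall N, 'I_N -> I -> R) N (i : 'I_N) k :
  word_prod (a N) (single i k) = a N i k.
Proof.
rewrite word_prod_upd ?ffunE// /word_prod big1 ?mulr1// => j _; by rewrite ffunE.
Qed.

Definition clt_sum e (Z : nat -> {RV Pr >-> T}) N (w : Om) (k : I) : R :=
  (\sum_(i < N) samples e Z w i k) / Num.sqrt N%:R.

(** Each normalised sum is a combination of one-letter words with N coefficients equal to 1 / sqrt
    N. *)
Lemma clt_sum_sqr N k : (0 < N)%N ->
  [/\ fin_int Pr (fun w => clt_sum alpha X N w k ^+ 2),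
      \int[Pr]_w (clt_sum alpha X N w k ^+ 2) = 1,
      fin_int Pr (fun w => clt_sum beta Y N w k ^+ 2) &
      \int[Pr]_w (clt_sum beta Y N w k ^+ 2) = 1].
Proof.
move=> N0; have r0 : 0 < Num.sqrt N%:R :> R by rewrite sqrtr_gt0 ltr0n.
have sq : \sum_(i < N) ((Num.sqrt N%:R)^-1 : R) ^+ 2 = 1.
  rewrite sumr_const card_ord exprVn sqr_sqrtr ?ler0n//.
  by rewrite -[LHS]mulr_natl divff// pnatr_eq0 -lt0n.
have none1 a : word_prod a ([ffun=> None] : {ffun 'I_N -> option I}) = 1 :> R.
  by rewrite /word_prod big1// => j _; rewrite ffunE.
pose pa (i : 'I_N) := (single i k, [ffun=> None] : {ffun 'I_N -> option I}).
pose pb (i : 'I_N) := ([ffun=> None] : {ffun 'I_N -> option I}, single i k).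
have ea i j : (pa i == pa j) = (i == j).
  by apply/eqP/eqP => [[/single_inj[]]|->].
have eb i j : (pb i == pb j) = (i == j).
  by apply/eqP/eqP => [[/single_inj[]]|->].
pose Psi (p : {ffun 'I_N -> option I} * {ffun 'I_N -> option I}) w :=
   word_prod (A w) p.1 * word_prod (B w) p.2.
have [|a1 a2] := @orthonormal_sum_sqr _ Om R Pr _ (fun i => Psi (pa i)) _ (fun=> (Num.sqrt N%:R)^-1).
  by move=> i j; rewrite -ea; exact: words_orthonormal.
have [|b1 b2] := @orthonormal_sum_sqr _ Om R Pr _ (fun i => Psi (pb i)) _ (fun=> (Num.sqrt N%:R)^-1).
  by move=> i j; rewrite -eb; exact: words_orthonormal.
have eA w : (\sum_i (Num.sqrt N%:R)^-1 * Psi (pa i) w) ^+ 2 = clt_sum alpha X N w k ^+ 2.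
  congr (_ ^+ 2); rewrite /clt_sum [RHS]mulrC mulr_sumr.
  apply: eq_bigr => i _; rewrite /Psi /= none1 mulr1; congr (_ * _).
  exact: (word_prod_single (fun N => A w)).
have eB w : (\sum_i (Num.sqrt N%:R)^-1 * Psi (pb i) w) ^+ 2 = clt_sum beta Y N w k ^+ 2.
  congr (_ ^+ 2); rewrite /clt_sum [RHS]mulrC mulr_sumr.
  apply: eq_bigr => i _; rewrite /Psi /= none1 mul1r; congr (_ * _).
  exact: (word_prod_single (fun N => B w)).
rewrite sq in a2 b2.
by move: a1 a2 b1 b2; rewrite (funext eA) (funext eB).
Qed.

(** The products U_k V_k are orthonormal, being built from pairs of one-letter words with the same
    letter. This gives a bound in sum_k c_k^2; estimating term by term would involve sum_k |c_k|,
    which need not stay bounded as letters are added. *)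
Lemma clt_product_chebyshev N (c : I -> R) (e : R) : 0 < e -> (0 < N)%N ->
  prob_le Pr [set w | e <= `|\sum_k c k * (clt_sum alpha X N w k * clt_sum beta Y N w k)|]
   ((\sum_k c k ^+ 2) / e ^+ 2).
Proof.
move=> e0 N0; have NR : 0 < N%:R :> R by rewrite ltr0n.
pose p (x : I * 'I_N * 'I_N) := (single x.1.2 x.1.1, single x.2 x.1.1).
have ep x y : (p x == p y) = (x == y).
  apply/eqP/eqP => [|->//]; case: x => [[k i] j]; case: y => [[k' i'] j'] /=.
  by move=> [/single_inj[/= -> ->] /single_inj[/= -> _]].
pose Psi (p : {ffun 'I_N -> option I} * {ffun 'I_N -> option I}) w :=
   word_prod (A w) p.1 * word_prod (B w) p.2.
have := @orthonormal_chebyshev _ Om R Pr _ (fun x => Psi (p x)) _ (fun x => c x.1.1 / N%:R) e e0.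
rewrite (_ : [set w | _] = [set w | e <= `|\sum_k c k *
    (clt_sum alpha X N w k * clt_sum beta Y N w k)|]); last first.
  apply/funext => w /=; congr (is_true (_ <= `|_|)).
  rewrite -(pair_bigA _ (fun x j => c x.1 / N%:R * Psi (p (x, j)) w))/=.
  rewrite -(pair_bigA _ (fun k i => \sum_j c k / N%:R * Psi (p (k, i, j)) w))/=.
  apply: eq_bigr => k _; rewrite /clt_sum.
  have -> : c k * ((\sum_(i < N) samples alpha X w i k) / Num.sqrt N%:R *
     ((\sum_(i < N) samples beta Y w i k) / Num.sqrt N%:R)) =
    c k / N%:R * ((\sum_(i < N) samples alpha X w i k) * (\sum_(i < N) samples beta Y w i k)).
    rewrite -[in X in _ = c k / X * _](sqr_sqrtr (ltW NR)); field.
    by rewrite gt_eqF// sqrtr_gt0.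
  rewrite mulr_suml mulr_sumr; apply: eq_bigr => i _; rewrite -mulr_sumr; congr (_ * _).
  rewrite mulr_sumr; apply: eq_bigr => j _; rewrite /Psi /=; congr (_ * _).
    exact: (word_prod_single (fun N => A w)).
  exact: (word_prod_single (fun N => B w)).
move=> h; apply: prob_leW (h _) _ _ => //.
  by move=> x y; rewrite -ep; exact: words_orthonormal.
rewrite ler_wpM2r ?invr_ge0 ?exprn_ge0 ?(ltW e0)//.
rewrite -(pair_bigA _ (fun x (j : 'I_N) => (c x.1 / N%:R) ^+ 2))/=.
rewrite -(pair_bigA _ (fun k (i : 'I_N) => \sum_(j < N) (c k / N%:R) ^+ 2))/=.
apply: ler_sum => k _; rewrite !sumr_const !card_ord -mulrnA -[leLHS]mulr_natl natrM.
rewrite expr_div_n le_eqVlt; apply/orP; left; apply/eqP; field.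
by rewrite gt_eqF.
Qed.

End kernel_moments.

(** * Limit theorems for the truncated kernel *)

Section integrals.
Context d (S : measurableType d) (R : realType).

Lemma fin_int_le (mu : {measure set S -> \bar R}) (f g : S -> R) :
  measurable_fun setT f -> fin_int mu g -> (forall x, `|f x| <= g x) -> fin_int mu f.
Proof.
move=> mf ig fg; apply: (le_integrable measurableT _ _ ig).
  exact/measurable_EFinP.
by move=> x _ /=; rewrite lee_fin (le_trans (fg x))// ler_norm.
Qed.

Lemma fin_int_norm (mu : {measure set S -> \bar R}) (f : S -> R) :
  fin_int mu f -> fin_int mu (fun x => `|f x|).
Proof. by move=> h; exact: (integrable_norm h). Qed.

Lemma fin_intB (mu : {measure set S -> \bar R}) (f g : S -> R) :
  fin_int mu f -> fin_int mu g -> fin_int mu (fun x => f x - g x).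
Proof.
move=> hf hg; rewrite (_ : (fun x => _) = (fun x => f x + -1 * g x)).
  by apply: fin_intD => //; exact: fin_intZ.
by apply/funext => x; rewrite mulN1r.
Qed.

Lemma dominated_Rintegral0 (mu : {measure set S -> \bar R}) (f_ : nat -> S -> R) (g : S -> R) :
  (forall n, measurable_fun setT (f_ n)) -> fin_int mu g -> (forall n x, `|f_ n x| <= g x) ->
  (forall x, f_ n x @[n --> \oo] --> (0:R)) -> \int[mu]_x (f_ n x) @[n --> \oo] --> (0:R).
Proof.
move=> mf ig fg f0.
have h1 : {ae mu, forall x, setT x -> (EFin \o f_ n) x @[n --> \oo] --> cst 0%E x}.
  by apply: aeW => x _; apply: cvg_EFin; [exact: nearW|exact: f0].
have h2 : {ae mu, forall x n, setT x -> (`|(EFin \o f_ n) x| <= (EFin \o g) x)%E}.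
  by apply: aeW => x n _; rewrite /= lee_fin.
have [|_ _] := @dominated_convergence _ S R mu setT measurableT (fun n => EFin \o f_ n)
  (cst 0%E) (EFin \o g) _ (measurable_cst _) h1 ig h2.
  by move=> n; exact/measurable_EFinP.
rewrite integral0 => /fine_cvg; exact.
Qed.

Lemma Rintegral_cst_prob (mu : probability S R) (c : R) : \int[mu]_x c = c.
Proof.
rewrite (Rintegral_cst mu measurableT c) [X in fine X](_ : _ = 1%E) ?mulr1//.
exact: probability_setT.
Qed.

Lemma tail_integral (mu : {measure set S -> \bar R}) (f : S -> R) (e : R) :
  fin_int mu f -> (forall x, 0 <= f x) -> 0 < e ->
  exists2 c0 : R, 0 <= c0 & forall c, c0 <= c ->
    fin_int mu (fun x => if c < f x then f x else 0) /\
    \int[mu]_x (if c < f x then f x else 0) <= e.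
Proof.
move=> fi f0 e0.
have mf : measurable_fun setT f by exact: fin_int_measurable fi.
pose g c x : R := if c < f x then f x else 0.
have mg c : measurable_fun setT (g c).
  by apply: measurable_fun_ifT => //; exact: measurable_fun_ltr.
have g0 c x : 0 <= g c x by rewrite /g; case: ifP.
have ig c : fin_int mu (g c).
  by apply: fin_int_le fi _ => // x; rewrite ger0_norm// /g; case: ifP.
have : \int[mu]_x (g n%:R x) @[n --> \oo] --> (0:R).
  apply: dominated_Rintegral0 fi _ _ => // [n x|x].
    by rewrite ger0_norm// /g; case: ifP.
  apply: cvg_near_cst; near=> n; rewrite /g ltNge ltW//.
  by near: n; exact: nbhs_infty_gtr.
move=> /cvgrPdist_le/(_ _ e0)[n _ /(_ n (leqnn n))].
rewrite sub0r normrN => h; exists n%:R => // c nc; split; first exact: ig.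
apply: le_trans (le_trans (ler_norm _) h); apply: le_Rintegral => //; [exact: ig|exact: ig|move=> x _].
rewrite /g; case: ifPn => // cf; first by rewrite (le_lt_trans nc cf).
by case: ifP.
Unshelve. all: by end_near. Qed.

End integrals.

(** * Weak laws for independent samples *)

Section independent_samples.
Context d d' (Om : measurableType d) (S : measurableType d') (R : realType).
Variables (Pr : probability Om R) (mu : probability S R).

Section fixed_size.
Variables (n : nat) (V : 'I_n -> Om -> S).
Hypothesis hV : indep_with Pr V (fun=> mu).

Lemma fin_int_sample (i : 'I_n) f : fin_int mu f ->
  fin_int Pr (fun w => f (V i w)) /\ \int[Pr]_w f (V i w) = \int[mu]_x f x.
Proof.
move=> fi; pose phi k : S -> R := if k == i then f else cst 1.
have iphi k : fin_int mu (phi k) by rewrite /phi; case: ifP => // _; exact: fin_int_cst.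
have E w : \prod_k phi k (V k w) = f (V i w).
  rewrite (bigD1 i)//= {1}/phi eqxx big1 ?mulr1// => k /negPf ki.
  by rewrite /phi ki.
rewrite -(funext E); split; first exact: (integrable_prod_indep hV iphi).
rewrite (Rintegral_prod_indep hV iphi) (bigD1 i)//= {1}/phi eqxx big1 ?mulr1// => k /negPf ki.
by rewrite /phi ki Rintegral_cst_prob.
Qed.

(** Under the product weight the samples are i.i.d. with density [xi] and [phi] is centred, so only
    the n diagonal terms of the square remain. *)
Lemma weighted_mean_sqr (xi phi : S -> R) : (0 < n)%N ->
  fin_int mu xi -> \int[mu]_x xi x = 1 ->
  fin_int mu (fun x => xi x * phi x) -> \int[mu]_x (xi x * phi x) = 0 ->
  fin_int mu (fun x => xi x * phi x ^+ 2) ->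
  fin_int Pr (fun w => \prod_i xi (V i w) * ((\sum_i phi (V i w)) / n%:R) ^+ 2) /\
  \int[Pr]_w (\prod_i xi (V i w) * ((\sum_i phi (V i w)) / n%:R) ^+ 2) =
  \int[mu]_x (xi x * phi x ^+ 2) / n%:R.
Proof.
move=> n0 i0 I0 i1 I1 i2.
(* Absorbs the weight and both factors [phi] into one product over k; for i = j the two conditions
   coincide and give phi ^ 2. *)
pose h (i j k : 'I_n) x : R := xi x * ((if k == i then phi x else 1) * (if k == j then phi x else 1)).
have ih i j k : fin_int mu (h i j k).
  rewrite /h; case: (k == i); case: (k == j).
  - by under eq_fun do rewrite -expr2.
  - by under eq_fun do rewrite mulr1.
  - by under eq_fun do rewrite mul1r.
  - by under eq_fun do rewrite !mulr1.
have E w : \prod_i xi (V i w) * ((\sum_i phi (V i w)) / n%:R) ^+ 2 =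
   \sum_i \sum_j n%:R ^- 2 * \prod_k h i j k (V k w).
  transitivity (\sum_i \sum_j n%:R ^- 2 * (\prod_k xi (V k w) * (phi (V i w) * phi (V j w)))).
    rewrite exprMn exprVn (expr2 (\sum_i phi (V i w))) !mulr_suml mulr_sumr.
    apply: eq_bigr => i _; rewrite mulr_sumr mulr_suml mulr_sumr; apply: eq_bigr => j _; ring.
  apply: eq_bigr => i _; apply: eq_bigr => j _; congr (_ * _).
  rewrite /h big_split/= big_split/=; congr (_ * (_ * _)).
    by rewrite -big_mkcond big_pred1_eq.
  by rewrite -big_mkcond big_pred1_eq.
rewrite (funext E).
have iP i j : fin_int Pr (fun w => n%:R ^- 2 * \prod_k h i j k (V k w)).
  by apply: fin_intZ; exact: (integrable_prod_indep hV (ih _ _)).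
split; first by apply: fin_int_sum => i; exact: fin_int_sum.
rewrite Rintegral_sum => [|i]; last exact: fin_int_sum.
rewrite (eq_bigr (fun=> n%:R ^- 2 * \int[mu]_x (xi x * phi x ^+ 2))) => [|i _].
  rewrite sumr_const card_ord -[LHS]mulr_natl; field.
  by rewrite pnatr_eq0 -lt0n.
rewrite Rintegral_sum// (bigD1 i)//= big1 ?addr0 => [|j ji].
  rewrite RintegralZl//; last by exact: (integrable_prod_indep hV (ih _ _)).
  rewrite (Rintegral_prod_indep hV (ih i i)) (bigD1 i)//= big1 ?mulr1 => [|k /negPf ki].
    by congr (_ * _); apply: eq_Rintegral => x _; rewrite /h eqxx expr2.
  by rewrite -I0; apply: eq_Rintegral => x _; rewrite /h ki !mulr1.
rewrite RintegralZl//; last by exact: (integrable_prod_indep hV (ih _ _)).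
rewrite (Rintegral_prod_indep hV (ih i j)) (bigD1 i)//= (_ : \int[mu]_x _ = 0) ?mul0r ?mulr0//.
by rewrite -I1; apply: eq_Rintegral => x _; rewrite /h eqxx eq_sym (negPf ji) mulr1.
Qed.

End fixed_size.

Definition iid_prefixes (Z : nat -> Om -> S) :=
  forall n, indep_with Pr (fun i : 'I_n => Z i) (fun=> mu).

Variables (Z : nat -> Om -> S).
Hypothesis hZ : iid_prefixes Z.

Lemma weak_law_bounded (f : S -> R) (c t e : R) : measurable_fun setT f ->
  (forall x, `|f x| <= c) -> 0 < t -> 0 < e ->
  exists N0, forall N, (N0 <= N)%N ->
    prob_le Pr [set w | t <= `|(\sum_(i < N) f (Z i w)) / N%:R - \int[mu]_x f x|] e.
Proof.
move=> mf fc t0 e0; pose m := \int[mu]_x f x; pose phi x := f x - m.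
have fi : fin_int mu f by apply: (fin_int_le mf (fin_int_cst mu c)).
have iphi : fin_int mu phi by apply: fin_intB => //; exact: fin_int_cst.
have phic x : `|phi x| <= c + `|m| by apply: le_trans (ler_normB _ _) _; rewrite lerD2r.
have iphi2 : fin_int mu (fun x => phi x ^+ 2).
  apply: (fin_int_le _ (fin_int_cst mu ((c + `|m|) ^+ 2))) => [|x].
    by apply: measurable_funX; exact: fin_int_measurable iphi.
  by rewrite normrX lerXn2r// nnegrE// (le_trans (normr_ge0 _) (phic x)).
pose v := \int[mu]_x (phi x ^+ 2).
have v0 : 0 <= v by apply: Rintegral_ge0 => x _; exact: sqr_ge0.
have [N0 hN0] : exists N0 : nat, v / t ^+ 2 / e < N0%:R.
  exists (Num.bound (v / t ^+ 2 / e)); apply: archi_boundP.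
  by rewrite !mulr_ge0 ?invr_ge0// ltW// exprn_gt0.
exists (maxn N0 1) => N; rewrite geq_max => /andP[NN N1].
have NR : 0 < N%:R :> R by rewrite ltr0n.
have Nn : N%:R != 0 :> R by rewrite gt_eqF.
have [|||||h1 h2] := @weighted_mean_sqr N _ (hZ N) (cst 1) phi N1.
- exact: fin_int_cst.
- by rewrite Rintegral_cst_prob.
- by under eq_fun do rewrite mul1r.
- under eq_Rintegral do rewrite mul1r.
  rewrite RintegralB//; last exact: fin_int_cst.
  by rewrite Rintegral_cst_prob subrr.
- by under eq_fun do rewrite mul1r.
have E w : \prod_i cst 1 (Z (i : 'I_N) w) * ((\sum_(i < N) phi (Z i w)) / N%:R) ^+ 2 =
   ((\sum_(i < N) f (Z i w)) / N%:R - m) ^+ 2.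
  rewrite big1// mul1r sumrB sumr_const card_ord; congr (_ ^+ 2).
  by rewrite -mulr_natr; field.
rewrite (funext E) in h1 h2.
have := markov_ineq (exprn_gt0 2 t0) h1 (fun w => sqr_ge0 _).
rewrite h2 => h; apply: prob_leW h _ _ => [w/= h|].
  by rewrite -[leRHS](real_normK (num_real _)) ler_pXn2r// nnegrE ltW.
under eq_Rintegral do rewrite mul1r.
rewrite -/v mulrAC ler_pdivrMr// [e * _]mulrC -ler_pdivrMr//.
by apply: ltW; apply: lt_le_trans hN0 _; rewrite ler_nat.
Qed.

(** Products of two L^2 functions, the entries of the Gram matrix, are only integrable, so no
    variance is available: the part of [f] bounded by [c] has one, and the rest is handled by
    Markov's inequality. *)
Lemma weak_law (f : S -> R) (t e : R) : fin_int mu f -> 0 < t -> 0 < e ->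
  exists N0, forall N, (N0 <= N)%N ->
    prob_le Pr [set w | t <= `|(\sum_(i < N) f (Z i w)) / N%:R - \int[mu]_x f x|] e.
Proof.
move=> fi t0 e0; have mf := fin_int_measurable fi.
(* The first bound limits the change of the mean to t / 4; the second makes Markov's inequality at
   level t / 4 cost at most e / 2. *)
pose a := Num.min (t / 4) (t * e / 8).
have a0 : 0 < a by rewrite lt_min !divr_gt0 ?mulr_gt0.
have [c c0 /(_ c (lexx _))[ih hc]] := tail_integral (fin_int_norm fi) (fun x => normr_ge0 _) a0.
pose g x : R := if c < `|f x| then 0 else f x.
pose h x : R := if c < `|f x| then `|f x| else 0.
have mg : measurable_fun setT g.
  apply: measurable_fun_ifT => //; apply: measurable_fun_ltr => //.
  exact: measurableT_comp.
have gc x : `|g x| <= c by rewrite /g; case: ifPn; rewrite ?normr0// -leNgt.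
have fg x : `|f x - g x| <= h x.
  by rewrite /g /h; case: ifP => _; rewrite ?subr0 ?subrr ?normr0.
have h0 x : 0 <= h x by rewrite /h; case: ifP.
have t4 : 0 < t / 4 by rewrite divr_gt0.
have e2 : 0 < e / 2 by rewrite divr_gt0.
have [N0 HN] := weak_law_bounded mg gc t4 e2.
exists (maxn N0 1) => N; rewrite geq_max => /andP[NN N1].
have NR : 0 < N%:R :> R by rewrite ltr0n.
have ig : fin_int mu g by apply: (fin_int_le mg (fin_int_cst mu c)).
have mfg : `|\int[mu]_x f x - \int[mu]_x g x| <= t / 4.
  rewrite -RintegralB//.
  apply: le_trans (le_normr_Rintegral measurableT (fin_intB fi ig)) _.
  apply: (@le_trans _ _ (\int[mu]_x h x)).
    by apply: le_Rintegral => //; apply: fin_int_norm; exact: fin_intB.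
  by apply: le_trans hc _; rewrite ge_min lexx.
have iH : fin_int Pr (fun w => N%:R^-1 * \sum_(i < N) h (Z i w)).
  by apply: fin_intZ; apply: fin_int_sum => i; case: (fin_int_sample (hZ N) i ih).
have H0 w : 0 <= N%:R^-1 * \sum_(i < N) h (Z i w).
  by rewrite mulr_ge0 ?invr_ge0 ?sumr_ge0.
have H1 := markov_ineq t4 iH H0.
apply: prob_leW (prob_leU (HN N NN) H1) _ _ => [w /= hw|].
  have [|hw1] := leP (t / 4) (`|(\sum_(i < N) g (Z i w)) / N%:R - \int[mu]_x g x|); first by left.
  right; rewrite leNgt; apply/negP => hw2.
  have hw3 : `|(\sum_(i < N) f (Z i w)) / N%:R - (\sum_(i < N) g (Z i w)) / N%:R| <=
      N%:R^-1 * \sum_(i < N) h (Z i w).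
    rewrite -mulrBl -sumrB normrM normfV (ger0_norm (ltW NR)) mulrC.
    rewrite ler_wpM2l ?invr_ge0 ?(ltW NR)//; apply: le_trans (ler_norm_sum _ _ _) _.
    by apply: ler_sum => i _.
  have hw4 : `|\int[mu]_x g x - \int[mu]_x f x| <= t / 4 by rewrite distrC.
  have := ler_normD ((\sum_(i < N) f (Z i w)) / N%:R - (\sum_(i < N) g (Z i w)) / N%:R)
     ((\sum_(i < N) g (Z i w)) / N%:R - \int[mu]_x f x).
  have := ler_normD ((\sum_(i < N) g (Z i w)) / N%:R - \int[mu]_x g x)
     (\int[mu]_x g x - \int[mu]_x f x).
  by rewrite !addrA !subrK; lra.
have -> : \int[Pr]_w (N%:R^-1 * \sum_(i < N) h (Z i w)) = \int[mu]_x h x.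
  rewrite RintegralZl//; last first.
    by apply: fin_int_sum => i; case: (fin_int_sample (hZ N) i ih).
  rewrite Rintegral_sum => [|i]; last by case: (fin_int_sample (hZ N) i ih).
  rewrite (eq_bigr (fun=> \int[mu]_x h x)) => [|i _].
    by rewrite sumr_const card_ord -(mulr_natl (\int[mu]_x h x)) mulKf// gt_eqF.
  by case: (fin_int_sample (hZ N) i ih).
have : \int[mu]_x h x <= t * e / 8 by apply: le_trans hc _; rewrite ge_min lexx orbT.
move=> h8.
suff : (\int[mu]_x h x) / (t / 4) <= e / 2 by lra.
by rewrite ler_pdivrMr//; lra.
Qed.

(** If one sample exceeds t sqrt N, then so does the sum of the truncated squares exceed t^2 N.
    Markov's inequality leaves the tail integral of f^2 beyond t^2 N, divided by t^2: the N samples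
    cancel against the N of the level. *)
Lemma max_samples (f : S -> R) (t e : R) : fin_int mu (fun x => f x ^+ 2) ->
  measurable_fun setT f -> 0 < t -> 0 < e ->
  exists N0, forall N, (N0 <= N)%N ->
    prob_le Pr [set w | exists i : 'I_N, t * Num.sqrt N%:R < `|f (Z i w)| ] e.
Proof.
move=> fi mf t0 e0; have a0 : 0 < t ^+ 2 * e by rewrite mulr_gt0 ?exprn_gt0.
have [c c0 hc] := tail_integral fi (fun x => sqr_ge0 _) a0.
exists (maxn (Num.bound (c / t ^+ 2)) 1) => N; rewrite geq_max => /andP[NN N1].
have NR : 0 < N%:R :> R by rewrite ltr0n.
have a1 : 0 < t ^+ 2 * N%:R by rewrite mulr_gt0 ?exprn_gt0.
have /hc[ih h1] : c <= t ^+ 2 * N%:R.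
  rewrite mulrC -ler_pdivrMr ?exprn_gt0// ltW//.
  apply: lt_le_trans (archi_boundP _) _; last by rewrite ler_nat.
  by rewrite mulr_ge0 ?invr_ge0// exprn_ge0// ltW.
pose h x : R := if t ^+ 2 * N%:R < f x ^+ 2 then f x ^+ 2 else 0.
have h0 x : 0 <= h x by rewrite /h; case: ifP => // _; exact: sqr_ge0.
have iH : fin_int Pr (fun w => \sum_(i < N) h (Z i w)).
  by apply: fin_int_sum => i; case: (fin_int_sample (hZ N) i ih).
have := markov_ineq a1 iH (fun w => sumr_ge0 _ (fun i _ => h0 _)).
move=> H; apply: prob_leW H _ _ => [w /= [i hi]|].
  have hi2 : t ^+ 2 * N%:R < f (Z i w) ^+ 2.
    rewrite -(real_normK (num_real (f (Z i w)))) -[X in _ * X](sqr_sqrtr (ltW NR)) -exprMn.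
    by rewrite ltr_pXn2r// nnegrE mulr_ge0 ?sqrtr_ge0// ltW.
  rewrite (bigD1 i)//= {1}/h hi2 -[leLHS]addr0 lerD ?(ltW hi2)//.
  by apply: sumr_ge0.
rewrite Rintegral_sum => [|i]; last by case: (fin_int_sample (hZ N) i ih).
rewrite (eq_bigr (fun=> \int[mu]_x h x)) => [|i _]; last first.
  by case: (fin_int_sample (hZ N) i ih).
rewrite sumr_const card_ord -[X in X / _]mulr_natr -mulf_div divff ?gt_eqF// mulr1.
by rewrite ler_pdivrMr ?exprn_gt0// mulrC.
Qed.

End independent_samples.

Section vanishing_events.
Context d (Om : measurableType d) (R : realType) (Pr : probability Om R).

Definition vanishing (E : nat -> set Om) := forall e : R, 0 < e ->
  exists N0, forall N, (N0 <= N)%N -> prob_le Pr (E N) e.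

Lemma vanishingU E F : vanishing E -> vanishing F -> vanishing (fun N => E N `|` F N).
Proof.
move=> hE hF e e0; have e2 : 0 < e / 2 by rewrite divr_gt0.
have [M hM] := hE _ e2; have [N hN] := hF _ e2; exists (maxn M N) => K.
rewrite geq_max => /andP[MK NK]; apply: prob_leW (prob_leU (hM K MK) (hN K NK)) _ _ => //.
by lra.
Qed.

Lemma vanishing_bigcup (J : finType) (E : nat -> J -> set Om) :
  (forall j, vanishing (E ^~ j)) -> vanishing (fun N => [set w | exists j, E N j w]).
Proof.
move=> hE e e0; pose f := e / (#|J|%:R + 1).
have n0 : 0 < #|J|%:R + 1 :> R by rewrite ltr_wpDl.
have f0 : 0 < f by rewrite divr_gt0.
have /choice[Nf hNf] : forall j, exists N0, forall N, (N0 <= N)%N -> prob_le Pr (E N j) f.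
  by move=> j; exact: hE.
exists (\max_j Nf j)%N => N NN.
have H j : prob_le Pr (E N j) f.
  by apply: hNf; apply: leq_trans NN; exact: leq_bigmax.
apply: prob_leW (prob_le_bigcup H) _ _ => //.
by rewrite sumr_const -mulr_natr /f mulrAC ler_pdivrMr// ler_pM2l// lerDl.
Qed.

End vanishing_events.

(** * Lower tail for finitely many letters *)

Section finite_kernel_tail.
Context d d' (Om : measurableType d) (T : measurableType d') (R : realType).
Variable Pr : probability Om R.
Variables (P Q : probability T R) (X Y : nat -> {RV Pr >-> T}).
Hypotheses (hX : iid X P) (hY : iid Y Q) (hXY : independent_sequences X Y).
Context (I : finType).

(** The exceptional events in the hypotheses of [trunc_kernel_lower], for one of the two samples. *)
Let Gram_max (mu : probability T R) (Z : nat -> {RV Pr >-> T}) (e : I -> T -> R) (eta : R) :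
  iid Z mu -> orthonormal_with_one mu e -> 0 < eta ->
  vanishing Pr (fun N => [set w | exists k, exists i : 'I_N,
     eta * Num.sqrt N%:R < `|samples e Z w i k| ] `|`
   [set w | exists kl : I * I, eta <=
     `|(\sum_(i < N) samples e Z w i kl.1 * samples e Z w i kl.2) / N%:R - (kl.1 == kl.2)%:R|]).
Proof.
move=> hZ he eta0.
have hZ' : iid_prefixes Pr mu (fun i => Z i : Om -> T) by move=> n; exact: iid_indep_with.
apply: vanishingU.
  apply: vanishing_bigcup => k t t0.
  have [i2 _] := he (Some k) (Some k); have [i1 _] := he (Some k) None.
  apply: (max_samples hZ' (f := e k)) => //.
  rewrite (_ : e k = (fun x => with_one e (Some k) x * with_one e None x)).
    exact: fin_int_measurable i1.
  by apply/funext => x; rewrite /= mulr1.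
apply: vanishing_bigcup => -[k l] t t0.
have [i2 I2] := he (Some k) (Some l).
have [N0 hN0] := weak_law hZ' i2 eta0 t0; exists N0 => N /hN0.
by rewrite I2.
Qed.

Variables (alpha beta : I -> T -> R).
Hypotheses (ha : orthonormal_with_one P alpha) (hb : orthonormal_with_one Q beta).

(** The exponent falls below - B0 only if its quadratic or its bilinear part exceeds B0 / 2. These
    have the two explicit bounds, which do not vanish with 1/N but see the letters only through
    sum_k s_k^2; [e] absorbs four other events, a quarter each. *)
Lemma finite_kernel_lower_tail (s : I -> R) (q B0 e : R) :
  0 < q -> q < 1 -> (forall k, 0 <= s k <= q) -> 0 < B0 -> 0 < e ->
  exists N0, forall N, (N0 <= N)%N ->
    prob_le Pr [set w | kernel_avg X Y (finite_kernel s alpha beta) N w < expR (- B0) / 2]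
      (2 * (\sum_k s k ^+ 2) / ((1 - q ^+ 2) * B0) +
       4 * (\sum_k s k ^+ 2) / ((1 - q ^+ 2) * B0) ^+ 2 + e).
Proof.
move=> q0 q1 hs B00 e0.
pose S := \sum_k s k ^+ 2.
(* Two losses of [e1], one in [trunc_kernel_lower] and one for dropping repeated letters, leave half
   of expR (- B0). *)
pose e1 := expR (- B0) / 4.
have e10 : 0 < e1 by rewrite divr_gt0// expR_gt0.
have e4 : 0 < e / 4 by rewrite divr_gt0.
have n0 : 0 < #|I|%:R + 1 :> R by rewrite ltr_wpDl.
(* Markov's inequality for all #|I| squares, each of mean 1, then costs #|I| / B ^ 2 <= e / 4. *)
pose B := Num.sqrt ((#|I|%:R + 1) * (4 / e)).
have B2 : B ^+ 2 = (#|I|%:R + 1) * (4 / e) by rewrite sqr_sqrtr// mulr_ge0 ?divr_ge0// ltW.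
have B2_gt0 : 0 < B ^+ 2 by rewrite B2 mulr_gt0// divr_gt0.
have Bge0 : 0 <= B by exact: sqrtr_ge0.
have q2 : 0 < 1 - q ^+ 2 by rewrite subr_gt0 expr_lt1// ltW.
have hs1 k : 0 <= s k < 1 by case/andP: (hs k) => -> h; exact: le_lt_trans h q1.
have ds k : 1 - q ^+ 2 <= 1 - s k ^+ 2.
  by case/andP: (hs k) => h1 h2; rewrite lerD2l lerN2 lerXn2r// nnegrE ltW.
have ds0 k : 0 < 1 - s k ^+ 2 by exact: lt_le_trans (ds k).
have [M0 hM0] := trunc_kernel_lower hs1 Bge0 e10.
have [M1 hM1] : exists M1 : nat, forall M, (M1 <= M)%N ->
    q ^+ M.+1 * (1 - q)^-1 ^+ #|I| / e1 ^+ 2 <= e / 4.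
  pose t := e / 4 * e1 ^+ 2 * (1 - q) ^+ #|I|.
  have t0 : 0 < t by apply: mulr_gt0; [apply: mulr_gt0|]; rewrite ?exprn_gt0 ?subr_gt0.
  have /cvgrPdist_le/(_ _ t0)[M1 _ hM1] : q ^+ n @[n --> \oo] --> (0:R).
    by apply: cvg_expr; rewrite ger0_norm// ltW.
  exists M1 => M MM; have := hM1 M.+1 (leqW MM).
  rewrite /= sub0r normrN ger0_norm ?exprn_ge0 ?(ltW q0)// => h.
  rewrite ler_pdivrMr ?exprn_gt0// exprVn ler_pdivrMr ?exprn_gt0 ?subr_gt0//.
have [eta [N0 [eta0 N00 H]]] := hM0 (maxn M0 M1) (leq_maxl _ _).
have trunc_ev N := @kernel_avg_trunc_chebyshev _ _ _ _ _ _ _ _ _ _ _ hX hY hXY _ _ ha hb N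
   (maxn M0 M1) s q e1 e10 q0 q1 hs.
have [N1 hN1] := vanishingU (Gram_max hX ha eta0) (Gram_max hY hb eta0) e4.
exists (maxn N0 N1) => N; rewrite geq_max => /andP[NN0 NN1].
have N_gt0 := leq_trans N00 NN0.
pose U w k := clt_sum alpha X N w k; pose V w k := clt_sum beta Y N w k.
pose g k := s k ^+ 2 / 2 / (1 - s k ^+ 2); pose c k := s k / (1 - s k ^+ 2).
have g0 k : 0 <= g k by apply: divr_ge0; [rewrite divr_ge0// sqr_ge0|exact: ltW].
have iU k : fin_int Pr (fun w => U w k ^+ 2) by case: (clt_sum_sqr hX hY hXY ha hb k N_gt0).
have IU k : \int[Pr]_w (U w k ^+ 2) = 1 by case: (clt_sum_sqr hX hY hXY ha hb k N_gt0).
have iV k : fin_int Pr (fun w => V w k ^+ 2) by case: (clt_sum_sqr hX hY hXY ha hb k N_gt0).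
have IV k : \int[Pr]_w (V w k ^+ 2) = 1 by case: (clt_sum_sqr hX hY hXY ha hb k N_gt0).
have B02 : 0 < B0 / 2 by rewrite divr_gt0.
have i7 k : fin_int Pr (fun w => g k * (U w k ^+ 2 + V w k ^+ 2)).
  by apply: fin_intZ; exact: fin_intD.
have small : \sum_(k : I) 1 / B ^+ 2 <= e / 4.
  rewrite sumr_const -(mulr_natl (1 / B ^+ 2)) mul1r ler_pdivrMr// B2.
  rewrite (_ : e / 4 * _ = #|I|%:R + 1) ?lerDl//; field; exact: lt0r_neq0.
have ev5 : prob_le Pr [set w | exists k, B ^+ 2 <= U w k ^+ 2] (e / 4).
  apply: prob_leW (prob_le_bigcup (fun k => markov_ineq B2_gt0 (iU k) (fun w => sqr_ge0 _))) _ _ => //.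
  by under eq_bigr do rewrite IU; exact: small.
have ev6 : prob_le Pr [set w | exists k, B ^+ 2 <= V w k ^+ 2] (e / 4).
  apply: prob_leW (prob_le_bigcup (fun k => markov_ineq B2_gt0 (iV k) (fun w => sqr_ge0 _))) _ _ => //.
  by under eq_bigr do rewrite IV; exact: small.
have ev7 := markov_ineq B02 (fin_int_sum (index_enum I) predT i7)
  (fun w => sumr_ge0 _ (fun k _ => mulr_ge0 (g0 k) (addr_ge0 (sqr_ge0 _) (sqr_ge0 _)))).
have ev8 := clt_product_chebyshev hX hY hXY ha hb c B02 N_gt0.
apply: prob_leW (prob_leU (prob_leU (prob_leU ev7 ev8) (prob_leU ev5 ev6))
   (prob_leU (trunc_ev N) (hN1 N NN1))) _ _.
  move=> w /= hw; apply: contrapT.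
  move=> /not_orP[/not_orP[/not_orP[/negP h7 /negP h8] /not_orP[h5 h6]]
    /not_orP[/negP h9 /not_orP[/not_orP[ma Ga] /not_orP[mb Gb]]]].
  move: h7 h8 h9; rewrite -!ltNge => h7 h8 h9.
  have sqr_le (x : R) : ~ B ^+ 2 <= x ^+ 2 -> `|x| <= B.
    move=> /negP; rewrite -ltNge => /ltW; rewrite -(real_normK (num_real x)).
    by rewrite ler_pXn2r ?nnegrE ?sqrtr_ge0.
  have h10 : expR (\sum_k mehler_exponent (s k) (U w k) (V w k)) - e1 <=
      trunc_kernel (maxn M0 M1) s (samples alpha X w : 'I_N -> I -> R) (samples beta Y w).
    apply: H => // [i k|i k|k l|k l|k|k].
    - by rewrite leNgt; apply/negP => h; apply: ma; exists k, i.
    - by rewrite leNgt; apply/negP => h; apply: mb; exists k, i.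
    - by rewrite leNgt; apply/negP => h; apply: Ga; exists (k, l); exact: ltW.
    - by rewrite leNgt; apply/negP => h; apply: Gb; exists (k, l); exact: ltW.
    - by apply: sqr_le => h; apply: h5; exists k.
    - by apply: sqr_le => h; apply: h6; exists k.
  have E : \sum_k mehler_exponent (s k) (U w k) (V w k) =
      \sum_k c k * (U w k * V w k) - \sum_k g k * (U w k ^+ 2 + V w k ^+ 2).
    rewrite -sumrB; apply: eq_bigr => k _; rewrite /mehler_exponent /c /g.
    by field; exact: lt0r_neq0.
  have h11 : expR (- B0) <= expR (\sum_k mehler_exponent (s k) (U w k) (V w k)).
    by rewrite ler_expR E; move: h8; rewrite ltr_norml => /andP[? ?]; lra.
  by move: h9; rewrite ltr_norml => /andP[h9 _]; move: hw h10 h11 h9; rewrite /e1; lra.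
have b7 : (\int[Pr]_w \sum_k (g k * (U w k ^+ 2 + V w k ^+ 2))) / (B0 / 2) <=
    2 * S / ((1 - q ^+ 2) * B0).
  rewrite Rintegral_sum//.
  rewrite (_ : 2 * S / ((1 - q ^+ 2) * B0) = (\sum_k s k ^+ 2 / (1 - q ^+ 2)) / (B0 / 2)); last first.
    by rewrite -mulr_suml -/S; field; rewrite !lt0r_neq0.
  rewrite ler_pM2r ?invr_gt0//; apply: ler_sum => k _.
  rewrite RintegralZl//; last exact: fin_intD.
  rewrite (RintegralD measurableT (iU k) (iV k)) IU IV (_ : g k * (1 + 1) = s k ^+ 2 / (1 - s k ^+ 2)); last first.
    by rewrite /g; field; exact: lt0r_neq0.
  by rewrite ler_wpM2l ?sqr_ge0// lef_pV2 ?posrE.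
have b8 : (\sum_k c k ^+ 2) / (B0 / 2) ^+ 2 <= 4 * S / ((1 - q ^+ 2) * B0) ^+ 2.
  rewrite (_ : 4 * S / ((1 - q ^+ 2) * B0) ^+ 2 =
      (\sum_k s k ^+ 2 / (1 - q ^+ 2) ^+ 2) / (B0 / 2) ^+ 2); last first.
    by rewrite -mulr_suml -/S; field; rewrite !lt0r_neq0.
  rewrite ler_pM2r ?invr_gt0 ?exprn_gt0//; apply: ler_sum => k _.
  rewrite expr_div_n ler_wpM2l ?sqr_ge0// lef_pV2 ?posrE ?exprn_gt0//.
  by rewrite lerXn2r// nnegrE ltW.
by have := hM1 _ (leq_maxr M0 M1); move: b7 b8; rewrite /S; lra.
Qed.

End finite_kernel_tail.

(** * Completeness of L^2 and expansion of the density *)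

Section square_integrable.
Context d (S : measurableType d) (R : realType) (mu : probability S R).
Implicit Types f g h : S -> R.

Lemma ae_eq_Rintegral f g : measurable_fun setT f -> measurable_fun setT g ->
  {ae mu, forall x, f x = g x} -> \int[mu]_x f x = \int[mu]_x g x.
Proof.
move=> mf mg fg; rewrite /Rintegral; congr fine; apply: ae_eq_integral => //.
- exact/measurable_EFinP.
- exact/measurable_EFinP.
- by apply: filterS fg => x /= ->.
Qed.

Definition sqr_int f := measurable_fun setT f /\ fin_int mu (fun x => f x ^+ 2).

Lemma sqr_intP f : f \in Lfun mu 2%:E <-> sqr_int f.
Proof.
split=> [hf|[mf i2]].
  split; last exact: Lfun2_integrable_sqr.
  by move: hf; rewrite inE => /andP[/[!inE]].
rewrite inE; apply/andP; split; rewrite inE//=.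
rewrite /finite_norm unlock/=; apply: poweR_lty.
move/integrableP: i2 => [_]; apply: le_lt_trans; rewrite le_eqVlt; apply/orP; left; apply/eqP.
apply: eq_integral => x _ /=.
by rewrite powR_mulrn ?normr_ge0// normrX.
Qed.

Lemma sqr_int_mul f g : sqr_int f -> sqr_int g -> fin_int mu (fun x => f x * g x).
Proof.
move=> [mf f2] [mg g2]; apply: fin_int_le (fin_intD f2 g2) _; first exact: measurable_funM.
move=> x; rewrite ler_norml.
by have := sqr_ge0 (f x + g x); have := sqr_ge0 (f x - g x);
   have := sqr_ge0 (f x); have := sqr_ge0 (g x); lra.
Qed.

Lemma sqr_int_cst (c : R) : sqr_int (fun=> c).
Proof. by split => //; exact: fin_int_cst. Qed.

Lemma sqr_int_int f : sqr_int f -> fin_int mu f.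
Proof.
by move=> /sqr_int_mul/(_ (sqr_int_cst 1)); under eq_fun do rewrite mulr1.
Qed.

Lemma sqr_intD f g : sqr_int f -> sqr_int g -> sqr_int (fun x => f x + g x).
Proof.
move=> hf hg; have fg := sqr_int_mul hf hg; case: hf hg => [mf f2] [mg g2]; split.
  exact: measurable_funD.
rewrite (_ : (fun x => _) = (fun x => (f x ^+ 2 + g x ^+ 2) + 2 * (f x * g x))).
  by apply: fin_intD; [exact: fin_intD|exact: fin_intZ].
by apply/funext => x; ring.
Qed.

Lemma sqr_intZ f (c : R) : sqr_int f -> sqr_int (fun x => c * f x).
Proof.
move=> [mf f2]; split; first exact: measurable_funM.
by under eq_fun do rewrite exprMn; exact: fin_intZ.
Qed.

Lemma sqr_intB f g : sqr_int f -> sqr_int g -> sqr_int (fun x => f x - g x).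
Proof.
move=> hf hg; rewrite (_ : (fun x => _) = (fun x => f x + -1 * g x)).
  by apply: sqr_intD => //; exact: sqr_intZ.
by apply/funext => x; rewrite mulN1r.
Qed.

Lemma sqr_int_sum (J : Type) (r : seq J) (p : pred J) (F : J -> S -> R) :
  (forall j, sqr_int (F j)) -> sqr_int (fun x => \sum_(j <- r | p j) F j x).
Proof.
move=> hF; elim: r => [|j r IH].
  by under eq_fun do rewrite big_nil; exact: sqr_int_cst.
under eq_fun do rewrite big_cons; case: (p j) => //; exact: sqr_intD.
Qed.

(** Cauchy-Schwarz for u in the unit ball: with c the pairing, the integral of (f - c u)^2 is
    nonnegative. *)
Lemma sqr_int_pairing_le f u : sqr_int f -> sqr_int u ->
  \int[mu]_x (u x ^+ 2) <= 1 -> (\int[mu]_x (f x * u x)) ^+ 2 <= \int[mu]_x (f x ^+ 2).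
Proof.
move=> hf hu u1; pose c := \int[mu]_x (f x * u x).
have ifu := sqr_int_mul hf hu; have [_ f2] := hf; have [_ u2] := hu.
have : 0 <= \int[mu]_x ((f x - c * u x) ^+ 2) by apply: Rintegral_ge0 => x _; exact: sqr_ge0.
under eq_Rintegral => x _.
  rewrite (_ : _ ^+ 2 = (f x ^+ 2 + (- (2 * c)) * (f x * u x)) + c ^+ 2 * (u x ^+ 2)); last by ring.
  over.
rewrite RintegralD//; [|by apply: fin_intD => //; exact: fin_intZ|exact: fin_intZ].
rewrite RintegralD//; last exact: fin_intZ.
rewrite !RintegralZl// -/c => h.
have : c ^+ 2 * \int[mu]_x (u x ^+ 2) <= c ^+ 2 by rewrite ler_piMr// sqr_ge0.
by move: h; rewrite expr2; lra.
Qed.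

Lemma sqr_int_norm f : sqr_int f -> sqr_int (fun x => `|f x|).
Proof.
move=> [mf f2]; split; first exact: measurableT_comp.
by under eq_fun do rewrite real_normK ?num_real//.
Qed.

Lemma Rintegral_norm_sqr_le f : sqr_int f ->
  (\int[mu]_x `|f x|) ^+ 2 <= \int[mu]_x (f x ^+ 2).
Proof.
move=> hf; have := sqr_int_pairing_le (sqr_int_norm hf) (sqr_int_cst 1).
rewrite expr1n Rintegral_cst_prob => /(_ (lexx _)).
under eq_Rintegral do rewrite mulr1.
by under [X in _ <= X -> _]eq_Rintegral do rewrite real_normK ?num_real//.
Qed.


Lemma fatou_sqr (h_ : nat -> S -> R) h (c : R) :
  (forall n, sqr_int (h_ n)) -> (forall n, \int[mu]_x (h_ n x ^+ 2) <= c) ->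
  (forall x, h_ n x @[n --> \oo] --> h x) ->
  sqr_int h /\ \int[mu]_x (h x ^+ 2) <= c.
Proof.
move=> hh hc cvh.
have mh : measurable_fun setT h.
  by apply: (measurable_fun_cvg (fun n => (hh n).1)) => x _; exact: cvh.
have mh2 : measurable_fun setT (fun x => (h x ^+ 2)%:E).
  by apply/measurable_EFinP; exact: measurable_funX.
have le_c : (\int[mu]_x (h x ^+ 2)%:E <= c%:E)%E.
  have -> : (\int[mu]_x (h x ^+ 2)%:E = \int[mu]_x limn_einf (fun n => (h_ n x ^+ 2)%:E))%E.
    apply: eq_integral => x _; apply/esym.
    have /cvg_limn_einf_sup[-> _] // : (h_ n x ^+ 2)%:E @[n --> \oo] --> (h x ^+ 2)%:E.
    apply: cvg_EFin; first exact: nearW.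
    rewrite expr2; under eq_fun do rewrite expr2.
    by apply: cvgM; exact: cvh.
  apply: le_trans (fatou mu measurableT _ _) _ => [n|n x _|].
  - by apply/measurable_EFinP; apply: measurable_funX; case: (hh n).
  - by rewrite lee_fin sqr_ge0.
  rewrite limn_einf_lim; apply: lime_le; first exact: is_cvg_einfs.
  apply: nearW => n; apply: (@le_trans _ _ (\int[mu]_x (h_ n x ^+ 2)%:E)%E).
    by apply: ereal_inf_lbound; exists n => /=.
  rewrite -(@fineK _ (\int[mu]_x (h_ n x ^+ 2)%:E)%E); last first.
    by apply: integrable_fin_num => //; case: (hh n).
  by rewrite lee_fin; exact: hc.
have ih : fin_int mu (fun x => h x ^+ 2).
  apply/integrableP; split => //.
  under eq_integral => x _ do rewrite /= ger0_norm ?sqr_ge0//.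
  exact: le_lt_trans le_c (ltry _).
split=> //; rewrite -lee_fin fineK//; exact: integrable_fin_num.
Qed.

(** The sum of the absolute increments has integral at most 2, hence is finite almost everywhere;
    [A] is the set where it is. *)
Lemma ae_cvg_fast (u : nat -> S -> R) : (forall n, measurable_fun setT (u n)) ->
  (forall n, fin_int mu (u n)) ->
  (forall n, \int[mu]_x `|u n.+1 x - u n x| <= 2 ^- n) ->
  exists A, [/\ measurable A, {ae mu, forall x, A x} &
    forall x, A x -> cvgn (fun n => u n x)].
Proof.
move=> mu_ iu hu; pose D n x := `|u n.+1 x - u n x|.
have D0 n x : (0 <= (D n x)%:E)%E by rewrite lee_fin normr_ge0.
have iD n : fin_int mu (D n) by apply: fin_int_norm; exact: fin_intB.
have mD n : measurable_fun setT (fun x => (D n x)%:E).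
  by apply/measurable_EFinP; apply: fin_int_measurable (iD n).
pose G x := (\sum_(n <oo) (D n x)%:E)%E.
have mG : measurable_fun setT G.
  apply: (@ge0_emeasurable_sum _ S R setT (fun n x => (D n x)%:E) xpredT) => [k x _ _|k _].
    exact: D0.
  exact: mD.
have intG : (\int[mu]_x G x < +oo)%E.
  rewrite integral_nneseries//.
  apply: (@le_lt_trans _ _ (\sum_(n <oo) (2 ^- n)%:E)%E).
    apply: lee_nneseries => [n _ _|n _].
      by apply: integral_ge0 => x _; exact: D0.
    rewrite -(@fineK _ (\int[mu]_x (D n x)%:E)%E) ?lee_fin; first exact: hu.
    by apply: integrable_fin_num => //; exact: iD.
  apply: le_lt_trans (ltry (2 : R)); apply: le_trans (epsilon_trick0 xpredT _) => //.
  apply: lee_nneseries => [n _ _|n _]; first by rewrite lee_fin invr_ge0 exprn_ge0.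
  by rewrite lee_fin natrX exprS invfM mulrA divff ?pnatr_eq0// mul1r.
exists [set x | (G x < +oo)%E]; split.
- by rewrite -[X in measurable X]setTI; apply: emeasurable_fun_infty_o.
- have : mu.-integrable setT G.
    apply/integrableP; split => //; apply: le_lt_trans intG.
    rewrite le_eqVlt; apply/orP; left; apply/eqP; apply: eq_integral => x _.
    by rewrite gee0_abs// nneseries_ge0.
  move=> /(integrable_ae measurableT).
  by apply: filterS => x /(_ Logic.I) /fin_numPlt/andP[].
- move=> x /= Gx.
  have -> : (fun n => u n x) = (fun n => u 0 x + series (fun i => u i.+1 x - u i x) n).
    by apply/funext => n; rewrite /series/= telescope_sumr// addrC subrK.
  apply: is_cvgD; first exact: is_cvg_cst.
  apply: normed_cvg; apply: nondecreasing_is_cvgn.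
    by apply: nondecreasing_series => n _ _; exact: normr_ge0.
  exists (fine (G x)) => _ [n _ <-].
  rewrite -lee_fin fineK; last first.
    by rewrite ge0_fin_numE// nneseries_ge0.
  rewrite /series/= -sumEFin; apply: (nneseries_lim_ge n) => k _ _.
  by rewrite lee_fin.
Qed.


Lemma Riesz_Fischer (u : nat -> S -> R) : (forall n, sqr_int (u n)) ->
  (forall i j, (i <= j)%N -> \int[mu]_x ((u j x - u i x) ^+ 2) <= (2 ^- i) ^+ 2) ->
  exists2 g, sqr_int g & forall i, \int[mu]_x ((g x - u i x) ^+ 2) <= (2 ^- i) ^+ 2.
Proof.
move=> hu cu; have mu_ n : measurable_fun setT (u n) by case: (hu n).
have [|A [mA aeA cA]] := ae_cvg_fast mu_ (fun n => sqr_int_int (hu n)).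
  move=> n; rewrite -(ler_pXn2r (ltn0Sn 1)) ?nnegrE ?invr_ge0 ?exprn_ge0//; last first.
    by apply: Rintegral_ge0 => x _; exact: normr_ge0.
  apply: le_trans (Rintegral_norm_sqr_le (sqr_intB (hu n.+1) (hu n))) _.
  exact: cu.
(* Cutting with the indicator of [A] makes the sequence converge at every point, as [fatou_sqr]
   requires. *)
pose v n x : R := \1_A x * u n x.
have hA n : sqr_int (v n).
  have [mun un2] := hu n; split; first by apply: measurable_funM.
  apply: fin_int_le un2 _ => [|x].
    by apply: measurable_funX; apply: measurable_funM.
  rewrite ger0_norm ?sqr_ge0// /v indicE; case: (x \in A); rewrite /= ?mul1r//.
  by rewrite mul0r expr0n/= sqr_ge0.
pose g x : R := lim (v n x @[n --> \oo]).
have cv x : v n x @[n --> \oo] --> g x.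
  suff : cvgn (fun n => v n x) by [].
  have [xA|xA] := boolP (x \in A).
    rewrite (_ : (fun n => v n x) = (fun n => u n x)).
      by apply: cA; rewrite inE in xA.
    by apply/funext => n; rewrite /v indicE xA mul1r.
  rewrite (_ : (fun n => v n x) = cst 0); first exact: is_cvg_cst.
  by apply/funext => n; rewrite /v indicE (negPf xA) mul0r.
have mg : measurable_fun setT g.
  by apply: (measurable_fun_cvg (fun n => (hA n).1)) => x _; exact: cv.
have H i : sqr_int (fun x => g x - v i x) /\
    \int[mu]_x ((g x - v i x) ^+ 2) <= (2 ^- i) ^+ 2.
  apply: (@fatou_sqr (fun n x => v (n + i)%N x - v i x)) => [n|n|x].
  - exact: sqr_intB.
  - apply: le_trans (cu i (n + i)%N (leq_addl _ _)).
    apply: le_Rintegral => //; [by case: (sqr_intB (hA (n + i)%N) (hA i))|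
      by case: (sqr_intB (hu (n + i)%N) (hu i))|move=> x _].
    rewrite /v indicE; case: (x \in A); rewrite /= ?mul1r//.
    by rewrite !mul0r subrr expr0n/= sqr_ge0.
  - apply: cvgB; last exact: cvg_cst.
    by have := cv x; rewrite -(cvg_shiftn i).
exists g => [|i].
  have := sqr_intD (H 0%N).1 (hA 0%N); congr sqr_int; apply/funext => x.
  by rewrite subrK.
apply: le_trans (H i).2; rewrite le_eqVlt; apply/orP; left; apply/eqP.
apply: ae_eq_Rintegral.
- by apply: measurable_funX; exact: measurable_funB.
- by case: (H i) => -[? _] _; exact: measurable_funX.
- by apply: filterS aeA => x Ax; rewrite /v indicE mem_set// mul1r.
Qed.

Lemma eq_of_dist_pow2 (x y : R) (k : nat) :
  (forall i, (k <= i)%N -> `|x - y| <= 2 ^- i) -> x = y.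
Proof.
move=> h; apply/eqP; rewrite -subr_eq0 -normr_le0 leNgt; apply/negP => xy.
pose i := maxn k (Num.bound `|x - y|^-1).
have := h i (leq_maxl _ _); rewrite leNgt => /negP; apply.
rewrite -[ltRHS]invrK ltf_pV2 ?posrE ?invr_gt0 ?exprn_gt0//.
apply: lt_trans (archi_boundP _) _; first by rewrite invr_ge0 ltW.
rewrite -natrX ltr_nat; apply: (leq_ltn_trans (leq_maxr k _)).
exact: ltn_expl.
Qed.

Section Parseval.
Variables (e : nat -> S -> R) (f : S -> R).
Hypotheses (he : is_padded_onb mu e) (hf : sqr_int f).

Let c k := \int[mu]_x (f x * e k x).

Let he2 k : sqr_int (e k). Proof. by apply/sqr_intP; exact: onb_L2 he k. Qed.

(** Covers the padding: where [e k] is null instead of normed, the coefficient vanishes as well. *)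
Let coef_null k : c k * \int[mu]_x (e k x * e k x) = c k.
Proof.
have [->|ek0] := onb_norm he k; first by rewrite mulr1.
suff -> : c k = 0 by rewrite mul0r.
rewrite /c (ae_eq_Rintegral (g := cst 0)) ?Rintegral_cst_prob//.
- by apply: fin_int_measurable (sqr_int_mul hf (he2 k)).
- by apply: filterS ek0 => x /(_ Logic.I)/= ->; rewrite mulr0.
Qed.

Let he_le1 k : \int[mu]_x (e k x ^+ 2) <= 1.
Proof.
under eq_Rintegral do rewrite expr2.
have [->//|ek0] := onb_norm he k.
rewrite (ae_eq_Rintegral (g := cst 0)) ?Rintegral_cst_prob//.
- by apply: fin_int_measurable (sqr_int_mul (he2 k) (he2 k)).
- by apply: filterS ek0 => x /(_ Logic.I)/= ->; rewrite mulr0.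
Qed.

(** The predicate serves both the partial sums, with [predT], and their differences, with a lower
    bound on k. *)
Let part (p : pred nat) n x := \sum_(0 <= k < n | p k) c k * e k x.

Let hpart p n : sqr_int (part p n).
Proof. by apply: sqr_int_sum => k; exact: sqr_intZ. Qed.

Let part_pairing p n j : \int[mu]_x (part p n x * e j x) = if (j < n)%N && p j then c j else 0.
Proof.
rewrite /part.
under eq_Rintegral do rewrite mulr_suml.
rewrite Rintegral_sum => [|k]; last first.
  by under eq_fun do rewrite -mulrA; apply: fin_intZ; exact: sqr_int_mul.
rewrite (eq_bigr (fun k => if k == j then c j else 0)) => [|k _]; last first.
  under eq_Rintegral do rewrite -mulrA.
  rewrite RintegralZl//; last exact: sqr_int_mul.
  case: eqVneq => [->|/eqP kj]; first exact: coef_null.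
  by rewrite (onb_orth he kj) mulr0.
by rewrite -big_mkcondr (big_nat1_cond_eq _ (fun=> c j)).
Qed.

Let part_sqr p n : \int[mu]_x (part p n x ^+ 2) = \sum_(0 <= k < n | p k) c k ^+ 2.
Proof.
under eq_Rintegral => x _.
  rewrite expr2 {2}/part mulr_sumr.
  under eq_bigr do rewrite mulrCA.
  over.
rewrite Rintegral_sum => [|k]; last by apply: fin_intZ; exact: sqr_int_mul.
rewrite big_seq_cond [RHS]big_seq_cond; apply: eq_bigr => k; rewrite mem_index_iota/= => /andP[kn pk].
by rewrite RintegralZl//; [rewrite part_pairing kn pk expr2|exact: sqr_int_mul].
Qed.

Let part_dist n : \int[mu]_x ((f x - part predT n x) ^+ 2) =
  \int[mu]_x (f x ^+ 2) - \sum_(0 <= k < n) c k ^+ 2.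
Proof.
have [_ f2] := hf; have [_ p2] := hpart predT n; have fp := sqr_int_mul hf (hpart predT n).
under eq_Rintegral => x _.
  rewrite (_ : _ ^+ 2 = (f x ^+ 2 + (- 2) * (f x * part predT n x)) + part predT n x ^+ 2);
    last by ring.
  over.
rewrite RintegralD//; last by apply: fin_intD => //; exact: fin_intZ.
rewrite RintegralD//; last exact: fin_intZ.
rewrite RintegralZl// part_sqr.
have -> : \int[mu]_x (f x * part predT n x) = \sum_(0 <= k < n) c k ^+ 2.
  under eq_Rintegral => x _.
    rewrite /part mulr_sumr.
    under eq_bigr do rewrite mulrCA.
    over.
  rewrite Rintegral_sum => [|k]; last by apply: fin_intZ; exact: sqr_int_mul.
  by apply: eq_bigr => k _; rewrite RintegralZl//; exact: sqr_int_mul.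
by ring.
Qed.

Lemma Bessel n : \sum_(0 <= k < n) (\int[mu]_x (f x * e k x)) ^+ 2 <= \int[mu]_x (f x ^+ 2).
Proof.
rewrite -subr_ge0 -part_dist; apply: Rintegral_ge0 => x _; exact: sqr_ge0.
Qed.

(** Along a fast subsequence the partial sums converge in L^2 to some g with the same coefficients
    as f. Completeness gives f = g almost everywhere, and [part_dist] turns the distance into the
    missing part of the sum. *)
Lemma Parseval :
  \sum_(0 <= k < n) (\int[mu]_x (f x * e k x)) ^+ 2 @[n --> \oo] --> \int[mu]_x (f x ^+ 2).
Proof.
pose s n := \sum_(0 <= k < n) c k ^+ 2.
have nd : nondecreasing_seq s by apply: nondecreasing_series => n _ _; exact: sqr_ge0.
have cs : s @ \oo --> lim (s @ \oo).
  apply: nondecreasing_is_cvgn => //.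
  by exists (\int[mu]_x (f x ^+ 2)) => _ [n _ <-]; exact: Bessel.
set l := lim (s @ \oo) in cs.
suff -> : \int[mu]_x (f x ^+ 2) = l by [].
have sl n : s n <= l by exact: nondecreasing_cvgn_le.
have /choice[Nf hNf] : forall i, exists N0 : nat, forall n, (N0 <= n)%N -> l - s n <= (2 ^- i) ^+ 2.
  move=> i; have i0 : 0 < (2 ^- i) ^+ 2 :> R by rewrite exprn_gt0// invr_gt0 exprn_gt0.
  have /cvgrPdist_le/(_ _ i0)[N0 _ hN0] := cs; exists N0 => n /hN0.
  exact: le_trans (ler_norm _).
(* The sum makes [m] nondecreasing and at least [Nf i]; the summand [i] makes it unbounded, so that
   every index k is eventually below [m i]. *)
pose m i := (\sum_(j < i.+1) Nf j + i)%N.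
have mle i j : (i <= j)%N -> (m i <= m j)%N.
  move=> ij; apply: leq_add => //; rewrite -!(big_mkord xpredT Nf).
  by rewrite (big_cat_nat (n := i.+1) (p := j.+1))//= leq_addr.
have mN i : l - s (m i) <= (2 ^- i) ^+ 2.
  by apply: hNf; rewrite /m big_ord_recr/= -addnA addnC -addnA leq_addr.
have [i j ij|g hg Hg] := @Riesz_Fischer (fun i => part predT (m i)) (fun i => hpart predT (m i)).
  have -> : (fun x => (part predT (m j) x - part predT (m i) x) ^+ 2) =
      (fun x => part (fun k => (m i <= k)%N) (m j) x ^+ 2).
    apply/funext => x; congr (_ ^+ 2); rewrite /part (big_cat_nat (n := m i))//=; last exact: mle.
    by rewrite addrAC subrr add0r (@big_nat_widenl _ _ _ _ 0).
  rewrite part_sqr; apply: le_trans (mN i); rewrite lerBrDl.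
  apply: le_trans (sl (m j)).
  have -> : s (m j) = s (m i) + \sum_(m i <= k < m j) c k ^+ 2.
    by rewrite /s (big_cat_nat (n := m i))//=; exact: mle.
  by rewrite lerD2l [leRHS](@big_nat_widenl _ _ _ (m i) 0).
have gc k : \int[mu]_x (g x * e k x) = c k.
  apply: (@eq_of_dist_pow2 _ _ k.+1) => i ki.
  have km : (k < m i)%N by rewrite (leq_trans ki)// leq_addl.
  rewrite -(ler_pXn2r (ltn0Sn 1)) ?nnegrE ?invr_ge0 ?exprn_ge0//.
  apply: le_trans (Hg i); rewrite real_normK ?num_real//.
  apply: le_trans (sqr_int_pairing_le (sqr_intB hg (hpart predT (m i))) (he2 k) (he_le1 k)).
  rewrite le_eqVlt; apply/orP; left; apply/eqP; congr (_ ^+ 2).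
  under [RHS]eq_Rintegral do rewrite mulrBl.
  by rewrite RintegralB ?part_pairing ?km//; exact: sqr_int_mul.
have fg : (fun x => f x - g x) = cst 0 %[ae mu].
  apply: (onb_complete he); first by apply/sqr_intP; exact: sqr_intB.
  move=> k; under eq_Rintegral do rewrite mulrBl.
  by rewrite RintegralB ?gc ?subrr//; exact: sqr_int_mul.
apply: (@eq_of_dist_pow2 _ _ 0) => i _.
have fi : \int[mu]_x (f x ^+ 2) - s (m i) <= (2 ^- i) ^+ 2.
  rewrite /s -part_dist; apply: le_trans (Hg i); rewrite le_eqVlt; apply/orP; left; apply/eqP.
  apply: ae_eq_Rintegral.
  - by case: (sqr_intB hf (hpart predT (m i))) => _ /fin_int_measurable.
  - by case: (sqr_intB hg (hpart predT (m i))) => _ /fin_int_measurable.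
  - by apply: filterS fg => x /(_ Logic.I)/= /eqP; rewrite subr_eq0 => /eqP ->.
have pi : (2 ^- i) ^+ 2 <= 2 ^- i :> R.
  by rewrite expr2 ler_piMr ?invr_ge0 ?exprn_ge0// invf_le1 ?exprn_gt0// exprn_ege1// ler1n.
have := mN i; have := sl (m i); have := Bessel (m i); rewrite -/(s (m i)) ler_norml.
by move: fi pi; lra.
Qed.

End Parseval.

End square_integrable.

Section real_Fubini.
Context d1 d2 (T1 : measurableType d1) (T2 : measurableType d2) (R : realType).
Variables (P : probability T1 R) (Q : probability T2 R).

(** Passing to real values by [fine] alters the inner integral only where it is infinite, which is a
    null set. *)
Lemma Rintegral_Fubini (f : T1 * T2 -> R) : fin_int (P \x Q)%E f ->
  [/\ {ae P, forall x, fin_int Q (fun y => f (x, y))},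
      fin_int P (fun x => \int[Q]_y f (x, y)) &
      \int[(P \x Q)%E]_z f z = \int[P]_x \int[Q]_y f (x, y)].
Proof.
move=> fi; have h1 := ae_integrable1 fi.
pose G x := (\int[Q]_y (f (x, y))%:E)%E.
have iG : P.-integrable setT G by exact: (integrable_fubini_F fi).
have mG := measurable_int _ iG.
have ifG : fin_int P (fun x => \int[Q]_y f (x, y)).
  apply: (le_integrable measurableT _ _ iG).
    by apply/measurable_EFinP; apply: measurableT_comp.
  by move=> y _ /=; rewrite /Rintegral -/(G y); case: (G y) => //= *; rewrite normr0 leey.
split=> //; rewrite {1}/Rintegral -(integral12_prod_meas1 fi); congr fine.
apply: ae_eq_integral => //; first exact: measurable_int ifG.
apply: filterS (integrable_ae measurableT iG) => y /(_ Logic.I) Gy _.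
by rewrite /= /Rintegral -/(G y) fineK.
Qed.

Lemma fin_int_tensor (f : T1 -> R) (g : T2 -> R) : fin_int P f -> fin_int Q g ->
  fin_int (P \x Q)%E (fun z => f z.1 * g z.2) /\
  \int[(P \x Q)%E]_z (f z.1 * g z.2) = \int[P]_x f x * \int[Q]_y g y.
Proof.
move=> fi gi.
have mf := fin_int_measurable fi; have mg := fin_int_measurable gi.
have mfg : measurable_fun setT (fun z : T1 * T2 => f z.1 * g z.2).
  by apply: measurable_funM; exact: measurableT_comp.
have h : fin_int (P \x Q)%E (fun z => f z.1 * g z.2).
  apply/integrable12ltyP; first exact/measurable_EFinP.
  under eq_integral => x _.
    under eq_integral do rewrite /= normrM EFinM.
    rewrite ge0_integralZl//; last exact/measurable_EFinP/measurableT_comp.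
    over.
  rewrite /= ge0_integralZr//; last 2 first.
  - exact/measurable_EFinP/measurableT_comp.
  - exact: integral_ge0.
  move/integrableP: fi => [_ fi]; move/integrableP: gi => [_ gi].
  by rewrite lte_mul_pinfty// ?integral_ge0// ge0_fin_numE// integral_ge0.
split=> //; have [_ _ ->] := Rintegral_Fubini h.
rewrite -RintegralZr//.
by apply: eq_Rintegral => x _ /=; rewrite RintegralZl.
Qed.

End real_Fubini.

(** * Hilbert-Schmidt expansion of the density *)

Section kernel_expansion.
Context d1 d2 (T1 : measurableType d1) (T2 : measurableType d2) (R : realType).
Variables (P : probability T1 R) (Q : probability T2 R) (xi : T1 * T2 -> R).
Variables (s : nat -> R) (alpha : nat -> T1 -> R) (beta : nat -> T2 -> R).
Hypothesis hs : is_singular_system P Q xi s alpha beta.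
Let PQ : probability _ R := (P \x Q)%E.
Hypothesis hxi : sqr_int PQ xi.

Let ha k : sqr_int P (alpha k).
Proof. by apply/sqr_intP; exact: onb_L2 (ss_alpha_onb hs) k. Qed.
Let hb k : sqr_int Q (beta k).
Proof. by apply/sqr_intP; exact: onb_L2 (ss_beta_onb hs) k. Qed.

Lemma sqr_int_tensor (f : T1 -> R) (g : T2 -> R) : sqr_int P f -> sqr_int Q g ->
  sqr_int PQ (fun z => f z.1 * g z.2).
Proof.
move=> [mf f2] [mg g2]; split.
  by apply: measurable_funM; exact: measurableT_comp.
by under eq_fun do rewrite exprMn; case: (fin_int_tensor f2 g2).
Qed.

(** For almost every x the coefficients of the section xi (x, .) in the basis [beta] are s_k
    alpha_k(x). Integrating Parseval's identity in x is dominated convergence, with Bessel's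
    inequality as domination. *)
Lemma singular_values_sum :
  \sum_(0 <= k < n) s k ^+ 2 @[n --> \oo] --> \int[PQ]_z (xi z ^+ 2).
Proof.
have [mxi xi2] := hxi.
have [ae1 iG EG] := Rintegral_Fubini xi2.
pose G x := \int[Q]_y (xi (x, y) ^+ 2).
pose F n x := \sum_(0 <= k < n) (s k * alpha k x) ^+ 2.
have iF n : fin_int P (F n).
  apply: fin_int_sum => k; by case: (sqr_intZ (s k) (ha k)).
have IF n : \int[P]_x F n x = \sum_(0 <= k < n) s k ^+ 2.
  rewrite Rintegral_sum => [|k]; last by case: (sqr_intZ (s k) (ha k)).
  apply: eq_bigr => k _; under eq_Rintegral do rewrite exprMn.
  rewrite RintegralZl//; last by case: (ha k).
  under eq_Rintegral do rewrite expr2.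
  have [->|sk] := eqVneq (s k) 0; first by rewrite expr0n/= mul0r.
  by have [-> _] := ss_nonnull hs sk; rewrite mulr1.
have ae2 : {ae P, forall x k, opA_adj Q xi (beta k) x = s k * alpha k x}.
  by apply: ae_foralln => k; apply: filterS (ss_Aadj hs k) => x /(_ Logic.I).
have ae3 : {ae P, forall x, (forall n, F n x <= G x) /\ F n x @[n --> \oo] --> G x}.
  near=> x.
  have h1 : fin_int Q (fun y => xi (x, y) ^+ 2) by near: x.
  have h2 : forall k, opA_adj Q xi (beta k) x = s k * alpha k x by near: x.
  have hx : sqr_int Q (fun y => xi (x, y)) by split => //; exact: measurableT_comp.
  have Fx n : F n x = \sum_(0 <= k < n) (\int[Q]_y (xi (x, y) * beta k y)) ^+ 2.
    rewrite /F; apply: eq_bigr => k _; rewrite -h2 /opA_adj.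
    by under eq_Rintegral do rewrite mulrC.
  split=> [n|]; first by rewrite Fx; exact: (Bessel (ss_beta_onb hs) hx).
  by rewrite (funext Fx); exact: (Parseval (ss_beta_onb hs) hx).
rewrite EG -(funext IF).
have F0 n x : 0 <= F n x by apply: sumr_ge0 => k _; exact: sqr_ge0.
have h1 : {ae P, forall x, setT x -> (EFin \o F n) x @[n --> \oo] --> (EFin \o G) x}.
  apply: filterS ae3 => x [_ h] _; apply: cvg_EFin => //; exact: nearW.
have h2 : {ae P, forall x n, setT x -> (`|(EFin \o F n) x| <= (EFin \o G) x)%E}.
  by apply: filterS ae3 => x [h _] n _; rewrite /= lee_fin ger0_norm.
have [||_ _] := @dominated_convergence _ T1 R P setT measurableT (fun n => EFin \o F n)
  (EFin \o G) (EFin \o G) _ _ h1 iG h2.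
- by move=> n; exact: measurable_int (iF n).
- exact: measurable_int iG.
rewrite -(@fineK _ (\int[P]_x (EFin \o G) x)%E); last exact: integrable_fin_num.
by move=> /fine_cvg; exact.
Unshelve. all: by end_near. Qed.

Definition kernel_part n z : R := \sum_(0 <= k < n) s k * (alpha k z.1 * beta k z.2).

Lemma sqr_int_kernel_part n : sqr_int PQ (kernel_part n).
Proof. by apply: sqr_int_sum => k; apply: sqr_intZ; exact: sqr_int_tensor. Qed.

Lemma kernel_pairing k : \int[PQ]_z (xi z * (alpha k z.1 * beta k z.2)) = s k.
Proof.
have h := sqr_int_mul hxi (sqr_int_tensor (ha k) (hb k)).
have [ae1 i1 ->] := Rintegral_Fubini h.
have mi := fin_int_measurable i1.
have [_ ak2] := ha k.
rewrite (ae_eq_Rintegral (g := fun x => s k * alpha k x ^+ 2))//; last 2 first.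
- exact: fin_int_measurable (fin_intZ (s k) ak2).
- have [mxi xi2] := hxi; have [ae2 _ _] := Rintegral_Fubini xi2.
  have ae3 : {ae P, forall x, opA_adj Q xi (beta k) x = s k * alpha k x}.
    by apply: filterS (ss_Aadj hs k) => x /(_ Logic.I).
  near=> x.
  have h1 : fin_int Q (fun y => xi (x, y) ^+ 2) by near: x.
  have h2 : opA_adj Q xi (beta k) x = s k * alpha k x by near: x.
  have hx : sqr_int Q (fun y => xi (x, y)) by split => //; exact: measurableT_comp.
  rewrite expr2 mulrA -h2 /opA_adj mulrC -RintegralZl//.
    by apply: eq_Rintegral => y _ /=; ring.
  by under eq_fun do rewrite mulrC; exact: sqr_int_mul.
rewrite RintegralZl//; have [->|sk] := eqVneq (s k) 0; first by rewrite mul0r.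
under eq_Rintegral do rewrite expr2.
by have [-> _] := ss_nonnull hs sk; rewrite mulr1.
Unshelve. all: by end_near. Qed.

(** The factors s_j s_k remove the padding: unit norms are known only where the singular value is
    nonzero. *)
Lemma tensor_orthogonal j k : s j * s k * \int[PQ]_z ((alpha j z.1 * beta j z.2) *
  (alpha k z.1 * beta k z.2)) = if j == k then s k ^+ 2 else 0.
Proof.
have [_ E] := fin_int_tensor (sqr_int_mul (ha j) (ha k)) (sqr_int_mul (hb j) (hb k)).
under eq_Rintegral do rewrite mulrACA.
rewrite E; case: eqVneq => [->|/eqP jk].
  have [->|sk] := eqVneq (s k) 0; first by rewrite expr0n/= !mul0r.
  by have [-> ->] := ss_nonnull hs sk; rewrite !mulr1.
by rewrite (onb_orth (ss_alpha_onb hs) jk) mul0r mulr0.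
Qed.

Lemma kernel_part_dist n : \int[PQ]_z ((xi z - kernel_part n z) ^+ 2) =
  \int[PQ]_z (xi z ^+ 2) - \sum_(0 <= k < n) s k ^+ 2.
Proof.
have ht k := sqr_int_tensor (ha k) (hb k).
have [_ x2] := hxi; have [_ p2] := sqr_int_kernel_part n.
have xp := sqr_int_mul hxi (sqr_int_kernel_part n).
under eq_Rintegral => z _.
  rewrite (_ : _ ^+ 2 = (xi z ^+ 2 + (- 2) * (xi z * kernel_part n z)) + kernel_part n z ^+ 2);
    last by ring.
  over.
rewrite RintegralD//; last by apply: fin_intD => //; exact: fin_intZ.
rewrite RintegralD//; last exact: fin_intZ.
rewrite RintegralZl//.
have -> : \int[PQ]_z (xi z * kernel_part n z) = \sum_(0 <= k < n) s k ^+ 2.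
  under eq_Rintegral => x _.
    rewrite /kernel_part mulr_sumr.
    under eq_bigr do rewrite mulrCA.
    over.
  rewrite Rintegral_sum => [|k]; last by apply: fin_intZ; exact: sqr_int_mul.
  by apply: eq_bigr => k _; rewrite RintegralZl ?kernel_pairing ?expr2//; exact: sqr_int_mul.
have -> : \int[PQ]_z (kernel_part n z ^+ 2) = \sum_(0 <= k < n) s k ^+ 2.
  under eq_Rintegral => x _.
    rewrite expr2 /kernel_part mulr_suml.
    under eq_bigr => j _.
      rewrite mulr_sumr.
      under eq_bigr do rewrite mulrACA.
      over.
    over.
  rewrite Rintegral_sum => [|j]; last first.
    by apply: fin_int_sum => k; apply: fin_intZ; exact: sqr_int_mul.
  rewrite big_nat [RHS]big_nat; apply: eq_bigr => j jn.
  rewrite Rintegral_sum => [|k]; last by apply: fin_intZ; exact: sqr_int_mul.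
  rewrite (eq_bigr (fun k => if k == j then s j ^+ 2 else 0)) => [|k _]; last first.
    rewrite RintegralZl//; last exact: sqr_int_mul.
    by rewrite tensor_orthogonal eq_sym; case: eqVneq => // ->.
  by rewrite -big_mkcond (big_nat1_eq _ (fun=> s j ^+ 2)) jn.
by ring.
Qed.

Lemma kernel_part_cvg :
  \int[PQ]_z `|xi z - kernel_part n z| @[n --> \oo] --> (0 : R).
Proof.
apply/cvgrPdist_le => e e0; have e2 : 0 < e ^+ 2 by rewrite exprn_gt0.
have /cvgrPdist_le/(_ _ e2) := singular_values_sum.
apply: filterS => n /=; rewrite sub0r normrN -kernel_part_dist.
rewrite !ger0_norm; last 2 first.
- by apply: Rintegral_ge0 => z _; exact: normr_ge0.
- by apply: Rintegral_ge0 => z _; exact: sqr_ge0.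
move=> /(le_trans (Rintegral_norm_sqr_le (sqr_intB hxi (sqr_int_kernel_part n)))).
rewrite ler_pXn2r// nnegrE; last exact: ltW.
by apply: Rintegral_ge0 => z _; exact: normr_ge0.
Qed.

End kernel_expansion.

(** * Lower tail of the denominator *)

(** The right side is a difference of products over i, so its integral over independent pairs is
    explicit. *)
Lemma prod_dist_le (R : realDomainType) (J : Type) (r : seq J) (a b : J -> R) :
  `|\prod_(i <- r) b i - \prod_(i <- r) a i| <=
  \prod_(i <- r) (`|a i| + `|b i - a i|) - \prod_(i <- r) `|a i|.
Proof.
elim: r => [|i r IH]; first by rewrite !big_nil !subrr normr0.
rewrite !big_cons -normr_prod.
set A := \prod_(j <- r) a j; set B := \prod_(j <- r) b j.
set C := \prod_(j <- r) (`|a j| + `|b j - a j|).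
rewrite -normr_prod -/A -/B -/C in IH.
rewrite (_ : b i * B - a i * A = b i * (B - A) + (b i - a i) * A); last by ring.
apply: le_trans (ler_normD _ _) _; rewrite !normrM.
have bi : `|b i| <= `|a i| + `|b i - a i|.
  by apply: le_trans (ler_normD _ _); rewrite addrC subrK.
have := ler_pM (normr_ge0 _) (normr_ge0 _) bi IH.
by move=> h; apply: le_trans (lerD h (lexx _)) _; rewrite -/A -/C; lra.
Qed.

Section kernel_perturbation.
Context d d' (Om : measurableType d) (T : measurableType d') (R : realType).
Variable Pr : probability Om R.
Variables (P Q : probability T R) (X Y : nat -> {RV Pr >-> T}).
Hypotheses (hX : iid X P) (hY : iid Y Q) (hXY : independent_sequences X Y).
Let PQ : probability _ R := (P \x Q)%E.

(** The bound degrades exponentially in N, so it serves for a fixed N, the approximating kernel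
    being chosen afterwards. *)
Lemma kernel_avg_perturb N (z u : T * T -> R) (e : R) : 0 < e ->
  fin_int PQ z -> fin_int PQ u ->
  prob_le Pr [set w | e <= `|kernel_avg X Y u N w - kernel_avg X Y z N w|]
    (((\int[PQ]_x `|z x| + \int[PQ]_x `|z x - u x|) ^+ N - (\int[PQ]_x `|z x|) ^+ N) / e).
Proof.
move=> e0 iz iu; have fact0 : 0 < N`!%:R :> R by rewrite ltr0n fact_gt0.
have ifact0 : 0 <= N`!%:R^-1 :> R by rewrite invr_ge0 ltW.
pose h x := `|z x| + `|u x - z x|.
have in1 : fin_int PQ (fun x => `|z x|) by exact: fin_int_norm.
have in2 : fin_int PQ (fun x => `|u x - z x|) by apply: fin_int_norm; exact: fin_intB.
have ih : fin_int PQ h by exact: fin_intD.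
pose G (sig : 'S_N) w := \prod_(i < N) h (matched_pair X Y sig i w) -
  \prod_(i < N) `|z (matched_pair X Y sig i w)|.
have i1 sig : fin_int Pr (fun w => \prod_(i < N) h (matched_pair X Y sig i w)).
  exact: (integrable_prod_indep (indep_with_matched_pair hX hY hXY sig) (fun=> ih)).
have i2 sig : fin_int Pr (fun w => \prod_(i < N) `|z (matched_pair X Y sig i w)|).
  exact: (integrable_prod_indep (indep_with_matched_pair hX hY hXY sig) (fun=> in1)).
have iG sig : fin_int Pr (G sig) by exact: fin_intB.
have G0 sig w : 0 <= G sig w.
  exact: le_trans (prod_dist_le _ _ _).
have := markov_ineq e0 (fin_intZ N`!%:R^-1 (fin_int_sum (index_enum 'S_N) predT iG))
  (fun w => mulr_ge0 ifact0 (sumr_ge0 _ (fun sig _ => G0 sig w))).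
move=> H; apply: prob_leW H _ _ => [w /=|].
  move=> /le_trans; apply; rewrite /kernel_avg -mulrBr -sumrB normrM ger0_norm ?invr_ge0 ?(ltW fact0)//.
  rewrite ler_wpM2l ?invr_ge0 ?(ltW fact0)//; apply: le_trans (ler_norm_sum _ _ _) _.
  by apply: ler_sum => sig _; exact: prod_dist_le.
rewrite ler_wpM2r ?invr_ge0 ?(ltW e0)//.
rewrite RintegralZl//; last exact: fin_int_sum.
rewrite Rintegral_sum//.
rewrite (eq_bigr (fun=> (\int[PQ]_x `|z x| + \int[PQ]_x `|z x - u x|) ^+ N -
   (\int[PQ]_x `|z x|) ^+ N)) => [|sig _].
  by rewrite sumr_const card_Sn -[X in _ * X]mulr_natl mulKf// gt_eqF.
rewrite /G (RintegralB measurableT (i1 sig) (i2 sig)).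
rewrite (Rintegral_prod_indep (indep_with_matched_pair hX hY hXY sig) (fun=> ih)).
rewrite (Rintegral_prod_indep (indep_with_matched_pair hX hY hXY sig) (fun=> in1)).
rewrite !prodr_const !card_ord /h (RintegralD measurableT in1 in2).
congr ((_ + _) ^+ _ - _); by apply: eq_Rintegral => x _; rewrite distrC.
Qed.

End kernel_perturbation.

Section labels.
Context d (T : measurableType d) (R : realType) (mu : probability T R).

Lemma orthonormal_with_one_labels (e : nat -> T -> R) (I : finType) (lab : I -> nat) :
  is_padded_onb mu e -> e 0%N = cst 1 %[ae mu] -> injective lab ->
  (forall i, lab i != 0%N) -> (forall i, \int[mu]_x (e (lab i) x * e (lab i) x) = 1) ->
  orthonormal_with_one mu (fun i => e (lab i)).
Proof.
move=> he e0 injl l0 l1.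
have h2 k : sqr_int mu (e k) by apply/sqr_intP; exact: onb_L2 he k.
have mean0 i : \int[mu]_x e (lab i) x = 0.
  rewrite -(onb_orth he (elimN eqP (l0 i))); apply: ae_eq_Rintegral.
  - by case: (h2 (lab i)).
  - exact: fin_int_measurable (sqr_int_mul (h2 _) (h2 _)).
  - by apply: filterS e0 => x /(_ Logic.I)/= ->; rewrite mulr1.
move=> [i|] [j|] /=.
- split; first exact: sqr_int_mul.
  case: eqVneq => [[->]|ij]; first exact: l1.
  rewrite (onb_orth he)// => /injl E; by rewrite E eqxx in ij.
- split; first by under eq_fun do rewrite mulr1; exact: sqr_int_int.
  by under eq_Rintegral do rewrite mulr1; exact: mean0.
- split; first by under eq_fun do rewrite mul1r; exact: sqr_int_int.
  by under eq_Rintegral do rewrite mul1r; exact: mean0.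
- split; first by under eq_fun do rewrite mul1r; exact: fin_int_cst.
  by under eq_Rintegral do rewrite mul1r; rewrite Rintegral_cst_prob.
Qed.

End labels.

Section reduced_kernel.
Context d (T : measurableType d) (R : realType).
Variables (P Q : probability T R) (xi : T * T -> R).
Variables (s : nat -> R) (alpha beta : nat -> T -> R).
Hypothesis hs : is_singular_system P Q xi s alpha beta.
Let PQ : probability _ R := (P \x Q)%E.
Hypothesis hxi : sqr_int PQ xi.

(* The labels [0 < k < n] with [s k != 0], whose singular vectors have norm one. *)
Definition active n : {pred 'I_n} := fun k => (k != 0%N :> nat) && (s k != 0).
Arguments active : clear implicits.

Definition label n (x : {k in active n}) : nat := val (val x).

Lemma label_inj n : injective (@label n).
Proof. by move=> x y /val_inj/val_inj. Qed.

Lemma label_neq0 n (x : {k in active n}) : label x != 0%N.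
Proof. by have := valP x; rewrite unfold_in => /andP[]. Qed.

Lemma s_label n (x : {k in active n}) : s (label x) != 0.
Proof. by have := valP x; rewrite unfold_in => /andP[]. Qed.

Lemma sum_labels n (p : pred nat) (F : nat -> R) : (forall k, s k = 0 -> F k = 0) ->
  \sum_(x : {k in active n} | p (label x)) F (label x) = \sum_(1 <= k < n | p k) F k.
Proof.
move=> F0; rewrite -(big_sub_cond (active n) (fun i => p i) (fun i : 'I_n => F i)) big_geq_mkord.
rewrite big_mkcond [RHS]big_mkcond/=; apply: eq_bigr => i _.
rewrite unfold_in /active -lt0n; case: eqVneq => [/F0->|_]; last by rewrite andbT andbC.
by case: ifP; case: ifP.
Qed.

Lemma orthonormal_active_alpha n :
  orthonormal_with_one P (fun x : {k in active n} => alpha (label x)).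
Proof.
apply: (orthonormal_with_one_labels (ss_alpha_onb hs) (ss_alpha0 hs) (@label_inj n)).
  exact: label_neq0.
by move=> x; case: (ss_nonnull hs (s_label x)).
Qed.

Lemma orthonormal_active_beta n :
  orthonormal_with_one Q (fun x : {k in active n} => beta (label x)).
Proof.
apply: (orthonormal_with_one_labels (ss_beta_onb hs) (ss_beta0 hs) (@label_inj n)).
  exact: label_neq0.
by move=> x; case: (ss_nonnull hs (s_label x)).
Qed.

(** The term k = 0 is the constant 1, to which s_0 alpha_0 beta_0 is equal only almost everywhere;
    the expansion into words needs an exact 1. *)
Definition reduced_kernel n (z : T * T) : R :=
  1 + \sum_(1 <= k < n) s k * (alpha k z.1 * beta k z.2).

(** Expresses the kernel with fewer letters over the larger alphabet by zeroing weights, the form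
    that [kernel_avg_zeroed_chebyshev] compares. *)
Lemma finite_kernel_reduced n K : (K <= n)%N ->
  finite_kernel (fun x : {k in active n} => if (label x < K)%N then s (label x) else 0)
    (fun x => alpha (label x)) (fun x => beta (label x)) = reduced_kernel K.
Proof.
move=> Kn; apply/funext => z; rewrite /finite_kernel /reduced_kernel; congr (_ + _).
rewrite (big_nat_widen _ _ n)//.
rewrite -(@sum_labels n (fun k => k < K)%N (fun k => s k * (alpha k z.1 * beta k z.2))); last first.
  by move=> k ->; rewrite mul0r.
rewrite [RHS]big_mkcond; apply: eq_bigr => x _ /=.
by case: ifP => _; rewrite ?mul0r// mulrA.
Qed.

Lemma reduced_kernel_int n : fin_int PQ (reduced_kernel n).
Proof.
apply: sqr_int_int; apply: sqr_intD; first exact: sqr_int_cst.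
apply: sqr_int_sum => k; apply: sqr_intZ; apply: sqr_int_tensor; apply/sqr_intP.
  exact: onb_L2 (ss_alpha_onb hs) k.
exact: onb_L2 (ss_beta_onb hs) k.
Qed.

Lemma reduced_kernel_cvg :
  \int[PQ]_z `|xi z - reduced_kernel n z| @[n --> \oo] --> (0 : R).
Proof.
have ha : sqr_int P (alpha 0%N) by apply/sqr_intP; exact: onb_L2 (ss_alpha_onb hs) 0%N.
have hb : sqr_int Q (beta 0%N) by apply/sqr_intP; exact: onb_L2 (ss_beta_onb hs) 0%N.
(* The null correction between the two forms of the term k = 0; its squared norm is computed below
   as 1 - 2 + 1. *)
pose D (z : T * T) := alpha 0%N z.1 * beta 0%N z.2 - 1.
have hD : sqr_int PQ D by apply: sqr_intB; [exact: sqr_int_tensor|exact: sqr_int_cst].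
have [i1 E1] := fin_int_tensor (sqr_int_int ha) (sqr_int_int hb).
have D0 : \int[PQ]_z (D z ^+ 2) = 0.
  have [ha1 a2] := ha; have [hb1 b2] := hb.
  have [i2 E2] := fin_int_tensor a2 b2.
  under eq_Rintegral => z _.
    rewrite (_ : _ ^+ 2 = (alpha 0%N z.1 ^+ 2 * beta 0%N z.2 ^+ 2 +
      (- 2) * (alpha 0%N z.1 * beta 0%N z.2)) + 1); last by rewrite /D; ring.
    over.
  rewrite RintegralD//; [|by apply: fin_intD => //; exact: fin_intZ|exact: fin_int_cst].
  rewrite RintegralD//; last exact: fin_intZ.
  rewrite RintegralZl// Rintegral_cst_prob E1 E2.
  have sn0 : s 0%N != 0 by rewrite (ss_s0 hs) oner_eq0.
  have [A2 B2] := ss_nonnull hs sn0.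
  under eq_Rintegral do rewrite expr2.
  under [\int[Q]_x (beta _ _ ^+ 2)]eq_Rintegral do rewrite expr2.
  rewrite A2 B2.
  rewrite (@ae_eq_Rintegral _ _ _ P _ (cst 1))//; last first.
    by apply: filterS (ss_alpha0 hs) => x /(_ Logic.I).
  rewrite (@ae_eq_Rintegral _ _ _ Q _ (cst 1))//; last first.
    by apply: filterS (ss_beta0 hs) => x /(_ Logic.I).
  rewrite !Rintegral_cst_prob; ring.
have D1 : \int[PQ]_z `|D z| = 0.
  have := Rintegral_norm_sqr_le hD; rewrite D0 => h; apply/eqP.
  by rewrite -sqrf_eq0 eq_le h sqr_ge0.
apply: (@squeeze_cvgr _ _ _ _ (cst 0) (fun n => \int[PQ]_z `|xi z - kernel_part s alpha beta n z|)).
- near=> n; rewrite /=; apply/andP; split.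
    by apply: Rintegral_ge0 => z _; exact: normr_ge0.
  have n1 : (0 < n)%N by near: n; exact: nbhs_infty_gt.
  have ik : fin_int PQ (fun z => `|xi z - kernel_part s alpha beta n z|).
    by apply: fin_int_norm; apply: fin_intB; apply: sqr_int_int => //; exact: (sqr_int_kernel_part hs).
  rewrite -[leRHS]addr0 -D1 -RintegralD//; last exact: (fin_int_norm (sqr_int_int hD)).
  apply: le_Rintegral => //.
  + by apply: fin_int_norm; apply: fin_intB; [exact: sqr_int_int|exact: reduced_kernel_int].
  + by apply: fin_intD => //; exact: (fin_int_norm (sqr_int_int hD)).
  move=> z _; apply: le_trans (ler_normD _ _); rewrite le_eqVlt; apply/orP; left; apply/eqP.
  congr (`|_|); rewrite /kernel_part /reduced_kernel (big_ltn n1) (ss_s0 hs) /D; ring.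
- exact: cvg_cst.
- exact: (kernel_part_cvg hs).
Unshelve. all: by end_near. Qed.

End reduced_kernel.

Section denominator_tail.
Context d d' (Om : measurableType d) (T : measurableType d') (R : realType).
Variable Pr : probability Om R.
Variables (P Q : probability T R) (X Y : nat -> {RV Pr >-> T}).
Hypotheses (hX : iid X P) (hY : iid Y Q) (hXY : independent_sequences X Y).
Variables (xi : T * T -> R) (s : nat -> R) (alpha beta : nat -> T -> R).
Hypotheses (hs : is_singular_system P Q xi s alpha beta) (hgap : spectral_gap s).
Let PQ : probability _ R := (P \x Q)%E.
Hypotheses (hxi : sqr_int PQ xi) (xi0 : forall z, 0 <= xi z) (xi1 : \int[PQ]_z xi z = 1).

(** [K] is fixed before N and carries the lower tail; [L] is chosen after N to be close to [xi].
    Replacing [xi] by [L] and [L] by [K] changes the average by less than c / 4 each, off small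
    events, while the average for [K] is at least c. *)
Lemma kernel_avg_lower_tail (e : R) : 0 < e ->
  exists2 delta : R, 0 < delta & exists N0, forall N, (N0 <= N)%N ->
    prob_le Pr [set w | kernel_avg X Y xi N w < delta] e.
Proof.
(* The value 1/2 keeps [q] positive when s_1 = 0. *)
move=> e0; pose q := Num.max (s 1%N) 2^-1.
have q0 : 0 < q by rewrite lt_max invr_gt0 ltr0n orbT.
have q1 : q < 1 by rewrite gt_max hgap.2 invf_lt1 ?ltr1n.
have sq k : (0 < k)%N -> 0 <= s k <= q.
  move=> k0; case/andP: (ss_s_ge0_le1 hs k) => -> _ /=.
  by rewrite le_max hgap.1.
have q2 : 0 < 1 - q ^+ 2 by rewrite subr_gt0 expr_lt1// ltW.
pose S := \int[PQ]_z (xi z ^+ 2).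
have cS := singular_values_sum hs hxi; rewrite -/S in cS.
have nd : nondecreasing_seq (fun n => \sum_(0 <= k < n) s k ^+ 2).
  by apply: nondecreasing_series => k _ _; exact: sqr_ge0.
have leS n : \sum_(0 <= k < n) s k ^+ 2 <= S.
  rewrite -(cvg_lim _ cS)//; apply: nondecreasing_cvgn_le => //.
  by apply/cvg_ex; exists S.
have S0 : 0 <= S by apply: le_trans (leS 0%N); rewrite big_nil.
have leS1 n : \sum_(1 <= k < n) s k ^+ 2 <= S.
  apply: le_trans (leS n); case: n => [|n]; first by rewrite !big_geq.
  by rewrite [leRHS]big_ltn// lerDr sqr_ge0.
(* With (1 - q^2) B0 = t the two explicit terms of [finite_kernel_lower_tail] are at most 2 S / t +
   4 S / t^2. As t >= 1 this is at most 6 S / t, and 24 makes it at most e / 4. *)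
pose t := 24 * S / e + 1.
have tS : 0 <= 24 * S / e by rewrite mulr_ge0 ?invr_ge0 ?mulr_ge0// ltW.
have t1 : 1 <= t by rewrite lerDr.
have t0 : 0 < t by rewrite (lt_le_trans ltr01).
have St : 6 * S / t <= e / 4.
  rewrite ler_pdivrMr// /t mulrDr mulr1.
  have -> : e / 4 * (24 * S / e) = 6 * S by field; exact: lt0r_neq0.
  by rewrite lerDl divr_ge0// ltW.
pose B0 := t / (1 - q ^+ 2).
have B00 : 0 < B0 by rewrite divr_gt0.
have B0t : (1 - q ^+ 2) * B0 = t by rewrite /B0 mulrC mulfVK// lt0r_neq0.
pose c := expR (- B0) / 2.
have c0 : 0 < c by rewrite divr_gt0// expR_gt0.
have c4 : 0 < c / 4 by rewrite divr_gt0.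
have e4 : 0 < e / 4 by rewrite divr_gt0.
pose E0 := expR (S / (1 - q ^+ 2)).
(* The amount of s_k^2 that may be discarded: [K] is chosen so that the letters from [K] on carry at
   most [tau]. *)
have [tau tau0 htau] : exists2 tau : R, 0 < tau &
    E0 * (expR (tau / (1 - q ^+ 2)) - 1) / (c / 4) ^+ 2 <= e / 4.
  pose a := e / 4 * (c / 4) ^+ 2 / E0.
  have E00 : 0 < E0 by exact: expR_gt0.
  have a0 : 0 < a by rewrite divr_gt0// mulr_gt0// exprn_gt0.
  have a1 : 0 < 1 + a by rewrite addr_gt0.
  exists (ln (1 + a) * (1 - q ^+ 2)); first by rewrite mulr_gt0// ln_gt0// ltrDl.
  rewrite mulfK ?lt0r_neq0// lnK ?posrE// addrAC subrr add0r.
  by rewrite ler_pdivrMr ?exprn_gt0// /a mulrC mulfVK// lt0r_neq0.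
have [K hK] : exists K : nat, forall n, \sum_(1 <= k < n | ~~ (k < K)%N) s k ^+ 2 <= tau.
  have /cvgrPdist_le/(_ _ tau0)[K _ /(_ K (leqnn K)) /= hK] := cS.
  exists K => n; apply: le_trans (le_trans (ler_norm _) hK); rewrite lerBrDr.
  pose m := maxn n K.
  apply: le_trans (leS m); rewrite [leRHS](big_cat_nat (n := K))//=; last exact: leq_maxr.
  rewrite [leLHS]addrC; apply: lerD => //; rewrite [leRHS](@big_nat_widenl _ _ _ K 0)//= (@big_nat_widenl _ _ _ 1 0)//=.
  rewrite (big_nat_widen _ n m) ?leq_maxl// big_mkcond [leRHS]big_mkcond/=.
  apply: ler_sum => k _; rewrite -leqNgt; case: (K <= k)%N => //=.
  by case: ifP => // _; exact: sqr_ge0.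
have sql n (x : {k in @active R s n}) : 0 <= s (label x) <= q.
  by apply: sq; rewrite lt0n; exact: label_neq0.
have full n : finite_kernel (fun x : {k in @active R s n} => s (label x))
    (fun x => alpha (label x)) (fun x => beta (label x)) = reduced_kernel s alpha beta n.
  rewrite -(finite_kernel_reduced s alpha beta (leqnn n)); congr finite_kernel.
  by apply/funext => x; rewrite ltn_ord.
have [N0 hN0] := finite_kernel_lower_tail hX hY hXY (orthonormal_active_alpha hs (n := K))
  (orthonormal_active_beta hs (n := K)) q0 q1 (@sql K) B00 e4.
exists (c / 4) => //; exists N0 => N NN.
(* The choice depends on N: (1 + x)^N <= exp (N x), so an L^1 error x of order 1/N suffices.
   Dividing by N + 1 includes N = 0. *)
have [L KL hL] : exists2 L, (K <= L)%N &
    ((1 + \int[PQ]_z `|xi z - reduced_kernel s alpha beta L z|) ^+ N - 1) / (c / 4) <= e / 4.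
  pose a := e / 4 * (c / 4).
  have a0 : 0 < a by rewrite mulr_gt0.
  have la0 : 0 < ln (1 + a) by rewrite ln_gt0// ltrDl.
  have N1 : 0 < N%:R + 1 :> R by rewrite ltr_wpDl.
  have r0 : 0 < ln (1 + a) / (N%:R + 1) by rewrite divr_gt0.
  have /cvgrPdist_le/(_ _ r0)[L0 _ hL0] := reduced_kernel_cvg hs hxi.
  exists (maxn K L0); first exact: leq_maxl.
  have := hL0 (maxn K L0) (leq_maxr _ _); rewrite /= sub0r normrN => /(le_trans (ler_norm _)).
  set x := (\int[_]_z _) => hx.
  have x0 : 0 <= x by apply: Rintegral_ge0 => z _; exact: normr_ge0.
  rewrite ler_pdivrMr// -/a lerBlDl -[leRHS]lnK ?posrE ?addr_gt0//.
  apply: (@le_trans _ _ (expR x ^+ N)).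
    by rewrite lerXn2r ?nnegrE ?expR_ge0 ?addr_ge0// expR_ge1Dx.
  rewrite -expRM_natl ler_expR; move: hx; rewrite ler_pdivlMr// => hx.
  by apply: le_trans hx; rewrite mulrC ler_wpM2l// lerDl.
have xi_int := sqr_int_int hxi.
have n1 : \int[PQ]_z `|xi z| = 1 by rewrite -xi1; apply: eq_Rintegral => z _; rewrite ger0_norm.
have ev1 := hN0 N NN.
have ev2 := kernel_avg_perturb hX hY hXY N c4 xi_int (reduced_kernel_int hs L).
have ev3 := @kernel_avg_zeroed_chebyshev _ _ _ _ _ _ _ _ _ _ _ hX hY hXY _ _
  (orthonormal_active_alpha hs (n := L)) (orthonormal_active_beta hs (n := L)) N (fun x => s (label x))
  (fun x => if (label x < K)%N then s (label x) else 0) (fun x => label x < K)%N q (c / 4)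
  c4 (ltW q0) q1 (@sql L) (fun=> erefl).
rewrite finite_kernel_reduced// full in ev3; rewrite full in ev1.
rewrite -/PQ n1 expr1n in ev2.
apply: prob_leW (prob_leU ev1 (prob_leU ev2 ev3)) _ _ => [w /= hw|].
  have [|h1] := ltP (kernel_avg X Y (reduced_kernel s alpha beta K) N w) c; first by left.
  right; have [|h2] := leP (c / 4) (`|kernel_avg X Y (reduced_kernel s alpha beta L) N w -
     kernel_avg X Y xi N w|); first by left.
  right; rewrite leNgt; apply/negP => h3.
  by move: h2 h3; rewrite !ltr_norml => /andP[? ?] /andP[? ?]; lra.
have b1 : 2 * (\sum_(x : {k in @active R s K}) s (label x) ^+ 2) / ((1 - q ^+ 2) * B0) +
    4 * (\sum_(x : {k in @active R s K}) s (label x) ^+ 2) / ((1 - q ^+ 2) * B0) ^+ 2 <= e / 4.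
  rewrite B0t; apply: le_trans St.
  have sK : \sum_(x : {k in @active R s K}) s (label x) ^+ 2 <= S.
    rewrite (@sum_labels _ s K predT (fun k => s k ^+ 2)); first exact: leS1.
    by move=> k ->; rewrite expr0n.
  have h1 : 2 * (\sum_(x : {k in @active R s K}) s (label x) ^+ 2) / t <= 2 * S / t.
    by rewrite ler_pM2r ?invr_gt0// ler_pM2l.
  have h2 : 4 * (\sum_(x : {k in @active R s K}) s (label x) ^+ 2) / t ^+ 2 <= 4 * S / t.
    rewrite expr2 invfM mulrA; apply: (@le_trans _ _ (4 * S / t / t)).
      by rewrite !ler_pM2r ?invr_gt0// ler_pM2l.
    by rewrite ler_piMr ?invf_le1// divr_ge0 ?(ltW t0)// mulr_ge0.
  by move: h1 h2; rewrite -!mulrA; lra.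
have b3 : expR ((\sum_(x : {k in @active R s L} | (label x < K)%N) s (label x) ^+ 2) / (1 - q ^+ 2)) *
    (expR ((\sum_(x : {k in @active R s L} | ~~ (label x < K)%N) s (label x) ^+ 2) / (1 - q ^+ 2)) - 1) /
    (c / 4) ^+ 2 <= e / 4.
  apply: le_trans htau; rewrite ler_pM2r ?invr_gt0 ?exprn_gt0//.
  have sF k : s k = 0 -> s k ^+ 2 = 0 by move=> ->; rewrite expr0n.
  rewrite (sum_labels L (fun k => k < K)%N sF) (sum_labels L (fun k => ~~ (k < K))%N sF).
  apply: ler_pM; rewrite ?expR_ge0//.
  - rewrite subr_ge0 -[leLHS]expR0 ler_expR; apply: divr_ge0; last exact: ltW.
    by apply: sumr_ge0 => k _; exact: sqr_ge0.
  - rewrite ler_expR ler_pM2r ?invr_gt0//; apply: le_trans (leS1 L).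
    by rewrite big_mkcond; apply: ler_sum => k _; case: ifP => // _; exact: sqr_ge0.
  - by rewrite lerD2r ler_expR ler_pM2r ?invr_gt0.
by move: b1 b3 hL; lra.
Qed.

End denominator_tail.

(** * Concentration on a fixed event *)

(** Jensen's inequality for the square: the difference of the two sides is a weighted variance. *)
Lemma weighted_mean_sqr_le (R : realFieldType) (J : Type) (r : seq J) (a x : J -> R) :
  (forall j, 0 <= a j) -> 0 < \sum_(j <- r) a j ->
  ((\sum_(j <- r) a j * x j) / \sum_(j <- r) a j) ^+ 2 <=
  (\sum_(j <- r) a j * x j ^+ 2) / \sum_(j <- r) a j.
Proof.
move=> a0 A0; set A := \sum_(j <- r) a j; pose t := (\sum_(j <- r) a j * x j) / A.
have An : A != 0 by exact: lt0r_neq0.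
have : 0 <= \sum_(j <- r) a j * (x j - t) ^+ 2.
  by apply: sumr_ge0 => j _; rewrite mulr_ge0 ?sqr_ge0.
have -> : \sum_(j <- r) a j * (x j - t) ^+ 2 = \sum_(j <- r) a j * x j ^+ 2 - t ^+ 2 * A.
  transitivity (\sum_(j <- r) (a j * x j ^+ 2 - 2 * t * (a j * x j) + t ^+ 2 * a j)).
    by apply: eq_bigr => j _; ring.
  rewrite big_split sumrB -!mulr_sumr -/A /=.
  have -> : \sum_(j <- r) a j * x j = t * A by rewrite /t mulfVK.
  ring.
by rewrite subr_ge0 ler_pdivlMr.
Qed.

Section quotient.
Context d d' (Om : measurableType d) (T : measurableType d') (R : realType).
Variable Pr : probability Om R.
Variables (P Q : probability T R) (X Y : nat -> {RV Pr >-> T}).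
Hypotheses (hX : iid X P) (hY : iid Y Q) (hXY : independent_sequences X Y).
Variables (mu nu0 : probability (T * T)%type R) (xi : {nnfun (T * T)%type >-> R}).
Variables (s : nat -> R) (alpha beta : nat -> T -> R).
Hypotheses (hs : is_singular_system P Q xi s alpha beta) (hgap : spectral_gap s).
Let PQ : probability _ R := (P \x Q)%E.
Hypotheses (hxi : is_density PQ mu xi) (hxi2 : sqr_int PQ xi).

Let xi_ge0 z : 0 <= xi z. Proof. exact: fun_ge0. Qed.
Let xi_int : fin_int PQ xi. Proof. exact: sqr_int_int. Qed.

Let density_indic B : measurable B -> fin_int PQ (fun z => xi z * \1_B z) /\
  \int[PQ]_z (xi z * \1_B z) = fine (mu B).
Proof.
move=> mB; split.
  apply: fin_int_le xi_int _ => [|z].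
    by apply: measurable_funM => //; exact: fin_int_measurable xi_int.
  by rewrite indicE; case: (z \in B); rewrite /= ?mulr1 ?mulr0 ?normr0// ger0_norm.
rewrite hxi.2// integral_mkcond /Rintegral; congr fine; apply: eq_integral => z _.
by rewrite patchE indicE; case: (z \in B); rewrite /= ?mulr1 ?mulr0.
Qed.

Let density_total : \int[PQ]_z xi z = 1.
Proof.
have [_] := density_indic measurableT; rewrite probability_setT/= => <-.
by apply: eq_Rintegral => z _; rewrite indicE in_setT mulr1.
Qed.

Lemma muhat_concentrates (B : set (T * T)) (eta : R) : measurable B -> 0 < eta ->
  vanishing Pr (fun N => [set w | eta <=
    `|fine (muhat xi nu0 N (X ^~ w) (Y ^~ w) B) - fine (mu B)|]).
Proof.
move=> mB eta0 e e0; have e2 : 0 < e / 2 by rewrite divr_gt0.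
have [delta delta0 [N1 hN1]] := kernel_avg_lower_tail hX hY hXY hs hgap hxi2 xi_ge0 density_total e2.
pose m := fine (mu B); pose phi z : R := \1_B z - m.
have [iB IB] := density_indic mB.
have iphi : fin_int PQ (fun z => xi z * phi z).
  under eq_fun do rewrite mulrBr; apply: fin_intB => //.
  by under eq_fun do rewrite mulrC; exact: fin_intZ.
have Iphi : \int[PQ]_z (xi z * phi z) = 0.
  under eq_Rintegral do rewrite mulrBr.
  rewrite RintegralB//; last by under eq_fun do rewrite mulrC; exact: fin_intZ.
  by rewrite RintegralZr// density_total mul1r IB subrr.
have mphi : measurable_fun setT phi by apply: measurable_funB.
have iphi2 : fin_int PQ (fun z => xi z * phi z ^+ 2).
  apply: (fin_int_le (g := fun z => (1 + `|m|) ^+ 2 * xi z)) => [||z].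
  - apply: measurable_funM; first exact: fin_int_measurable xi_int.
    exact: measurable_funX.
  - exact: fin_intZ.
  rewrite normrM ger0_norm// mulrC ler_wpM2r// normrX lerXn2r ?nnegrE ?addr_ge0//.
  apply: le_trans (ler_normB _ _) _; rewrite lerD2r indicE ger0_norm// lern1.
  exact: leq_b1.
pose v := \int[PQ]_z (xi z * phi z ^+ 2).
have v0 : 0 <= v by apply: Rintegral_ge0 => z _; rewrite mulr_ge0 ?sqr_ge0.
have t0 : 0 < eta ^+ 2 * delta by rewrite mulr_gt0 ?exprn_gt0.
(* The last bound makes E V_N / (eta^2 delta), which is v / (N eta^2 delta), at most e / 2; the
   other half of e pays for small denominators. *)
exists (maxn N1 (maxn 1 (Num.bound (v / (eta ^+ 2 * delta) / (e / 2))))) => N.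
rewrite !geq_max => /and3P[NN1 N_gt0 NN2].
have fact0 : 0 < N`!%:R :> R by rewrite ltr0n fact_gt0.
have ifact0 : 0 <= N`!%:R^-1 :> R by rewrite invr_ge0 ltW.
have NR : 0 < N%:R :> R by rewrite ltr0n.
pose S sig w : R := (\sum_(i < N) phi (matched_pair X Y sig i w)) / N%:R.
pose W sig w : R := \prod_(i < N) xi (matched_pair X Y sig i w).
have W0 sig w : 0 <= W sig w by apply: prodr_ge0.
have var sig := weighted_mean_sqr (indep_with_matched_pair hX hY hXY sig) N_gt0
  xi_int density_total iphi Iphi iphi2.
have iV sig : fin_int Pr (fun w => W sig w * S sig w ^+ 2) by case: (var sig).
have V0 sig w : 0 <= W sig w * S sig w ^+ 2 by rewrite mulr_ge0 ?sqr_ge0.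
have ev := markov_ineq t0 (fin_intZ N`!%:R^-1 (fin_int_sum (index_enum 'S_N) predT iV))
  (fun w => mulr_ge0 ifact0 (sumr_ge0 _ (fun sig _ => V0 sig w))).
apply: prob_leW (prob_leU (hN1 N NN1) ev) _ _ => [w /= hw|].
  have [|den] := ltP (kernel_avg X Y xi N w) delta; [by left|right].
  have den0 := lt_le_trans delta0 den.
  have sumW : 0 < \sum_(sig : 'S_N) W sig w.
    by move: den0; rewrite /kernel_avg pmulr_rgt0 ?invr_gt0.
  have E : fine (muhat xi nu0 N (X ^~ w) (Y ^~ w) B) - m =
      (\sum_(sig : 'S_N) W sig w * S sig w) / \sum_(sig : 'S_N) W sig w.
    have dn : muhat_den xi N (X ^~ w) (Y ^~ w) != 0 by exact: lt0r_neq0.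
    rewrite /muhat (negPf dn) gtn_eqF//= /muhat_num.
    pose b sig : R := N%:R^-1 * \sum_(i < N) \1_B (matched_pair X Y sig i w).
    have bS sig : S sig w = b sig - m.
      rewrite /S /b sumrB sumr_const card_ord -[m *+ N]mulr_natl mulrBl mulrC; congr (_ - _).
      by rewrite mulrC mulKf// lt0r_neq0.
    rewrite (eq_bigr (fun sig => (W sig w * b sig)%:E)) => [|sig _]; last first.
      rewrite EFinM; congr (_ * _)%E; rewrite /b EFinM -sumEFin; congr (_ * _)%E.
    rewrite sumEFin -!EFinM /=.
    have -> : muhat_den xi N (X ^~ w) (Y ^~ w) = N`!%:R^-1 * \sum_(sig : 'S_N) W sig w by [].
    have -> : \sum_(sig : 'S_N) W sig w * S sig w =
        \sum_(sig : 'S_N) W sig w * b sig - (\sum_(sig : 'S_N) W sig w) * m.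
      by rewrite mulr_suml -sumrB; apply: eq_bigr => sig _; rewrite bS mulrBr.
    field; rewrite lt0r_neq0//=; exact: lt0r_neq0.
  move: hw; rewrite E => hw.
  have h1 := weighted_mean_sqr_le (fun sig => S sig w) (fun sig => W0 sig w) sumW.
  have h2 : eta ^+ 2 <= ((\sum_(sig : 'S_N) W sig w * S sig w) / \sum_(sig : 'S_N) W sig w) ^+ 2.
    by rewrite -[leRHS](real_normK (num_real _)) lerXn2r ?nnegrE// ltW.
  have := le_trans h2 h1; rewrite ler_pdivlMr// => h3.
  apply: (@le_trans _ _ (eta ^+ 2 * kernel_avg X Y xi N w)).
    by rewrite ler_pM2l ?exprn_gt0.
  by rewrite /kernel_avg mulrCA ler_wpM2l.
rewrite [leRHS](_ : e = e / 2 + e / 2); last by lra.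
rewrite lerD2l RintegralZl//; last exact: fin_int_sum.
rewrite Rintegral_sum// (eq_bigr (fun=> v / N%:R)) => [|sig _]; last by case: (var sig).
rewrite sumr_const card_Sn -(mulr_natl (v / N%:R)) mulKf ?lt0r_neq0//.
rewrite mulrAC ler_pdivrMr// [e / 2 * _]mulrC -ler_pdivrMr//; apply: ltW.
apply: lt_le_trans (archi_boundP _) _; last by rewrite ler_nat.
by rewrite !divr_ge0// ltW.
Qed.

End quotient.

(** * Weak convergence *)

Section countable_base.
Context (R : realType) (d : nat).
Let E : Type := ('rV[R]_d * 'rV[R]_d)%type.

Let radius n : R := n.+1%:R^-1.

Let radius_gt0 n : 0 < radius n. Proof. by rewrite invr_gt0 ltr0n. Qed.

Let rat_ball (x : 'rV[R]_d) (e : R) : 0 < e ->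
  exists q : 'rV[rat]_d, ball (map_mx ratr q : 'rV[R]_d) e x.
Proof.
move=> e0; have /choice[q hq] : forall j : 'I_d, exists q : rat, `|ratr q - x ord0 j| < e.
  move=> j; have [|q] := @rat_in_itvoo R (x ord0 j - e) (x ord0 j + e).
    by rewrite ltrD2l gtrN.
  by rewrite in_itv/= -ltr_distl => h; exists q.
by exists (\row_j q j); split=> // i j; rewrite !mxE ord1; exact: hq.
Qed.

(** Products of open sets, through interiors, hence measurable for the product sigma-algebra, and
    countably many. *)
Definition base_set (i : 'rV[rat]_d * 'rV[rat]_d * nat) : set E :=
  (ball (map_mx ratr i.1.1 : 'rV[R]_d) (radius i.2))^° `*`
  (ball (map_mx ratr i.1.2 : 'rV[R]_d) (radius i.2))^°.

Lemma measurable_base_set i : measurable (base_set i).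
Proof.
by apply: measurableX; apply: sub_sigma_algebra; exact: open_interior.
Qed.

Lemma base_setP (G : set E) z : open G -> G z -> exists2 i, base_set i z & base_set i `<=` G.
Proof.
move=> oG Gz; have /nbhs_ballP[e /= e0 eG] : nbhs z G by exact: open_nbhs_nbhs.
have [n hn] : exists n, radius n * 2 <= e.
  exists (Num.bound (2 / e)); rewrite /radius mulrC ler_pdivrMr ?ltr0n// mulrC -ler_pdivrMr//.
  apply: ltW; apply: lt_le_trans (archi_boundP _) _; first by rewrite divr_ge0// ltW.
  by rewrite ler_nat.
have r2 : 0 < radius n / 2 by rewrite divr_gt0.
have [q1 hq1] := rat_ball z.1 r2; have [q2 hq2] := rat_ball z.2 r2.
have int (q : 'rV[R]_d) x : ball q (radius n / 2) x -> (ball q (radius n))^° x.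
  move=> qx; apply/nbhs_ballP; exists (radius n / 2) => // y xy.
  by have := ball_triangle qx xy; rewrite -splitr.
have sub (q x y : 'rV[R]_d) : ball q (radius n / 2) x -> (ball q (radius n))^° y -> ball x e y.
  move=> qx /interior_subset qy; have := ball_triangle (ball_sym qx) qy.
  by apply: le_ball; apply: le_trans hn; have := radius_gt0 n; lra.
exists (q1, q2, n); first by split; exact: int.
by move=> y [/= /(sub _ _ _ hq1) h1 /(sub _ _ _ hq2) h2]; apply: eG.
Qed.

(** Finite lists of base sets are numbered by their codes; a number that codes no list gives the
    empty set. *)
Definition finite_base_union (k : nat) : set E :=
  if choice.unpickle k is Some l
  then \bigcup_(i in [set` (l : seq ('rV[rat]_d * 'rV[rat]_d * nat))]) base_set i
  else set0.

Lemma measurable_finite_base_union k : measurable (finite_base_union k).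
Proof.
rewrite /finite_base_union; case: choice.unpickle => // l.
by apply: fin_bigcup_measurable => // i _; exact: measurable_base_set.
Qed.

(** An open set is the increasing union of the finite unions of those base sets it contains. This
    gives both its measurability in the product sigma-algebra and the approximation of its mass. *)
Lemma open_inner_approx (mu : probability E R) (G : set E) (e : R) : open G -> 0 < e ->
  measurable G /\
  exists2 k, finite_base_union k `<=` G & fine (mu G) - e <= fine (mu (finite_base_union k)).
Proof.
move=> oG e0.
pose I n : seq ('rV[rat]_d * 'rV[rat]_d * nat) :=
  [seq i <- pmap choice.unpickle (iota 0 n) | `[< base_set i `<=` G >]].
pose F n := \bigcup_(i in [set` I n]) base_set i.
have mF n : measurable (F n).
  by apply: fin_bigcup_measurable => // i _; exact: measurable_base_set.
have FG n : F n `<=` G.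
  by move=> z [i /=]; rewrite mem_filter => /andP[/asboolP h _]; exact: h.
have UF : \bigcup_n F n = G.
  apply/seteqP; split => [z [n _]|z Gz]; first exact: FG.
  have [i iz iG] := base_setP oG Gz.
  exists (choice.pickle i).+1 => //; exists i => //=; rewrite mem_filter.
  apply/andP; split; first exact/asboolP.
  rewrite mem_pmap; apply/mapP; exists (choice.pickle i); last exact: (esym (choice.pickleK i)).
  by rewrite mem_iota add0n/=.
have mG : measurable G by rewrite -UF; exact: bigcup_measurable.
split=> //.
have ndF : nondecreasing_seq F.
  move=> m n mn; apply/subsetPset => z [i /=]; rewrite mem_filter => /andP[iG].
  rewrite mem_pmap => /mapP[j]; rewrite mem_iota/= add0n => jm ij zi.
  exists i => //=; rewrite mem_filter iG mem_pmap; apply/mapP; exists j => //.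
  by rewrite mem_iota/= add0n (leq_trans jm).
have H : mu \o F @ \oo --> (fine (mu G))%:E.
  rewrite fineK ?fin_num_measure// -UF.
  exact: nondecreasing_cvg_mu (bigcup_measurable (fun n _ => mF n)) ndF.
have [_ /cvgrPdist_le/(_ _ e0)[n _ /(_ n (leqnn n)) /= h]] := iffLR (fine_cvgP _ _) H.
have E1 : finite_base_union (choice.pickle (I n)) = F n by rewrite /finite_base_union choice.pickleK.
exists (choice.pickle (I n)); rewrite E1; first exact: FG.
by rewrite lerBlDr -lerBlDl; apply: le_trans (ler_norm _) h.
Qed.

End countable_base.

Section step_functions.
Context (R : realFieldType).

(** For 0 < a <= n this is the ceiling of a minus one, hence within 1 below a. *)
Let count_below (a : R) n := \sum_(1 <= j < n.+1) (j%:R < a)%R%:R : R.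

Let count_belowS a n : count_below a n.+1 = count_below a n + (n.+1%:R < a)%R%:R.
Proof. by rewrite /count_below big_nat_recr. Qed.

Let count_below_le_n a n : count_below a n <= n%:R.
Proof.
elim: n => [|n IH]; first by rewrite /count_below big_geq.
by rewrite count_belowS -natr1 lerD// lern1 leq_b1.
Qed.

Lemma count_below_le (a : R) n : 0 <= a -> \sum_(1 <= j < n.+1) (j%:R < a)%R%:R <= a.
Proof.
move=> a0; rewrite -/(count_below a n); elim: n => [|n IH].
  by rewrite /count_below big_geq.
rewrite count_belowS; case: ltP => h; last by rewrite addr0.
by apply: le_trans (ltW h); rewrite -[in leRHS]natr1 lerD// count_below_le_n.
Qed.

Lemma count_below_ge (a : R) n : a <= n%:R -> a <= 1 + \sum_(1 <= j < n.+1) (j%:R < a)%R%:R.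
Proof.
rewrite -/(count_below a n); elim: n => [|n IH] h.
  by rewrite /count_below big_geq// addr0 (le_trans h).
rewrite count_belowS; have [an|na] := leP a n%:R.
  by apply: le_trans (IH an) _; rewrite lerD2l lerDl.
apply: le_trans h _; rewrite -natr1 addrC lerD2l.
apply: (@le_trans _ _ (count_below a n)); last by rewrite lerDl.
rewrite /count_below big_nat (eq_bigr (fun=> 1)) => [|j /andP[j1 jn]]; last first.
  by rewrite (le_lt_trans _ na)// ler_nat.
by rewrite -big_nat sumr_const_nat subSS subn0.
Qed.

End step_functions.

Section weak_convergence_test.
Context (R : realType) (d : nat).
Let E : Type := ('rV[R]_d * 'rV[R]_d)%type.
Implicit Types (mu nu : probability E R).

Let level (f : E -> R) (t : R) : set E := [set z | t < f z].

Let open_level (f : E -> R) t : continuous f -> open (level f t).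
Proof. by move=> cf; apply: (open_comp (D := [set x | t < x])) => // z _; exact: cf. Qed.

Let measurable_continuous (f : E -> R) : continuous f -> measurable_fun setT f.
Proof.
move=> cf; apply: (measurability _ (RGenOInfty.measurableE R)) => _ [_ [x ->] <-].
rewrite setTI (_ : _ @^-1` _ = level f x).
  (* The Dirac mass is a mere witness: only measurability of the open level set is extracted. *)
  by case: (open_inner_approx \d_((0, 0) : E) (@open_level f x cf) ltr01).
by apply/seteqP; split => z; rewrite /= in_itv/= andbT.
Qed.

Let Rintegral_indic mu A : measurable A -> \int[mu]_z \1_A z = fine (mu A).
Proof. by move=> mA; rewrite /Rintegral integral_indic// setIT. Qed.

(** One half of the portmanteau theorem: inner approximation gives a lower bound on the limiting
    mass of open sets, and f is within one step above a step function built from its open level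
    sets. *)
Lemma lower_integral_limit (nu_ : nat -> probability E R) mu (f : E -> R) (C e : R) :
  (forall k, fine (nu_ n (@finite_base_union R d k)) @[n --> \oo] -->
             fine (mu (@finite_base_union R d k))) ->
  continuous f -> (forall z, `|f z| <= C) -> 0 < e ->
  \forall n \near \oo, \int[mu]_z f z - e <= \int[nu_ n]_z f z.
Proof.
move=> cvF cf fC e0; have h0 : 0 < e / 2 by rewrite divr_gt0.
have C0 : 0 <= C by apply: le_trans (fC (0, 0)).
(* Steps of height [h], with n h >= 2 C to cover the range of f. The step costs [h]; the masses of
   the n levels lose at most [delta] each, in all at most 1, which costs another [h]. *)
pose h := e / 2; pose n := Num.bound (2 * C / h).
have nC : 2 * C / h <= n%:R by rewrite ltW// archi_boundP// divr_ge0 ?mulr_ge0// ltW.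
pose G j := level f (j%:R * h - C).
have oG j : open (G j) by exact: open_level.
have mG j : measurable (G j) by case: (open_inner_approx mu (oG j) ltr01).
pose st z : R := \sum_(1 <= j < n.+1) \1_(G j) z.
have stE z : st z = \sum_(1 <= j < n.+1) (j%:R < (f z + C) / h)%R%:R.
  apply: eq_bigr => j _; rewrite indicE; congr (_%:R); congr nat_of_bool.
  have -> : (z \in G j) = (j%:R * h - C < f z) by apply/idP/idP => [|?]; rewrite inE.
  by rewrite ltrBlDr ltr_pdivlMr.
have fzC z : - C <= f z <= C by rewrite -ler_norml.
have st_le z : h * st z - C <= f z.
  rewrite lerBlDr mulrC -ler_pdivlMr// stE; apply: count_below_le.
  by rewrite divr_ge0 ?(ltW h0)//; case/andP: (fzC z); lra.
have st_ge z : f z <= h * st z - C + h.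
  have := @count_below_ge _ ((f z + C) / h) n; rewrite -stE => /(_ _) hz.
  have {}hz : (f z + C) / h <= 1 + st z.
    by apply: hz; apply: le_trans nC; rewrite ler_pM2r ?invr_gt0//; case/andP: (fzC z); lra.
  by move: hz; rewrite ler_pdivrMr//; lra.
have ist nu : fin_int nu st.
  by apply: fin_int_sum => j; apply: integrable_indic.
have ifn nu : fin_int nu f.
  by apply: (fin_int_le (measurable_continuous cf) (fin_int_cst nu C)).
have ih nu : fin_int nu (fun z => h * st z - C).
  by apply: fin_intB; [exact: fin_intZ|exact: fin_int_cst].
have Ist nu : \int[nu]_z (h * st z - C) = h * (\sum_(1 <= j < n.+1) fine (nu (G j))) - C.
  rewrite (RintegralB measurableT (fin_intZ h (ist nu)) (fin_int_cst nu C)).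
  rewrite (RintegralZl h measurableT (ist nu)) (Rintegral_cst_prob nu) Rintegral_sum => [|j]; last exact: integrable_indic.
  by congr (_ * _ - _); apply: eq_bigr => j _; exact: Rintegral_indic.
have lo nu : h * (\sum_(1 <= j < n.+1) fine (nu (G j))) - C <= \int[nu]_z f z.
  by rewrite -Ist; apply: (le_Rintegral measurableT (ih nu) (ifn nu)) => z _; exact: st_le.
have hi nu : \int[nu]_z f z <= h * (\sum_(1 <= j < n.+1) fine (nu (G j))) - C + h.
  have := RintegralD measurableT (ih nu) (fin_int_cst nu h).
  rewrite (Rintegral_cst_prob nu h) Ist => <-.
  apply: (le_Rintegral measurableT (ifn nu) (fin_intD (ih nu) (fin_int_cst nu h))) => z _.
  exact: st_ge.
pose delta : R := (n%:R + 1)^-1.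
have n1 : 0 < n%:R + 1 :> R by rewrite ltr_wpDl.
have d0 : 0 < delta by rewrite invr_gt0.
have d2 : 0 < delta / 2 by rewrite divr_gt0.
have /choice[Nf hNf] : forall j : nat, exists N0 : nat, forall m, (N0 <= m)%N ->
    fine (mu (G j)) - delta <= fine (nu_ m (G j)).
  move=> j; have [_ [k kG hk]] := open_inner_approx mu (oG j) d2.
  have /cvgrPdist_le/(_ _ d2)[N0 _ hN0] := cvF k; exists N0 => m /hN0 /= hm.
  have : fine (nu_ m (@finite_base_union R d k)) <= fine (nu_ m (G j)).
    rewrite fine_le ?fin_num_measure//; last first.
      by apply: le_measure => //; rewrite inE//; exact: measurable_finite_base_union.
    exact: measurable_finite_base_union.
  by move: hk hm; rewrite ler_norml => hk /andP[_ hm]; lra.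
exists (\max_(j < n.+1) Nf j)%N => // m /= Nm.
apply: le_trans (lo (nu_ m)); have := hi mu.
have : \sum_(1 <= j < n.+1) fine (mu (G j)) - 1 <= \sum_(1 <= j < n.+1) fine (nu_ m (G j)).
  apply: (@le_trans _ _ (\sum_(1 <= j < n.+1) (fine (mu (G j)) - delta))).
    rewrite sumrB lerD2l lerN2 sumr_const_nat subSS subn0 -mulr_natr /delta.
    by rewrite mulrC ler_pdivrMr// mul1r lerDl.
  rewrite !big_add1/= !big_mkord; apply: ler_sum => j _; apply: hNf.
  apply: leq_trans Nm; have jn : (j.+1 < n.+1)%N by rewrite ltnS.
  exact: (leq_bigmax (Ordinal jn)).
move=> hs hmu; have : h * (\sum_(1 <= j < n.+1) fine (mu (G j)) - 1) <=
    h * \sum_(1 <= j < n.+1) fine (nu_ m (G j)) by rewrite ler_wpM2l// ltW.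
by rewrite /h in hmu *; lra.
Qed.

(** The lower bound is applied to f and to - f. *)
Lemma cvg_weakly_finite_base_union (nu_ : nat -> probability E R) mu :
  (forall k, fine (nu_ n (@finite_base_union R d k)) @[n --> \oo] -->
             fine (mu (@finite_base_union R d k))) ->
  cvg_weakly nu_ mu.
Proof.
move=> cvF f cf [M [_ fM]]; pose C := `|M| + 1.
have fC z : `|f z| <= C by apply: fM => //; rewrite (le_lt_trans (ler_norm _))// ltrDl.
apply/cvgrPdist_le => e e0.
have cfN : continuous (fun z => - f z) by move=> z; apply: cvgN; exact: cf.
have fCN z : `|- f z| <= C by rewrite normrN.
have i nu : fin_int nu f by apply: (fin_int_le (measurable_continuous cf) (fin_int_cst nu C)).
have N nu : \int[nu]_z - f z = - \int[nu]_z f z.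
  have := RintegralZl (-1) measurableT (i nu); rewrite mulN1r => <-.
  by apply: eq_Rintegral => z _; rewrite mulN1r.
near=> n.
have h1 : \int[mu]_z f z - e <= \int[nu_ n]_z f z.
  by near: n; exact: lower_integral_limit cvF cf fC e0.
have h2 : \int[mu]_z - f z - e <= \int[nu_ n]_z - f z.
  by near: n; exact: lower_integral_limit cvF cfN fCN e0.
by rewrite ler_norml; move: h2; rewrite !N; lra.
Unshelve. all: by end_near. Qed.

(** If every test failed, some measures passing the m-th test would stay at distance [eps] from
    [mu]; yet along them every mass in the list converges, so they converge weakly to [mu]. *)
Lemma metric_finite_test rho mu (eps : R) : metrizes_weak_cvg rho -> 0 < eps ->
  exists m : nat, forall nu, (forall k : 'I_m,
    `|fine (nu (@finite_base_union R d k)) - fine (mu (@finite_base_union R d k))| < m.+1%:R^-1) ->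
  rho nu mu < eps.
Proof.
move=> hrho eps0; apply: contrapT => /forallNP H.
have /choice[nu_ hnu] : forall m : nat, exists nu : probability E R, (forall k : 'I_m,
    `|fine (nu (@finite_base_union R d k)) - fine (mu (@finite_base_union R d k))| < m.+1%:R^-1) /\
    eps <= rho nu mu.
  move=> m; have /existsNP[nu /not_implyP[h1 h2]] := H m; exists nu; split => //.
  by rewrite leNgt; exact/negP.
have /(mw_cvg hrho)/cvgrPdist_lt/(_ _ eps0)[n _ /(_ n (leqnn n))] : cvg_weakly nu_ mu.
  apply: cvg_weakly_finite_base_union => k; apply/cvgrPdist_le => e e0.
  near=> n.
  have kn : (k < n)%N by near: n; exact: nbhs_infty_gt.
  have en : n.+1%:R^-1 <= e.
    rewrite -[leRHS]invrK lef_pV2 ?posrE ?invr_gt0// ltW//.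
    apply: lt_le_trans (archi_boundP _) _; first by rewrite invr_ge0 ltW.
    by rewrite ler_nat; near: n; exists (Num.bound e^-1) => // n /= /leqW.
  rewrite distrC; apply: le_trans en; apply: ltW.
  by have [h _] := hnu n; exact: (h (Ordinal kn)).
rewrite /= sub0r normrN ger0_norm ?(mw_ge0 hrho)// ltNge.
by have [_ ->] := hnu n.
Unshelve. all: by end_near. Qed.

End weak_convergence_test.

Lemma vanishing_mu_ext d (Om : measurableType d) (R : realType) (Pr : probability Om R)
    (E : nat -> set Om) :
  vanishing Pr E -> (fun n => mu_ext Pr (E n)) @ \oo --> 0%E.
Proof.
move=> hE; have le_ext n e : prob_le Pr (E n) e -> (mu_ext Pr (E n) <= e%:E)%E.
  move=> [A mA [EA Ae]]; apply: le_trans (le_mu_ext Pr EA) _.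
  by rewrite measurable_mu_extE.
apply/fine_cvgP; split.
  have [N0 hN0] := hE 1 ltr01; exists N0 => // n /= /hN0/le_ext h.
  by rewrite ge0_fin_numE ?mu_ext_ge0// (le_lt_trans h)// ltry.
apply/cvgrPdist_le => e e0; have [N0 hN0] := hE e e0; exists N0 => // n /= /hN0/le_ext h.
have f0 : (0 <= mu_ext Pr (E n))%E by exact: mu_ext_ge0.
rewrite sub0r normrN ger0_norm ?fine_ge0// -lee_fin fineK//.
by rewrite ge0_fin_numE// (le_lt_trans h)// ltry.
Qed.
Theorem theorem1 (R : realType) (d : nat)
  (P Q : probability 'rV[R]_d R)
  (mu : probability ('rV[R]_d * 'rV[R]_d)%type R)
  (hmu : is_coupling P Q mu)
  (xi : {nnfun ('rV[R]_d * 'rV[R]_d)%type >-> R})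
  (hxi : is_density (P \x Q)%E mu xi)
  (hxi2 : (xi : _ -> R) \in Lfun (P \x Q)%E 2%:E)
  (s : nat -> R) (alpha beta : nat -> 'rV[R]_d -> R)
  (hs : is_singular_system P Q xi s alpha beta)
  (hgap : spectral_gap s)
  (disp : measure_display) (Om : measurableType disp) (Pr : probability Om R)
  (X Y : nat -> {RV Pr >-> 'rV[R]_d})
  (hX : iid X P) (hY : iid Y Q) (hXY : independent_sequences X Y)
  (nu0 : probability ('rV[R]_d * 'rV[R]_d)%type R)
  (rho : probability ('rV[R]_d * 'rV[R]_d)%type R ->
         probability ('rV[R]_d * 'rV[R]_d)%type R -> R)
  (hrho : metrizes_weak_cvg rho) :
  cvg_in_probability Pr
    (fun N w => rho (muhat_prob xi nu0 N (X ^~ w) (Y ^~ w)) mu) 0.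
Proof.
have hxi2' : sqr_int ((P \x Q)%E : probability _ R) xi by apply/sqr_intP.
move=> eps eps0; have [m hm] := metric_finite_test mu hrho eps0.
have m0 : 0 < m.+1%:R^-1 :> R by rewrite invr_gt0 ltr0n.
apply: vanishing_mu_ext => e e0.
have V := vanishing_bigcup (fun k : 'I_m => muhat_concentrates hX hY hXY nu0 hs hgap hxi hxi2'
  (@measurable_finite_base_union R d k) m0).
have [N0 hN0] := V e e0; exists N0 => N /hN0 h; apply: prob_leW h _ _ => // w /=.
rewrite subr0 ger0_norm ?(mw_ge0 hrho)// => rho_ge; apply: contrapT => none.
move: rho_ge; rewrite leNgt => /negP; apply; apply: hm => k.
by rewrite ltNge; apply/negP => hk; apply: none; exists k.
Qed.
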